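(* Let $\mathbb{A}_n$ be the linearly oriented quiver $n\to n-1\to\cdots\to1$, let $H^0=\mathrm{Hom}_{\mathcal{C}_{\mathbb{A}_n}}(\bigoplus_iP_i,-):\mathcal{C}_{\mathbb{A}_n}\to\mathrm{mod}\,k\mathbb{A}_n$, and let $M$ and $N$ be indecomposable objects of $\mathcal{C}_{\mathbb{A}_n}$ such that $\mathrm{Ext}^1_{\mathcal{C}_{\mathbb{A}_n}}(M,N)$ is one-dimensional. Let $U$ and $U'$ be the unique objects such that there exist non-split triangles $$N\to U\to M\to N[1]\quad\text{and}\quad M\to U'\to N\to M[1].$$ (a) If $N$ and $M$ are modules such that $\mathrm{Hom}_{k\mathbb{A}_n}(M,N)=0$, then there exist modules $U_3,U_4$ such that $H^0(U')=U_3\oplus U_4$ and $$X_NX_M=X_U+X_{U'}\,y^{\underline{\dim}M-\underline{\dim}U_3}\,z^{\underline{\dim}N-\underline{\dim}U_4}.$$ (b) If $M=P_i[1]$ and $N$ is an indecomposable module, then $$X_NX_M=X_U\,y^{\underline{\dim}N-\underline{\dim}H^0U}+X_{U'}\,z^{\underline{\dim}N-\underline{\dim}H^0U'}.$$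
   Context: Let $k$ be an algebraically closed field. $\mathcal{C}_Q$ denotes the cluster category of an acyclic quiver $Q$ with vertices $1,\dots,n$, i.e. the orbit category of $\mathcal{D}^b(\mathrm{mod}\,kQ)$ by $\tau^{-1}[1]$, where $\tau$ is the Auslander–Reiten translation and $[1]$ the shift. $P_i$ is the indecomposable projective module at vertex $i$; for $\mathbb{A}_n$ as in the claim, $P_1$ is simple. For Dynkin $Q$, the indecomposable objects of $\mathcal{C}_Q$ are the indecomposable $kQ$-modules and the $P_i[1]$. $\underline{\dim}$ denotes the dimension vector. The cluster character with coefficients $X_?:\mathrm{obj}\,\mathcal{C}_Q\to\mathbb{Q}(x_1,\dots,x_n,y_1,\dots,y_n,z_1,\dots,z_n)$ is the map with $X_{M\oplus N}=X_MX_N$, $X_{P_i[1]}=x_i$, and, for an indecomposable $kQ$-module $V$ with dimension vector $d=(d_1,\dots,d_n)$, $$X_V=\sum_{0\le e\le d}\chi(\mathrm{Gr}_e(V))\prod_{r=1}^n x_r^{-\langle e,\alpha_r\rangle-\langle\alpha_r,d-e\rangle}\,y_r^{e_r}z_r^{d_r-e_r},$$ where $\mathrm{Gr}_e(V)$ is the Grassmannian of submodules of $V$ of dimension vector $e$, $\chi$ the Euler characteristic, $\alpha_r$ the dimension vector of the simple $S_r$, and $\langle\ ,\ \rangle$ the Euler form. For an integer vector $v=(v_1,\dots,v_n)$, $y^v=\prod_ry_r^{v_r}$ and $z^v=\prod_rz_r^{v_r}$.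
   Formalization: Part (a) additionally assumes Ext^1_{kA_n}(N,M)=0, so that N→U→M comes from a short exact sequence; as printed (a) fails, e.g. n=2, M=S_1, N=S_2, where X_N X_M = X_{P_2} + y_2 z_1 with U=0, U'=P_2. *)

(* Defs.v *)
From HB Require Import structures.
From mathcomp Require Import all_boot all_order all_algebra.
From mathcomp Require Import zify.
From mathcomp Require Import mpoly.

Set Implicit Arguments.
Unset Strict Implicit.
Unset Printing Implicit Defensive.

Import Order.TTheory GRing.Theory Num.Theory.
Local Open Scope ring_scope.

Record quiver (n : nat) := Quiver {
  arrow : finType;
  src : arrow -> 'I_n;
  tgt : arrow -> 'I_n }.

(* The vertex r : 'I_n stands for the vertex r + 1 of n -> n-1 -> ... -> 1. *)
Definition linA (n : nat) : quiver n :=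
  @Quiver n {p : 'I_n * 'I_n | val p.1 == (val p.2).+1}
    (fun a => (val a).1) (fun a => (val a).2).

(* Modules over kQ are representations of Q on coordinate spaces, with
   matrices acting on row vectors: x in V_(src a) goes to x *m V_a. *)
Record rep (k : fieldType) (n : nat) (Q : quiver n) := Rep {
  rdim :> 'I_n -> nat;
  ract : forall a : arrow Q, 'M[k]_(rdim (src a), rdim (tgt a)) }.

Record rmor (k : fieldType) (n : nat) (Q : quiver n) (V W : rep k Q) := RMor {
  rmx :> forall v, 'M[k]_(V v, W v);
  rmxP : forall a : arrow Q,
    ract V a *m rmx (tgt a) = rmx (src a) *m ract W a }.

Section Representations.
Variables (k : fieldType) (n : nat) (Q : quiver n).
Implicit Types V W U : rep k Q.

Definition rid V : rmor V V.
Proof. by exists (fun=> 1%:M) => a; rewrite mulmx1 mul1mx. Defined.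

Definition rcomp V W U (g : rmor W U) (f : rmor V W) : rmor V U.
Proof.
exists (fun v => f v *m g v) => a.
by rewrite mulmxA rmxP -mulmxA rmxP mulmxA.
Defined.

Definition rmor0 V W : rmor V W.
Proof. by exists (fun=> 0) => a; rewrite mulmx0 mul0mx. Defined.

Definition ropp V W (f : rmor V W) : rmor V W.
Proof. by exists (fun v => - f v) => a; rewrite mulmxN mulNmx rmxP. Defined.

Definition rep0 : rep k Q := @Rep k n Q (fun=> 0%N) (fun=> 0).

Definition rsum V W : rep k Q :=
  @Rep k n Q (fun v => (V v + W v)%N) (fun a => block_mx (ract V a) 0 0 (ract W a)).

Definition rzero V : Prop := forall v, V v = 0%N.

Definition riso V W : Prop :=
  exists (f : rmor V W) (g : rmor W V),
    forall v, f v *m g v = 1%:M /\ g v *m f v = 1%:M.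

Definition rindecomposable V : Prop :=
  ~ rzero V /\
  forall W W', riso V (rsum W W') -> rzero W \/ rzero W'.

Definition dimvec V : 'rV[int]_n := \row_v (V v)%:Z.

Definition euler_form (d e : 'rV[int]_n) : int :=
  \sum_v d 0 v * e 0 v - \sum_(a : arrow Q) d 0 (src a) * e 0 (tgt a).

End Representations.

Section EulerCharacteristic.
Variable k : fieldType.

Definition kset (N : nat) := 'rV[k]_N -> Prop.

(* First-order definable; for algebraically closed k this means constructible,
   by elimination of quantifiers. *)
Definition constructible N (X : kset N) : Prop :=
  exists f : GRing.formula k,
    forall x, X x <-> GRing.holds [seq x 0 j | j <- enum 'I_N] f.

(* An Euler characteristic (with compact supports) of constructible sets over k.
   The compactly supported l-adic Euler characteristic satisfies these
   properties in every characteristic, as does the topological one when k is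
   the field of complex numbers; both agree with the ordinary Euler
   characteristic on projective varieties such as quiver Grassmannians. *)
Record euler_characteristic (chi : forall N, kset N -> int) : Prop := {
  chi_point : forall N (x : 'rV[k]_N), chi N (fun y => y = x) = 1;
  chi_line : chi 1%N (fun=> True) = 1;
  chi_union : forall N (X Y : kset N), constructible X -> constructible Y ->
    (forall x, X x -> Y x -> False) ->
    chi N (fun x => X x \/ Y x) = chi N X + chi N Y;
  chi_prod : forall N M (X : kset N) (Y : kset M),
    constructible X -> constructible Y ->
    chi (N + M)%N (fun z => X (lsubmx z) /\ Y (rsubmx z)) = chi N X * chi M Y;
  chi_bij : forall N M (X : kset N) (Y : kset M) (G : kset (N + M)),
    constructible X -> constructible Y -> constructible G ->
    (forall x, X x -> exists! y, Y y /\ G (row_mx x y)) ->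
    (forall y, Y y -> exists! x, X x /\ G (row_mx x y)) ->
    chi N X = chi M Y }.

Definition reduced_echelon m d (A : 'M[k]_(m, d)) : Prop :=
  exists p : 'I_m -> 'I_d,
    (forall i j : 'I_m, (i < j)%N -> (p i < p j)%N) /\
    forall i, (forall j : 'I_d, (j < p i)%N -> A i j = 0) /\
              (forall i' : 'I_m, A i' (p i) = (i' == i)%:R).

(* A point of Gr_e(V) is a family of subspaces U_v of V_v of dimension e_v with
   U_(src a) V_a contained in U_(tgt a). Each U_v is recorded by its unique
   basis in reduced echelon form, i.e. by its coordinates in the Schubert cell
   that contains it; so this is a constructible set in constructible bijection
   with the projective variety Gr_e(V). *)
Definition quiver_grass n (Q : quiver n) (V : rep k Q) (e : 'I_n -> nat) :
    kset (\sum_v (e v * V v)%N) :=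
  fun x =>
    let U v : 'M[k]_(e v, V v) :=
      vec_mx (@submxrow k n (fun v => (e v * V v)%N) 1 x v) in
    (forall v, reduced_echelon (U v)) /\
    (forall a : arrow Q, (U (src a) *m ract V a <= U (tgt a))%MS).

End EulerCharacteristic.

Arguments quiver_grass {k n Q} V e _.

Record complex (k : fieldType) (n : nat) (Q : quiver n) := Complex {
  cobj :> int -> rep k Q;
  cdiff : forall i, rmor (cobj i) (cobj (i + 1));
  cdiffK : forall i v, cdiff i v *m cdiff (i + 1) v = 0;
  cbounded : exists m : nat, forall i, (m < `|i|)%N -> rzero (cobj i) }.

Record chain (k : fieldType) (n : nat) (Q : quiver n) (X Y : complex k Q) := Chain {
  cmap :> forall i, rmor (X i) (Y i);
  cmapP : forall i v,
    cmap i v *m cdiff Y i v = cdiff X i v *m cmap (i + 1) v }.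

Section Complexes.
Variables (k : fieldType) (n : nat) (Q : quiver n).
Implicit Types (X Y Z : complex k Q) (V W : rep k Q).

Definition chain_id X : chain X X.
Proof. by exists (fun i => rid (X i)) => i v /=; rewrite mulmx1 mul1mx. Defined.

Definition chain_comp X Y Z (g : chain Y Z) (f : chain X Y) : chain X Z.
Proof.
exists (fun i => rcomp (g i) (f i)) => i v /=.
by rewrite -mulmxA cmapP mulmxA cmapP mulmxA.
Defined.

(* X[1]^i = X^(i+1), with differential -d. *)
Definition shiftc X : complex k Q.
Proof.
exists (fun i => X (i + 1)) (fun i => ropp (cdiff X (i + 1))).
- by move=> i v /=; rewrite mulNmx mulmxN cdiffK !oppr0.
- have [m Xm] := cbounded X; exists m.+1 => i mi; apply: Xm; lia.
Defined.

Definition shift_chain X Y (f : chain X Y) : chain (shiftc X) (shiftc Y).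
Proof.
exists (fun i => f (i + 1)) => i v /=.
by rewrite mulmxN mulNmx cmapP.
Defined.

(* cone(f)^i = X^(i+1) (+) Y^i, with differential (x, y) |-> (-dx, fx + dy). *)
Definition cone_diff X Y (f : chain X Y) (i : int) :
  rmor (rsum (X (i + 1)) (Y i)) (rsum (X (i + 1 + 1)) (Y (i + 1))).
Proof.
exists (fun v => block_mx (- cdiff X (i + 1) v) (f (i + 1) v) 0 (cdiff Y i v)) => a.
rewrite /= !mulmx_block !mul0mx !mulmx0 !addr0 !add0r.
by rewrite mulmxN mulNmx !rmxP.
Defined.

Definition cone X Y (f : chain X Y) : complex k Q.
Proof.
exists (fun i => rsum (X (i + 1)) (Y i)) (cone_diff f).
- move=> i v /=; rewrite mulmx_block !mul0mx !mulmx0 !addr0 !add0r.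
  by rewrite !mulNmx !mulmxN !cdiffK cmapP addNr !oppr0 block_mx0.
- have [m Xm] := cbounded X; have [m' Ym] := cbounded Y.
  exists (maxn m m').+1 => i mi v /=.
  by rewrite Xm ?Ym //; lia.
Defined.

Definition rinr V W : rmor W (rsum V W).
Proof.
exists (fun v => row_mx (0 : 'M[k]_(W v, V v)) 1%:M) => a.
rewrite /= mul_mx_row mul_row_block !mulmx0 !mul0mx !add0r.
by rewrite mulmx1 mul1mx.
Defined.

Definition rprl V W : rmor (rsum V W) V.
Proof.
exists (fun v => col_mx 1%:M (0 : 'M[k]_(W v, V v))) => a.
rewrite /= mul_block_col mul_col_mx !mulmx0 !mul0mx !addr0.
by rewrite mulmx1 mul1mx.
Defined.

Definition cone_in X Y (f : chain X Y) : chain Y (cone f).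
Proof.
exists (fun i => rinr (X (i + 1)) (Y i)) => i v /=.
rewrite mul_mx_row mul_row_block !mulmx0 !mul0mx !add0r.
by rewrite mulmx1 mul1mx.
Defined.

Definition cone_out X Y (f : chain X Y) : chain (cone f) (shiftc X).
Proof.
exists (fun i => rprl (X (i + 1)) (Y i)) => i v /=.
rewrite mul_block_col mul_col_mx !mulmx0 !mul0mx !addr0.
by rewrite mulmx1 mul1mx.
Defined.

(* f induces bijections on the cohomology at every i + 1, hence everywhere. *)
Definition quasi_iso X Y (f : chain X Y) : Prop :=
  forall i v,
    (forall x : 'rV_(X (i + 1) v), x *m cdiff X (i + 1) v = 0 ->
      (exists y : 'rV_(Y i v), x *m f (i + 1) v = y *m cdiff Y i v) ->
      exists x' : 'rV_(X i v), x = x' *m cdiff X i v) /\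
    (forall y : 'rV_(Y (i + 1) v), y *m cdiff Y (i + 1) v = 0 ->
      exists (x : 'rV_(X (i + 1) v)) (y' : 'rV_(Y i v)),
        x *m cdiff X (i + 1) v = 0 /\ y = x *m f (i + 1) v + y' *m cdiff Y i v).

Definition null_homotopic X Y (f : chain X Y) : Prop :=
  exists h : forall i, rmor (X (i + 1)) (Y i), forall i v,
    f (i + 1) v = cdiff X (i + 1) v *m h (i + 1) v + h i v *m cdiff Y i v.

Definition stalk V : complex k Q.
Proof.
exists (fun i => if i is Posz 0 then V else rep0 k Q) (fun i => rmor0 _ _).
- by move=> i v /=; rewrite mulmx0.
- by exists 0%N => -[[|i]|i].
Defined.

Definition stalk_chain V W (f : rmor V W) : chain (stalk V) (stalk W).
Proof.
exists (fun i => match i return rmor (stalk V i) (stalk W i) with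
                 | Posz 0 => f
                 | _ => rmor0 _ _
                 end) => i v /=.
by rewrite mulmx0 mul0mx.
Defined.

End Complexes.

Record lincat (k : fieldType) (O : Type) := LinCat {
  hom :> O -> O -> lmodType k;
  idm : forall X, hom X X;
  comp : forall X Y Z, hom Y Z -> hom X Y -> hom X Z;
  comp1m : forall X Y (f : hom X Y), comp (idm Y) f = f;
  compm1 : forall X Y (f : hom X Y), comp f (idm X) = f;
  compA : forall X Y Z T (h : hom Z T) (g : hom Y Z) (f : hom X Y),
    comp h (comp g f) = comp (comp h g) f;
  comp_linl : forall X Y Z (c : k) (g g' : hom Y Z) (f : hom X Y),
    comp (c *: g + g') f = c *: comp g f + comp g' f;
  comp_linr : forall X Y Z (c : k) (g : hom Y Z) (f f' : hom X Y),
    comp g (c *: f + f') = c *: comp g f + comp g f' }.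

Arguments idm {k O} _ _.
Arguments comp {k O _ X Y Z} _ _.

Notation "g \oc f" := (comp g f) (at level 40, left associativity).

(* A k-linear functor with action F on objects. *)
Record linfunctor (k : fieldType) (O O' : Type) (C : lincat k O) (D : lincat k O')
    (F : O -> O') := LinFunctor {
  fmor :> forall X Y, C X Y -> D (F X) (F Y);
  fmor_lin : forall X Y (c : k) (f g : C X Y),
    fmor (c *: f + g) = c *: fmor f + fmor g;
  fmor1 : forall X, fmor (idm C X) = idm D (F X);
  fmorM : forall X Y Z (g : C Y Z) (f : C X Y), fmor (g \oc f) = fmor g \oc fmor f }.

Arguments fmor {k O O' C D F} _ {X Y} _.

Definition lincomp (k : fieldType) (O O' O'' : Type) (C : lincat k O)
    (D : lincat k O') (E : lincat k O'') (F : O -> O') (G : O' -> O'')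
    (g : linfunctor D E G) (f : linfunctor C D F) :
  linfunctor C E (fun X => G (F X)).
Proof.
exists (fun X Y u => fmor g (fmor f u)).
- by move=> X Y c u v; rewrite !fmor_lin.
- by move=> X; rewrite !fmor1.
- by move=> X Y Z v u; rewrite !fmorM.
Defined.

Section Categories.
Variables (k : fieldType) (O : Type) (C : lincat k O).

Definition isiso X Y (f : C X Y) : Prop :=
  exists g : C Y X, g \oc f = idm C X /\ f \oc g = idm C Y.

Definition iso_obj X Y : Prop := exists f : C X Y, isiso f.

Definition zero_obj X : Prop := idm C X = 0.

Definition biproduct A X Y : Prop :=
  exists (i1 : C X A) (i2 : C Y A) (p1 : C A X) (p2 : C A Y),
    p1 \oc i1 = idm C X /\ p2 \oc i2 = idm C Y /\
    i1 \oc p1 + i2 \oc p2 = idm C A.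

Definition indecomposable X : Prop :=
  ~ zero_obj X /\ forall Y Z, biproduct X Y Z -> zero_obj Y \/ zero_obj Z.

Record quasi_inverse (fo : O -> O) (F : linfunctor C C fo) := QuasiInverse {
  qobj : O -> O;
  qfun : linfunctor C C qobj;
  qunit : forall X, C (qobj (fo X)) X;
  qcounit : forall X, C (fo (qobj X)) X;
  qunit_iso : forall X, isiso (qunit X);
  qcounit_iso : forall X, isiso (qcounit X);
  qunit_nat : forall X Y (f : C X Y),
    f \oc qunit X = qunit Y \oc fmor qfun (fmor F f);
  qcounit_nat : forall X Y (f : C X Y),
    f \oc qcounit X = qcounit Y \oc fmor F (fmor qfun f) }.

Record triangulated (sh : O -> O) (S : linfunctor C C sh) := Triangulated {
  tri_shift : quasi_inverse S;
  tri_zero : exists Z, zero_obj Z;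
  tri_biproduct : forall X Y, exists A, biproduct A X Y;
  dist : forall X Y Z, C X Y -> C Y Z -> C Z (sh X) -> Prop;
  tri_iso : forall X Y Z X' Y' Z'
      (u : C X Y) (v : C Y Z) (w : C Z (sh X))
      (u' : C X' Y') (v' : C Y' Z') (w' : C Z' (sh X'))
      (a : C X X') (b : C Y Y') (c : C Z Z'),
    isiso a -> isiso b -> isiso c ->
    u' \oc a = b \oc u -> v' \oc b = c \oc v -> w' \oc c = fmor S a \oc w ->
    dist u v w -> dist u' v' w';
  tri_id : forall X Z, zero_obj Z ->
    dist (idm C X) (0 : C X Z) (0 : C Z (sh X));
  tri_cone : forall X Y (u : C X Y),
    exists Z (v : C Y Z) (w : C Z (sh X)), dist u v w;
  tri_rot : forall X Y Z (u : C X Y) (v : C Y Z) (w : C Z (sh X)),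
    dist u v w <-> dist v w (- fmor S u);
  tri_mor : forall X Y Z X' Y' Z'
      (u : C X Y) (v : C Y Z) (w : C Z (sh X))
      (u' : C X' Y') (v' : C Y' Z') (w' : C Z' (sh X'))
      (a : C X X') (b : C Y Y'),
    dist u v w -> dist u' v' w' -> u' \oc a = b \oc u ->
    exists c : C Z Z', v' \oc b = c \oc v /\ w' \oc c = fmor S a \oc w;
  tri_oct : forall X Y Z X' Y' Z'
      (u : C X Y) (u1 : C Y Z') (u2 : C Z' (sh X))
      (v : C Y Z) (v1 : C Z X') (v2 : C X' (sh Y))
      (w1 : C Z Y') (w2 : C Y' (sh X)),
    dist u u1 u2 -> dist v v1 v2 -> dist (v \oc u) w1 w2 ->
    exists (f : C Z' Y') (g : C Y' X'),
      dist f g (fmor S u1 \oc v2) /\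
      f \oc u1 = w1 \oc v /\ w2 \oc f = u2 /\
      g \oc w1 = v1 /\ v2 \oc g = fmor S u \oc w2 }.

(* A triangle splits exactly when its connecting morphism vanishes. *)
Definition nonsplit_triangle sh (S : linfunctor C C sh) (T : triangulated S)
    X Y Z : Prop :=
  exists (u : C X Y) (v : C Y Z) (w : C Z (sh X)), dist T u v w /\ w <> 0.

Definition one_dim (V : lmodType k) : Prop :=
  exists2 e : V, e <> 0 & forall f : V, exists c : k, f = c *: e.

(* The orbit category C/F of an autoequivalence F: it has the objects of C, the
   projection proj is the identity on objects, F becomes isomorphic to the
   identity through orb_th, and (g_i)_i |-> sum_i g_i identifies the direct sum
   of the C(X, F^i Y), i in Z, with the space of morphisms from X to Y. *)

Fixpoint iter_mor (E : lincat k O) (f : O -> O) (t : forall X, E (f X) X)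
    (m : nat) (X : O) : E (iter m f X) X :=
  match m return E (iter m f X) X with
  | 0%N => idm E X
  | m'.+1 => iter_mor t m' X \oc t (iter m' f X)
  end.

Definition opow (fo go : O -> O) (i : int) (X : O) : O :=
  match i with Posz m => iter m fo X | Negz m => iter m.+1 go X end.

Definition opow_mor (E : lincat k O) (fo go : O -> O) (t : forall X, E (fo X) X)
    (t' : forall X, E (go X) X) (i : int) (X : O) : E (opow fo go i X) X :=
  match i return E (opow fo go i X) X with
  | Posz m => iter_mor t m X
  | Negz m => iter_mor t' m.+1 X
  end.

Record orbit_category (fo : O -> O) (F : linfunctor C C fo)
    (G : quasi_inverse F) := OrbitCategory {
  orb :> lincat k O;
  proj : linfunctor C orb id;
  orb_th : forall X, orb (fo X) X;
  orb_thV : forall X, orb (qobj G X) X;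
  orb_th_iso : forall X, exists g : orb X (fo X),
    g \oc orb_th X = idm orb (fo X) /\ orb_th X \oc g = idm orb X;
  orb_th_nat : forall X Y (f : C X Y),
    fmor proj f \oc orb_th X = orb_th Y \oc fmor proj (fmor F f);
  orb_thVE : forall X,
    orb_thV X \oc orb_th (qobj G X) = fmor proj (qcounit G X);
  orb_span : forall X Y (g : orb X Y),
    exists (s : seq int) (f : forall i, C X (opow fo (qobj G) i Y)),
      g = \sum_(i <- s) opow_mor orb_th orb_thV i Y \oc fmor proj (f i);
  orb_free : forall X Y (s : seq int)
      (f : forall i, C X (opow fo (qobj G) i Y)), uniq s ->
    \sum_(i <- s) opow_mor orb_th orb_thV i Y \oc fmor proj (f i) = 0 ->
    forall i, i \in s -> f i = 0 }.

End Categories.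

Section ClusterCategory.
Variables (k : fieldType) (n : nat) (Q : quiver n).

(* D^b(mod kQ): its objects are the bounded complexes, its morphisms X -> Y are
   the fractions f s^-1 with s : Z -> X a quasi-isomorphism and f : Z -> Y. *)
Record derived_category := DerivedCategory {
  dcat :> lincat k (complex k Q);
  loc : forall X Y, chain X Y -> dcat X Y;
  loc1 : forall X, loc (chain_id X) = idm dcat X;
  locM : forall X Y Z (g : chain Y Z) (f : chain X Y),
    loc (chain_comp g f) = loc g \oc loc f;
  loc_lin : forall X Y (c : k) (f g h : chain X Y),
    (forall i v, h i v = c *: f i v + g i v) -> loc h = c *: loc f + loc g;
  loc_quasi_iso : forall X Y (f : chain X Y), quasi_iso f -> isiso (loc f);
  loc_frac : forall X Y (g : dcat X Y),
    exists Z (s : chain Z X) (f : chain Z Y), quasi_iso s /\ g \oc loc s = loc f;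
  loc_eq0 : forall X Y (f : chain X Y),
    loc f = 0 <->
    exists Z (s : chain Z X), quasi_iso s /\ null_homotopic (chain_comp f s);
  dshift : linfunctor dcat dcat (@shiftc k n Q);
  dshift_loc : forall X Y (f : chain X Y), fmor dshift (loc f) = loc (shift_chain f) }.

Definition derived_dist (D : derived_category) X Y Z
    (u : D X Y) (v : D Y Z) (w : D Z (shiftc X)) : Prop :=
  exists (A B : complex k Q) (f : chain A B)
      (a : D A X) (b : D B Y) (c : D (cone f) Z),
    isiso a /\ isiso b /\ isiso c /\
    u \oc a = b \oc loc D f /\
    v \oc b = c \oc loc D (cone_in f) /\
    w \oc c = fmor (dshift D) a \oc loc D (cone_out f).

(* tau is the autoequivalence for which X |-> (tau X)[1] is a Serre functor: the
   forms ar_trace give isomorphisms D(X, Y) ~ D(Y, (tau X)[1])^*, natural in X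
   and Y. *)
Record ar_translation (D : derived_category) := ARTranslation {
  tau : complex k Q -> complex k Q;
  tauF : linfunctor D D tau;
  tauI : quasi_inverse tauF;
  ar_trace : forall X, {scalar (D X (shiftc (tau X)))};
  ar_nat : forall X X' (u : D X X') (h : D X' (shiftc (tau X))),
    ar_trace X (h \oc u) = ar_trace X' (fmor (dshift D) (fmor tauF u) \oc h);
  ar_perfect : forall X Y (phi : {scalar (D Y (shiftc (tau X)))}),
    exists! f : D X Y, forall g, phi g = ar_trace X (g \oc f) }.

(* The orbit category of D^b(mod kQ) by tau^-1[1], with a triangulated structure
   whose shift is induced by that of D^b(mod kQ) and for which the projection is
   a triangle functor. *)
Record cluster_category := ClusterCategory {
  cl_D : derived_category;
  cl_tau : ar_translation cl_D;
  cl_inv : quasi_inverse (lincomp (qfun (tauI cl_tau)) (dshift cl_D));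
  cl_orb :> orbit_category cl_inv;
  cl_shift : linfunctor cl_orb cl_orb (@shiftc k n Q);
  cl_shiftE : forall X Y (f : cl_D X Y),
    fmor cl_shift (fmor (proj cl_orb) f) = fmor (proj cl_orb) (fmor (dshift cl_D) f);
  cl_tri : triangulated cl_shift;
  cl_dist : forall X Y Z (u : cl_D X Y) (v : cl_D Y Z) (w : cl_D Z (shiftc X)),
    derived_dist u v w ->
    dist cl_tri (fmor (proj cl_orb) u) (fmor (proj cl_orb) v)
      (fmor (proj cl_orb) w) }.

Definition cl_Ext1 (C : cluster_category) (M N : complex k Q) : lmodType k :=
  C M (shiftc N).

(* Ext^1_kQ(V, W), computed in the derived category. *)
Definition mod_Ext1 (C : cluster_category) (V W : rep k Q) : lmodType k :=
  cl_D C (stalk V) (shiftc (stalk W)).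

End ClusterCategory.

Arguments cl_D {k n Q} _.
Arguments cl_orb {k n Q} _.

Section LinearQuiver.
Variables (k : fieldType) (n : nat).

(* P_i has a basis of paths starting at i; there is one path from i to each
   v <= i, and none to the other vertices. *)
Definition projective (i : 'I_n) : rep k (linA n) :=
  @Rep k n (linA n) (fun v => nat_of_bool (v <= i)%N) (fun=> const_mx 1).

(* Precomposition of paths with the arrow a. *)
Definition proj_arrow (a : arrow (linA n)) :
  rmor (projective (tgt a)) (projective (src a)).
Proof.
exists (fun v => const_mx 1) => b.
have ab := eqP (valP a); have bb := eqP (valP b).
apply/matrixP => i j.
have h : (val (src b) <= val (tgt a))%N.
  by move: (leq_ltn_trans (leq0n i) (ltn_ord i)); rewrite /= lt0b.
rewrite !mxE.
under eq_bigr do rewrite !mxE mulr1.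
under [RHS]eq_bigr do rewrite !mxE mulr1.
rewrite !sumr_const !card_ord /=; congr (_ *+ nat_of_bool _).
by rewrite /= in ab bb h *; apply/idP/idP => _; lia.
Defined.

(* V is the module H^0 X: V_v is Hom_C(P_v, X), and an arrow a acts by
   precomposition with P_(tgt a) -> P_(src a). *)
Definition is_H0 (C : cluster_category k (linA n)) (X : complex k (linA n))
    (V : rep k (linA n)) : Prop :=
  exists phi : forall v, {linear 'rV[k]_(V v) -> C (stalk (projective v)) X},
    (forall v, bijective (phi v)) /\
    forall (a : arrow (linA n)) (x : 'rV[k]_(V (src a))),
      phi (tgt a) (x *m ract V a) =
      phi (src a) x \oc
        fmor (proj (cl_orb C)) (loc (cl_D C) (stalk_chain (proj_arrow a))).

End LinearQuiver.

Definition cfield (n : nat) : fieldType := {fraction {mpoly rat[n + n + n]}}.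

Definition xvar n (r : 'I_n) : cfield n :=
  tofrac (mpolyX _ U_(lshift n (lshift n r)))%MM.
Definition yvar n (r : 'I_n) : cfield n :=
  tofrac (mpolyX _ U_(lshift n (rshift n r)))%MM.
Definition zvar n (r : 'I_n) : cfield n :=
  tofrac (mpolyX _ U_(rshift (n + n) r))%MM.

Definition ymon n (w : 'rV[int]_n) : cfield n := \prod_r yvar r ^ w 0 r.
Definition zmon n (w : 'rV[int]_n) : cfield n := \prod_r zvar r ^ w 0 r.

Section ClusterCharacter.
Variables (k : fieldType) (n : nat).
Variable chi : forall N, kset k N -> int.

Definition module_character (Q : quiver n) (V : rep k Q) : cfield n :=
  \sum_(e : {dffun forall v : 'I_n, 'I_(V v).+1})
    (chi (quiver_grass V (fun v => e v)))%:~R *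
    \prod_r
      (let ev : 'rV[int]_n := \row_v (e v)%:Z in
       let alpha : 'rV[int]_n := delta_mx 0 r in
       xvar r ^ (- euler_form Q ev alpha - euler_form Q alpha (dimvec V - ev)) *
       yvar r ^+ e r * zvar r ^+ (V r - e r)%N).

Record cluster_character (C : cluster_category k (linA n))
    (X : complex k (linA n) -> cfield n) : Prop := {
  cc_sum : forall A M N, biproduct C A M N -> X A = X M * X N;
  cc_proj : forall i, X (shiftc (stalk (projective k i))) = xvar i;
  cc_mod : forall V : rep k (linA n), rindecomposable V ->
    X (stalk V) = module_character V }.

End ClusterCharacter.

(* Main.v *)
From HB Require Import structures.
From mathcomp Require Import all_boot all_order all_algebra.
From mathcomp Require Import zify ring mpoly.
From Stdlib Require Import Classical ClassicalEpsilon.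
From Stdlib Require Import FunctionalExtensionality PropExtensionality.
Require Import Defs.

(** Number the vertices from 0 and write [a, b) for the interval module with
support a, ..., b - 1, so that P_i = [0, i + 1).  Let moreover [a, n + 1)
stand for P_{a-1}[1].  With this convention both parts of the theorem concern
M = [a, b) and N = [c, d) with b <= n + 1 and d <= n: a vector at the topmost
vertex of the support of a module generates an interval that splits off
(interval_summand), so indecomposable modules are intervals.  The proof has a
categorical half, which shows that

  c < a <= d < b,   U = [c, b) + [a, d),   U' = [d + 1, b) + [c, a - 1)

(exchange_triangles), and a numerical half, which evaluates the characters.

Numerical half.  A submodule of [s, t) is [s, u) for some u, so the quiver
Grassmannians of [s, t) are empty or a point, and with x_{-1} = x_n = 1

  X_[s,t) = sum_{s <= u <= t} x_{s-1} x_t / (x_{u-1} x_u) y^[s,u) z^[u,t)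

(module_character_interval).  Up to a monomial this is a difference
S(t + 1) - S(s) of partial sums of one sequence that does not depend on s and
t.  Both formulas then reduce to identities between such differences; the one
behind (a) is (B - A)(D - C) = (B - C)(D - A) + (B - D)(A - C).

Categorical half.  In the derived category D, the module P_v corepresents
cohomology at v, so that morphisms out of interval modules are computed from
the triangle [0, s) -> [0, t) -> [s, t) ->.  The Hom sequences of such a
triangle are exact in the cluster category C by the axioms; they are exact in
D because the component of degree 0 of a factorization in the orbit category
is a factorization in D (proj_extend).  Serre duality then determines the
Auslander-Reiten translates tau [s + 1, t + 1) = [s, t) and
tau (P_s[1]) = [s, n), by recognizing a nonzero pairing on each P_v
(serre_recognition).

Let F = tau^-1 [1] be the functor by which the orbit category is formed.
Since F lowers and its inverse raises cohomological degrees, the only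
component of C(N, M[1]) = sum_i D(N, F^i M[1]) that can be nonzero is
D(N, F^-1 M[1]) = D([c, d), [a - 1, b - 1)).  This gives the inequalities, and
U'[1] is the cone of the morphism [c, d) -> [a - 1, b - 1), which is the sum
of its cokernel [d, b - 1) and of its shifted kernel [c, a - 1)[1]
(interval_cone); finally [d, b - 1) becomes isomorphic to [d + 1, b)[1] in C
(cluster_obj_rotate).  As Ext^1(M, N) is one-dimensional, U is the middle term
of any nonsplit triangle from N to M: the one of the short exact sequence
0 -> [c, d) -> [c, b) + [a, d) -> [a, b) -> 0 if b <= n, and a rotation of
the cone of P_{a-1} -> [c, d) if b = n + 1.

The modules H^0(U) and H^0(U') are read off from the same degree argument:
C(P_v, V) = D(P_v, V) for a module V, while C(P_v, P_i[1]) = 0. *)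

Set Implicit Arguments.
Unset Strict Implicit.
Unset Printing Implicit Defensive.

Import Order.TTheory GRing.Theory Num.Theory.
Local Open Scope ring_scope.

(** * Linear categories and functors *)

Section LinCatTheory.
Variables (k : fieldType) (O : Type) (C : lincat k O).

Lemma compDl X Y Z (g g' : C Y Z) (f : C X Y) :
  (g + g') \oc f = g \oc f + g' \oc f.
Proof. by rewrite -{1}[g]scale1r comp_linl scale1r. Qed.

Lemma compDr X Y Z (g : C Y Z) (f f' : C X Y) :
  g \oc (f + f') = g \oc f + g \oc f'.
Proof. by rewrite -{1}[f]scale1r comp_linr scale1r. Qed.

Lemma comp0l X Y Z (f : C X Y) : (0 : C Y Z) \oc f = 0.
Proof. by apply: (@addrI _ ((0 : C Y Z) \oc f)); rewrite -compDl !addr0. Qed.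

Lemma comp0r X Y Z (g : C Y Z) : g \oc (0 : C X Y) = 0.
Proof. by apply: (@addrI _ (g \oc (0 : C X Y))); rewrite -compDr !addr0. Qed.

Lemma compZl X Y Z c (g : C Y Z) (f : C X Y) : (c *: g) \oc f = c *: (g \oc f).
Proof. by rewrite -[c *: g]addr0 comp_linl comp0l addr0. Qed.

Lemma compZr X Y Z c (g : C Y Z) (f : C X Y) : g \oc (c *: f) = c *: (g \oc f).
Proof. by rewrite -[c *: f]addr0 comp_linr comp0r addr0. Qed.

Lemma compNl X Y Z (g : C Y Z) (f : C X Y) : (- g) \oc f = - (g \oc f).
Proof. by rewrite -scaleN1r compZl scaleN1r. Qed.

Lemma compNr X Y Z (g : C Y Z) (f : C X Y) : g \oc (- f) = - (g \oc f).
Proof. by rewrite -scaleN1r compZr scaleN1r. Qed.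

Lemma compBl X Y Z (g g' : C Y Z) (f : C X Y) :
  (g - g') \oc f = g \oc f - g' \oc f.
Proof. by rewrite compDl compNl. Qed.

Lemma compBr X Y Z (g : C Y Z) (f f' : C X Y) :
  g \oc (f - f') = g \oc f - g \oc f'.
Proof. by rewrite compDr compNr. Qed.

Lemma comp_sumr X Y Z (J : Type) (r : seq J) (g : C Y Z) (f : J -> C X Y) :
  g \oc (\sum_(j <- r) f j) = \sum_(j <- r) g \oc f j.
Proof.
elim: r => [|j r IH]; first by rewrite !big_nil comp0r.
by rewrite !big_cons compDr IH.
Qed.

Lemma comp_suml X Y Z (J : Type) (r : seq J) (g : J -> C Y Z) (f : C X Y) :
  (\sum_(j <- r) g j) \oc f = \sum_(j <- r) g j \oc f.
Proof.
elim: r => [|j r IH]; first by rewrite !big_nil comp0l.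
by rewrite !big_cons compDl IH.
Qed.

Lemma isiso_id X : isiso (idm C X).
Proof. by exists (idm C X); rewrite comp1m. Qed.

Lemma isiso_comp X Y Z (g : C Y Z) (f : C X Y) :
  isiso g -> isiso f -> isiso (g \oc f).
Proof.
move=> [g' [g'g gg']] [f' [f'f ff']]; exists (f' \oc g'); split.
  by rewrite compA -[_ \oc g]compA g'g compm1.
by rewrite compA -[_ \oc f']compA ff' compm1.
Qed.

Lemma isiso_inv2 X Y (f : C X Y) (l r : C Y X) :
  l \oc f = idm C X -> f \oc r = idm C Y -> isiso f.
Proof.
move=> lf fr; exists l; split=> //.
by have -> : l = r by rewrite -[l]compm1 -fr compA lf comp1m.
Qed.

Lemma iso_refl X : iso_obj C X X.
Proof. by exists (idm C X); apply: isiso_id. Qed.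

Lemma iso_sym X Y : iso_obj C X Y -> iso_obj C Y X.
Proof. by move=> [f [g [gf fg]]]; exists g, f. Qed.

Lemma iso_trans Y X Z : iso_obj C X Y -> iso_obj C Y Z -> iso_obj C X Z.
Proof. by move=> [f fi] [g gi]; exists (g \oc f); apply: isiso_comp. Qed.

Definition hom0 X Y : Prop := forall f : C X Y, f = 0.

Lemma hom0_iso X X' Y Y' :
  iso_obj C X X' -> iso_obj C Y Y' -> hom0 X Y -> hom0 X' Y'.
Proof.
move=> [a [a' [_ aa']]] [b [b' [_ bb']]] h f.
rewrite -[f]compm1 -aa' -[f]comp1m -bb'.
have -> : b \oc b' \oc f \oc (a \oc a') = b \oc (b' \oc f \oc a) \oc a'.
  by rewrite !compA.
by rewrite (h (b' \oc f \oc a)) comp0r comp0l.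
Qed.

Lemma zero_objP X Y : zero_obj C X -> hom0 X Y /\ hom0 Y X.
Proof.
move=> X0; split=> f; first by rewrite -[f]compm1 X0 comp0r.
by rewrite -[f]comp1m X0 comp0l.
Qed.

Lemma zero_iso X Y : zero_obj C X -> zero_obj C Y -> iso_obj C X Y.
Proof.
move=> X0 Y0; exists 0, 0.
by rewrite (X0 : idm C X = 0) (Y0 : idm C Y = 0) !comp0l.
Qed.

Lemma zero_obj_iso X Y : iso_obj C X Y -> zero_obj C X -> zero_obj C Y.
Proof.
move=> [f [g [_ fg]]] X0; rewrite /zero_obj -fg.
by rewrite -[f]compm1 (X0 : idm C X = 0) comp0r comp0l.
Qed.

Lemma biproduct_iso A X Y A' X' Y' : iso_obj C A A' -> iso_obj C X X' ->
  iso_obj C Y Y' -> biproduct C A X Y -> biproduct C A' X' Y'.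
Proof.
move=> [a [a' [a'a aa']]] [f [f' [f'f ff']]] [g [g' [g'g gg']]].
move=> [i1 [i2 [p1 [p2 [p1i1 [p2i2 ip]]]]]].
exists (a \oc i1 \oc f'), (a \oc i2 \oc g'), (f \oc p1 \oc a'), (g \oc p2 \oc a').
split; last split.
- have -> : f \oc p1 \oc a' \oc (a \oc i1 \oc f') =
            f \oc (p1 \oc (a' \oc a) \oc i1) \oc f' by rewrite !compA.
  by rewrite a'a compm1 p1i1 compm1.
- have -> : g \oc p2 \oc a' \oc (a \oc i2 \oc g') =
            g \oc (p2 \oc (a' \oc a) \oc i2) \oc g' by rewrite !compA.
  by rewrite a'a compm1 p2i2 compm1.
have -> : a \oc i1 \oc f' \oc (f \oc p1 \oc a') =
          a \oc (i1 \oc (f' \oc f) \oc p1) \oc a' by rewrite !compA.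
have -> : a \oc i2 \oc g' \oc (g \oc p2 \oc a') =
          a \oc (i2 \oc (g' \oc g) \oc p2) \oc a' by rewrite !compA.
by rewrite f'f g'g !compm1 -compDl -compDr ip compm1.
Qed.

Lemma biproduct_swap A X Y : biproduct C A X Y -> biproduct C A Y X.
Proof.
move=> [i1 [i2 [p1 [p2 [a [b c]]]]]].
by exists i2, i1, p2, p1; rewrite addrC.
Qed.

Lemma biproduct_off A X Y (i1 : C X A) (i2 : C Y A) (p1 : C A X) (p2 : C A Y) :
  p1 \oc i1 = idm C X -> p2 \oc i2 = idm C Y ->
  i1 \oc p1 + i2 \oc p2 = idm C A -> p1 \oc i2 = 0 /\ p2 \oc i1 = 0.
Proof.
move=> a b c.
have E1 : p1 \oc i2 = 0.
  have := comp1m i2; rewrite -c compDl -!compA b compm1 -[X in _ = X]add0r.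
  move/addIr => e; by rewrite -[p1 \oc i2]comp1m -a -compA e comp0r.
have E2 : p2 \oc i1 = 0.
  have := comp1m i1; rewrite -c compDl -!compA a compm1 -[X in _ = X]addr0.
  move/addrI => e; by rewrite -[p2 \oc i1]comp1m -b -compA e comp0r.
by [].
Qed.

Lemma biproduct_uniq A A' X Y :
  biproduct C A X Y -> biproduct C A' X Y -> iso_obj C A A'.
Proof.
move=> [i1 [i2 [p1 [p2 [a [b c]]]]]] [j1 [j2 [q1 [q2 [a' [b' c']]]]]].
have [e1 e2] := biproduct_off a b c; have [e1' e2'] := biproduct_off a' b' c'.
have E X1 X2 X3 X4 X5 (x : C X4 X5) (y : C X3 X4) (z : C X2 X3) (t : C X1 X2) :
  (x \oc y) \oc (z \oc t) = x \oc (y \oc z) \oc t by rewrite !compA.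
exists (j1 \oc p1 + j2 \oc p2), (i1 \oc q1 + i2 \oc q2); split.
  rewrite !compDl !compDr !E a' b' e1' e2' !compm1 !comp0r !comp0l.
  by rewrite ?addr0 ?add0r.
rewrite !compDl !compDr !E a b e1 e2 !compm1 !comp0r !comp0l.
by rewrite ?addr0 ?add0r.
Qed.

Lemma biproduct_zero X Z : zero_obj C Z -> biproduct C X X Z.
Proof.
move=> Z0; exists (idm C X), 0, (idm C X), 0; rewrite !comp1m !comp0l addr0.
by rewrite (Z0 : idm C Z = 0).
Qed.

End LinCatTheory.

Arguments hom0 {k O} C X Y.

Section FunctorTheory.
Variables (k : fieldType) (O O' : Type) (C : lincat k O) (D : lincat k O').
Variables (F : O -> O') (f : linfunctor C D F).

Lemma fmor0 X Y : fmor f (0 : C X Y) = 0.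
Proof.
have := fmor_lin f 1 (0 : C X Y) 0; rewrite !scale1r addr0 -[LHS]addr0.
by move/addrI.
Qed.

Lemma fmorD X Y (g h : C X Y) : fmor f (g + h) = fmor f g + fmor f h.
Proof. by have := fmor_lin f 1 g h; rewrite !scale1r. Qed.

Lemma fmorZ X Y c (g : C X Y) : fmor f (c *: g) = c *: fmor f g.
Proof. by have := fmor_lin f c g 0; rewrite fmor0 !addr0. Qed.

Lemma fmorN X Y (g : C X Y) : fmor f (- g) = - fmor f g.
Proof. by rewrite -scaleN1r fmorZ scaleN1r. Qed.

Lemma fmorB X Y (g h : C X Y) : fmor f (g - h) = fmor f g - fmor f h.
Proof. by rewrite fmorD fmorN. Qed.

Lemma fmor_isiso X Y (g : C X Y) : isiso g -> isiso (fmor f g).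
Proof. by move=> [h [hg gh]]; exists (fmor f h); rewrite -!fmorM hg gh !fmor1. Qed.

Lemma fmor_iso X Y : iso_obj C X Y -> iso_obj D (F X) (F Y).
Proof. by move=> [g gi]; exists (fmor f g); apply: fmor_isiso. Qed.

Lemma fmor_zero X : zero_obj C X -> zero_obj D (F X).
Proof. by move=> X0; rewrite /zero_obj -(fmor1 f) (X0 : idm C X = 0) fmor0. Qed.

End FunctorTheory.

Section QuasiInverse.
Variables (k : fieldType) (O : Type) (C : lincat k O).
Variables (fo : O -> O) (F : linfunctor C C fo) (G : quasi_inverse F).

Lemma qfun_faithful X Y (f g : C X Y) : fmor (qfun G) f = fmor (qfun G) g -> f = g.
Proof.
move=> e; have [h [_ hh]] := qcounit_iso G X.
have := qcounit_nat G f; rewrite e -qcounit_nat => E.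
by rewrite -[f]compm1 -[g]compm1 -hh !compA E.
Qed.

Lemma qinv_faithful X Y (f g : C X Y) : fmor F f = fmor F g -> f = g.
Proof.
move=> e; have [h [_ hh]] := qunit_iso G X.
have := qunit_nat G f; rewrite e -qunit_nat => E.
by rewrite -[f]compm1 -[g]compm1 -hh !compA E.
Qed.

(** A preimage of g is obtained by conjugating its image under the quasi-inverse
with the unit; it is correct because the quasi-inverse is faithful. *)
Lemma qinv_full X Y (g : C (fo X) (fo Y)) : exists f : C X Y, fmor F f = g.
Proof.
have [h [hu uh]] := qunit_iso G X.
exists (qunit G Y \oc fmor (qfun G) g \oc h).
apply: qfun_faithful.
have [l [lu ul]] := qunit_iso G Y.
have E := qunit_nat G (qunit G Y \oc fmor (qfun G) g \oc h).
rewrite -compA hu compm1 in E.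
have cancel W (x y : C W (qobj G (fo Y))) :
    qunit G Y \oc x = qunit G Y \oc y -> x = y.
  by move=> e; rewrite -[x]comp1m -[y]comp1m -lu -!compA e.
exact: cancel (esym E).
Qed.

Lemma qinv_reflect_iso X Y : iso_obj C (fo X) (fo Y) -> iso_obj C X Y.
Proof.
move=> [g [h [hg gh]]]; have [f Ef] := qinv_full g; have [l El] := qinv_full h.
exists f, l; split; apply: qinv_faithful; by rewrite fmorM fmor1 Ef El.
Qed.

Lemma qinv_hom0 X Y : hom0 C (fo X) (fo Y) -> hom0 C X Y.
Proof. by move=> h f; apply: qinv_faithful; rewrite fmor0; apply: h. Qed.

Lemma qunit_isoobj X : iso_obj C (qobj G (fo X)) X.
Proof. by exists (qunit G X); apply: qunit_iso. Qed.

Lemma qcounit_isoobj X : iso_obj C (fo (qobj G X)) X.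
Proof. by exists (qcounit G X); apply: qcounit_iso. Qed.

End QuasiInverse.

(** * Triangulated categories *)

Section TriangulatedTheory.
Variables (k : fieldType) (O : Type) (C : lincat k O).
Variables (sh : O -> O) (S : linfunctor C C sh) (T : triangulated S).
Implicit Types X Y Z W : O.

Lemma dist_rot X Y Z (u : C X Y) (v : C Y Z) (w : C Z (sh X)) :
  dist T u v w -> dist T v w (- fmor S u).
Proof. by case: (tri_rot T u v w). Qed.

Lemma dist_comp0 X Y Z (u : C X Y) (v : C Y Z) (w : C Z (sh X)) :
  dist T u v w -> v \oc u = 0.
Proof.
move=> d; have [Z0 Z00] := tri_zero T.
have e : u \oc idm C X = u \oc idm C X by [].
have [c [-> _]] := tri_mor (tri_id T X Z00) d e.
by rewrite comp0r.
Qed.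

Lemma dist_comp0' X Y Z (u : C X Y) (v : C Y Z) (w : C Z (sh X)) :
  dist T u v w -> w \oc v = 0.
Proof. by move/dist_rot/dist_comp0. Qed.

(** Any g : W -> Y killed by v extends to a morphism from the rotation of the
identity triangle of W; its component W[1] -> X[1] is a shift. *)
Lemma dist_lift X Y Z (u : C X Y) (v : C Y Z) (w : C Z (sh X)) W (g : C W Y) :
  dist T u v w -> v \oc g = 0 -> exists h : C W X, g = u \oc h.
Proof.
move=> d vg; have [Z0 Z00] := tri_zero T.
have dW := dist_rot (tri_id T W Z00).
have dv := dist_rot d.
have e : v \oc g = 0 \oc (0 : C W Z0) by rewrite vg comp0r.
have [c [_]] := tri_mor dW dv e.
rewrite fmor1 compNl compNr compm1 => /oppr_inj.
have [h <-] := qinv_full (tri_shift T) c.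
rewrite -fmorM => /(qinv_faithful (tri_shift T)) E.
by exists h.
Qed.

(** Dual to dist_lift, with the triangle 0 -> W -> W -> 0[1]. *)
Lemma dist_ext X Y Z (u : C X Y) (v : C Y Z) (w : C Z (sh X)) W (f : C Y W) :
  dist T u v w -> f \oc u = 0 -> exists h : C Z W, f = h \oc v.
Proof.
move=> d fu; have [Z0 Z00] := tri_zero T.
have sZ0 : zero_obj C (sh Z0).
  by rewrite /zero_obj -(fmor1 S) (Z00 : idm C Z0 = 0) fmor0.
have dW : dist T (0 : C Z0 W) (idm C W) (0 : C W (sh Z0)).
  by apply: (tri_rot T _ _ _).2; rewrite fmor0 oppr0; apply: tri_id.
have e : (0 : C Z0 W) \oc (0 : C X Z0) = f \oc u by rewrite fu comp0r.
have [c [E _]] := tri_mor d dW e.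
by exists c; rewrite -E comp1m.
Qed.

Lemma dist_lift2 X Y Z (u : C X Y) (v : C Y Z) (w : C Z (sh X)) W (g : C W Z) :
  dist T u v w -> w \oc g = 0 -> exists h : C W Y, g = v \oc h.
Proof. by move/dist_rot; apply: dist_lift. Qed.

Lemma dist_ext2 X Y Z (u : C X Y) (v : C Y Z) (w : C Z (sh X)) W (f : C Z W) :
  dist T u v w -> f \oc v = 0 -> exists h : C (sh X) W, f = h \oc w.
Proof. by move/dist_rot; apply: dist_ext. Qed.

Lemma dist_ext3 X Y Z (u : C X Y) (v : C Y Z) (w : C Z (sh X)) W (f : C (sh X) W) :
  dist T u v w -> f \oc w = 0 -> exists h : C (sh Y) W, f = h \oc fmor S u.
Proof.
move=> /dist_rot/dist_rot d fw; have [h ->] := dist_ext d fw.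
by exists (- h); rewrite compNl compNr.
Qed.

Lemma dist_lift0 X Y Z (u : C X Y) (v : C Y Z) (w : C Z (sh X)) W (g : C W X) :
  dist T u v w -> u \oc g = 0 -> exists h : C (sh W) Z, fmor S g = w \oc h.
Proof.
move=> /dist_rot/dist_rot d ug; apply: (dist_lift d).
by rewrite compNl -fmorM ug fmor0 oppr0.
Qed.

Lemma isiso_1D X (e : C X X) : e \oc e = 0 -> isiso (idm C X + e).
Proof.
move=> ee; exists (idm C X - e); split.
  by rewrite compDl compDr !compNl compDr ee !comp1m compm1 addr0 addrK.
by rewrite compDl !compBr ee !comp1m compm1 subr0 subrK.
Qed.

(** c - 1 vanishes on v and is killed by w, so it factors through w on the right
and through v on the left; hence its square is 0. *)
Lemma dist_endo_iso X Y Z (u : C X Y) (v : C Y Z) (w : C Z (sh X)) (c : C Z Z) :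
  dist T u v w -> c \oc v = v -> w \oc c = w -> isiso c.
Proof.
move=> d cv wc.
have ev : (c - idm C Z) \oc v = 0 by rewrite compBl cv comp1m subrr.
have we : w \oc (c - idm C Z) = 0 by rewrite compBr wc compm1 subrr.
have [y Ey] := dist_ext2 d ev; have [x Ex] := dist_lift2 d we.
have -> : c = idm C Z + (c - idm C Z) by rewrite addrC subrK.
apply: isiso_1D; rewrite {1}Ey Ex compA -[y \oc w \oc v]compA.
by rewrite (dist_comp0' d) comp0r comp0l.
Qed.

(** The five lemma: by dist_endo_iso the comparison morphisms Z -> Z' -> Z and
Z' -> Z -> Z' are invertible. *)
Lemma dist_third_iso X Y Z (u : C X Y) (v : C Y Z) (w : C Z (sh X))
    X' Y' Z' (u' : C X' Y') (v' : C Y' Z') (w' : C Z' (sh X'))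
    (a : C X X') (b : C Y Y') :
  dist T u v w -> dist T u' v' w' -> isiso a -> isiso b ->
  u' \oc a = b \oc u -> iso_obj C Z Z'.
Proof.
move=> d d' [a' [a'a aa']] [b' [b'b bb']] e.
have e' : u \oc a' = b' \oc u'.
  rewrite -[u]comp1m -b'b -[b' \oc b \oc u]compA -e -!compA aa' compm1.
  by [].
have [c [c1 c2]] := tri_mor d d' e; have [c' [c1' c2']] := tri_mor d' d e'.
have i1 : isiso (c' \oc c).
  apply: (dist_endo_iso d).
    by rewrite -compA -c1 compA -c1' -compA b'b compm1.
  by rewrite compA c2' -compA c2 compA -fmorM a'a fmor1 comp1m.
have i2 : isiso (c \oc c').
  apply: (dist_endo_iso d').
    by rewrite -compA -c1' compA -c1 -compA bb' compm1.
  by rewrite compA c2 -compA c2' compA -fmorM aa' fmor1 comp1m.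
move: i1 i2 => [l [l1 _]] [r [_ r1]].
exists c; apply: (isiso_inv2 (l := l \oc c') (r := c' \oc r)).
  by rewrite -compA.
by rewrite compA.
Qed.

(** After two rotations the middle terms become cones of the connecting
morphisms, shifted once. *)
Lemma dist_middle_iso X Y Z (u : C X Y) (v : C Y Z) (w : C Z (sh X))
    X' Y' Z' (u' : C X' Y') (v' : C Y' Z') (w' : C Z' (sh X'))
    (a : C X X') (c : C Z Z') :
  dist T u v w -> dist T u' v' w' -> isiso a -> isiso c ->
  w' \oc c = fmor S a \oc w -> iso_obj C Y Y'.
Proof.
move=> /dist_rot/dist_rot d /dist_rot/dist_rot d' ai ci e.
apply: (qinv_reflect_iso (tri_shift T)).
exact: (dist_third_iso d d' ci (fmor_isiso S ai) e).
Qed.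

(** If the connecting morphism is 0 then v has a section s, and 1 - s v factors
through u. *)
Lemma dist0_split X Y Z (u : C X Y) (v : C Y Z) : dist T u v 0 ->
  exists (p : C Y X) (s : C Z Y),
    [/\ p \oc u = idm C X, v \oc s = idm C Z & u \oc p + s \oc v = idm C Y].
Proof.
move=> d.
have [s Es] := dist_lift2 (g := idm C Z) d (comp0l _ _).
have [p Ep] : exists p : C Y X, idm C Y - s \oc v = u \oc p.
  by apply: (dist_lift d); rewrite compBr compm1 compA -Es comp1m subrr.
have mono W (g : C W X) : u \oc g = 0 -> g = 0.
  move=> ug; have [h] := dist_lift0 d ug; rewrite comp0l => E.
  by apply: (qinv_faithful (tri_shift T)); rewrite fmor0.
exists p, s; split; last by rewrite -Ep subrK.
  apply/eqP; rewrite -subr_eq0; apply/eqP/mono.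
  rewrite compBr compm1 compA -Ep compBl comp1m -compA (dist_comp0 d) comp0r.
  by rewrite subr0 subrr.
by rewrite -Es.
Qed.

Lemma dist0_biproduct X Y Z (u : C X Y) (v : C Y Z) :
  dist T u v 0 -> biproduct C Y X Z.
Proof. by move=> /dist0_split[p [s [pu vs e]]]; exists u, s, p, v. Qed.

(** The cone of a split monomorphism i is a complement of Y in M, hence zero. *)
Lemma retract_indecomposable M Y (i : C Y M) (p : C M Y) :
  indecomposable C M -> ~ zero_obj C Y -> p \oc i = idm C Y -> isiso i.
Proof.
move=> [_ Mi] Y0 pi; have [Z [v [w d]]] := tri_cone T i.
have w0 : w = 0.
  rewrite -[w]comp1m -(fmor1 S) -pi fmorM -compA.
  have := dist_comp0' (dist_rot d); rewrite compNl => /eqP.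
  by rewrite oppr_eq0 => /eqP ->; rewrite comp0r.
rewrite w0 in d; have [//|Z0] := Mi _ _ (dist0_biproduct d).
have v0 : v \oc idm C M = 0 by rewrite ((zero_objP M Z0).2 v) comp0l.
have [h Eh] := dist_lift d v0.
exact: (isiso_inv2 pi (esym Eh)).
Qed.

End TriangulatedTheory.

(** * Complexes of representations *)

Section ChainComplexes.
Variables (k : fieldType) (n : nat) (Q : quiver n).
Implicit Types (X Y Z : complex k Q) (V W U : rep k Q).

Lemma mx_dim0l m p (A : 'M[k]_(m, p)) : m = 0%N -> A = 0.
Proof. by move=> m0; subst m; apply: flatmx0. Qed.

Lemma mx_dim0r m p (A : 'M[k]_(m, p)) : p = 0%N -> A = 0.
Proof. by move=> p0; subst p; apply: thinmx0. Qed.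

Section Casts.

(** Degrees such as i - 1 + 1 and i are equal without being convertible; rcast is
the identity of X between two equal degrees. *)
Definition rcast (X : int -> rep k Q) i j (e : i = j) : rmor (X i) (X j) :=
  match e with erefl => rid (X i) end.

Lemma rcast_nat (X Y : int -> rep k Q) (p : int -> int)
    (h : forall i, rmor (X i) (Y (p i))) a b (e : a = b) (e' : p a = p b) v :
  rcast X e v *m h b v = h a v *m rcast Y e' v.
Proof. by subst b; rewrite (eq_axiomK e') /= mul1mx mulmx1. Qed.

Lemma rcast_comp (X : int -> rep k Q) a b c (e : a = b) (e' : b = c) (e'' : a = c) v :
  rcast X e v *m rcast X e' v = rcast X e'' v.
Proof. by subst b c; rewrite (eq_axiomK e'') /= mul1mx. Qed.

Lemma rcastK (X : int -> rep k Q) a b (e : a = b) (e' : b = a) v :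
  rcast X e v *m rcast X e' v = 1%:M.
Proof. by subst b; rewrite (eq_axiomK e') /= mul1mx. Qed.

End Casts.

Lemma unshift_eq (i : int) : i - 1 + 1 = i + 1 - 1.
Proof. by rewrite subrK addrK. Qed.

(** The complex X[-1], with the sign that makes unshift_counit a chain map. *)
Definition unshiftc X : complex k Q.
Proof.
exists (fun i => X (i - 1))
  (fun i => rcomp (rcast X (unshift_eq i)) (ropp (cdiff X (i - 1)))).
- move=> i v /=.
  have e' : i - 1 + 1 + 1 = i + 1 - 1 + 1 by rewrite addrK subrK.
  rewrite -[_ *m _ *m (_ *m _)]mulmxA [_ *m (- _ *m _)]mulmxA mulmxN.
  rewrite (rcast_nat (cdiff X) (unshift_eq i) e').
  by rewrite mulNmx mulNmx mulmxN mulmxA mulmxA cdiffK !mul0mx !oppr0.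
- have [m Xm] := cbounded X; exists m.+1 => i mi; apply: Xm; lia.
Defined.

(** The adjoint of h under the equivalence between unshiftc and shiftc. *)
Definition unshift_chain X Y (h : chain X (shiftc Y)) : chain (unshiftc X) Y.
Proof.
exists (fun i => rcomp (rcast Y (subrK 1 i)) (h (i - 1))) => i v /=.
have e1 : i - 1 + 1 + 1 = i + 1 by rewrite subrK.
have e2 : i - 1 + 1 + 1 = i + 1 - 1 + 1 by rewrite addrK subrK.
rewrite -mulmxA (rcast_nat (cdiff Y) (subrK 1 i) e1) mulmxA.
have := cmapP h (i - 1) v; rewrite /= mulmxN => /(congr1 -%R).
rewrite opprK => ->; rewrite !mulNmx; congr (- _); rewrite -!mulmxA; congr (_ *m _).
rewrite [RHS]mulmxA (rcast_nat (X := X) (Y := Y) (p := fun j => j + 1) (cmap h) (unshift_eq i) e2).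
rewrite -!mulmxA; congr (_ *m _).
by rewrite (rcast_comp _ _ _ e1).
Defined.

Definition unshift_counit X : chain (shiftc (unshiftc X)) X.
Proof.
exists (fun i => rcast X (addrK 1 i)) => i v /=.
have e1 : i + 1 - 1 + 1 = i + 1 by rewrite addrK.
rewrite (rcast_nat (cdiff X) (addrK 1 i) e1) !mulNmx opprK -mulmxA.
by congr (_ *m _); rewrite (rcast_comp _ _ _ e1).
Defined.

Definition unshift_counitV X : chain X (shiftc (unshiftc X)).
Proof.
exists (fun i => rcast X (esym (addrK 1 i))) => i v /=.
have e0 : i + 1 = i + 1 - 1 + 1 by rewrite addrK.
rewrite mulNmx opprK mulmxA.
rewrite (rcast_nat (cdiff X) (esym (addrK 1 i)) e0) -mulmxA; congr (_ *m _).
by rewrite (rcast_comp _ _ _ (esym (addrK 1 (i + 1)))).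
Defined.

Lemma quasi_iso_precomp X Y Z (s : chain Y Z) (e : chain X Y) (e' : chain Y X)
    (h : chain X Z) :
  (forall i v, e i v *m e' i v = 1%:M) -> (forall i v, e' i v *m e i v = 1%:M) ->
  (forall i v, h i v = e i v *m s i v) -> quasi_iso s -> quasi_iso h.
Proof.
move=> ee e'e hE qs i v; have [inj sur] := qs i v; split.
  move=> x xd [y xy]; rewrite hE mulmxA in xy.
  have [|x' Ex'] := inj (x *m e (i + 1) v) _ (ex_intro _ y xy).
    by rewrite -mulmxA cmapP mulmxA xd mul0mx.
  exists (x' *m e' i v).
  by rewrite -mulmxA cmapP mulmxA -Ex' -mulmxA ee mulmx1.
move=> y yd; have [x [y' [xd ->]]] := sur y yd.
exists (x *m e' (i + 1) v), y'; split.
  by rewrite -mulmxA cmapP mulmxA xd mul0mx.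
by rewrite hE -[x *m _ *m _]mulmxA [e' _ _ *m (_ *m _)]mulmxA e'e mul1mx.
Qed.

(** Up to the isomorphism unshift_counit, the shift of unshift_chain s is s
itself; so the claim for s in degree i - 1 is the one for unshift_chain s in
degree i. *)
Lemma quasi_iso_unshift X Y (s : chain X (shiftc Y)) :
  quasi_iso s -> quasi_iso (unshift_chain s).
Proof.
move=> qs.
have qh : quasi_iso (shift_chain (unshift_chain s)).
  apply: (quasi_iso_precomp (e := unshift_counit X) (e' := unshift_counitV X) _ _ _ qs).
  - by move=> i v /=; rewrite rcastK.
  - by move=> i v /=; rewrite rcastK.
  move=> i v /=; rewrite -(rcast_nat (X := X) (Y := Y) (p := fun j => j + 1) (cmap s) (addrK 1 i)).
  by congr (_ *m _).
move=> i; have -> : i = i - 1 + 1 by rewrite subrK.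
move=> v; have [inj sur] := qh (i - 1) v.
move: (unshift_chain s) inj sur => t.
move: (unshiftc X) t => X' t /= inj sur; split.
  move=> x xd [y xy]; have [||x' Ex'] := inj x.
  - by rewrite mulmxN xd oppr0.
  - by exists (- y); rewrite mulmxN mulNmx opprK.
  by exists (- x'); rewrite Ex' mulmxN mulNmx.
move=> y yd; have [|x [y' [xd E]]] := sur y.
  by rewrite mulmxN yd oppr0.
exists x, (- y'); split; last by rewrite E mulmxN mulNmx.
by apply: oppr_inj; rewrite -mulmxN xd oppr0.
Qed.

Definition short_exact X Y Z (f : chain X Y) (g : chain Y Z) : Prop :=
  forall i v,
    (forall x : 'rV_(X i v), x *m f i v = 0 -> x = 0) /\
    f i v *m g i v = 0 /\
    (forall y : 'rV_(Y i v), y *m g i v = 0 -> exists x, y = x *m f i v) /\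
    (forall z : 'rV_(Z i v), exists y, z = y *m g i v).

Definition rcoprod0 V W U (g : rmor W U) : rmor (rsum V W) U.
Proof.
exists (fun v => col_mx 0 (g v)) => a /=.
by rewrite mul_block_col mul_col_mx !mul0mx mulmx0 addr0 add0r rmxP.
Defined.

Definition cone_to X Y Z (f : chain X Y) (g : chain Y Z)
  (fg : forall i v, f i v *m g i v = 0) : chain (cone f) Z.
Proof.
exists (fun i => rcoprod0 (X (i + 1)) (g i)) => i v /=.
rewrite mul_col_mx mul_block_col !mulmx0 !mul0mx.
by rewrite fg addr0 add0r cmapP.
Defined.

(** A diagram chase: lift along g, correct by f, and use the injectivity of f one
degree higher. *)
Lemma cone_to_quasi_iso X Y Z (f : chain X Y) (g : chain Y Z)
    (fg : forall i v, f i v *m g i v = 0) :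
  short_exact f g -> quasi_iso (cone_to fg).
Proof.
move=> ex i v; split.
  move=> x; rewrite -[x]hsubmxK /=; move: (lsubmx x) (rsubmx x) => a b.
  rewrite mul_row_block !mulmx0 !addr0 mulmxN -row_mx0 => /eq_row_mx[da].
  move=> /eqP; rewrite addr_eq0 => /eqP db [z]; rewrite mul_row_col mulmx0 add0r.
  have [_ [_ [_ sz]]] := ex i v; have [y' ->] := sz z.
  rewrite -mulmxA cmapP mulmxA => E.
  have [_ [_ [ey _]]] := ex (i + 1) v.
  have [|x' Ex'] := ey (b - y' *m cdiff Y i v).
    by rewrite mulmxBl E subrr.
  exists (row_mx x' y'); rewrite mul_row_block !mulmx0 !addr0 mulmxN.
  rewrite -Ex' subrK; congr row_mx.
  apply/eqP; rewrite -subr_eq0 opprK; apply/eqP.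
  have [inj _] := ex (i + 1 + 1) v; apply: inj.
  rewrite mulmxDl db -mulmxA -cmapP mulmxA -Ex' mulmxBl -mulmxA cdiffK mulmx0.
  by rewrite subr0 addNr.
move=> z zd; have [_ [_ [_ sz]]] := ex (i + 1) v; have [y Ey] := sz z.
have [inj2 [_ [ey _]]] := ex (i + 1 + 1) v.
have [|x0 Ex0] := ey (y *m cdiff Y (i + 1) v).
  by rewrite -mulmxA -cmapP mulmxA -Ey.
exists (row_mx (- x0) y), 0; split; last first.
  by rewrite /= mul_row_col mulmx0 add0r mul0mx addr0.
rewrite /= mul_row_block !mulmx0 !addr0 !mulNmx -Ex0 addNr mulmxN opprK.
have [inj _] := ex (i + 1 + 1 + 1) v.
rewrite [_ *m _](inj (x0 *m cdiff X (i + 1 + 1) v)) ?row_mx0 //.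
by rewrite -mulmxA -cmapP mulmxA -Ex0 -mulmxA cdiffK mulmx0.
Qed.

End ChainComplexes.

(** * The derived category *)

Section DerivedCategory.
Variables (k : fieldType) (n : nat) (Q : quiver n) (D : derived_category k Q).
Implicit Types (X Y Z : complex k Q) (V W U : rep k Q).

Lemma loc_zero X Y (f : chain X Y) : (forall i v, f i v = 0) -> loc D f = 0.
Proof.
move=> f0; rewrite (loc_lin D (c := -1) (f := f) (g := f) (h := f)).
  by rewrite scaleN1r addNr.
by move=> i v; rewrite scaleN1r addNr.
Qed.

Lemma loc_ext X Y (f g : chain X Y) : (forall i v, f i v = g i v) -> loc D f = loc D g.
Proof.
move=> fg; apply/eqP; rewrite -subr_eq0 -scaleN1r addrC; apply/eqP.
pose z : chain X Y := @Chain _ _ _ X Y (fun=> rmor0 _ _)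
  (fun i v => etrans (mul0mx _ _) (esym (mulmx0 _ _))).
rewrite -(loc_lin D (c := -1) (f := g) (g := f) (h := z)); first exact: loc_zero.
by move=> i v; rewrite /= scaleN1r fg addNr.
Qed.

Lemma loc_chain_iso X Y (f : chain X Y) (g : chain Y X) :
  (forall i v, f i v *m g i v = 1%:M) -> (forall i v, g i v *m f i v = 1%:M) ->
  isiso (loc D f).
Proof.
move=> fg gf; exists (loc D g); rewrite -!locM -!loc1.
by split; apply: loc_ext => i v /=.
Qed.

Lemma zero_complex X : (forall i v, X i v = 0%N) -> zero_obj D X.
Proof.
by move=> X0; rewrite /zero_obj -loc1; apply: loc_zero => i v; apply: mx_dim0l.
Qed.

Lemma short_exact_dist X Y Z (f : chain X Y) (g : chain Y Z) : short_exact f g ->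
  exists w : D Z (shiftc X), derived_dist (loc D f) (loc D g) w.
Proof.
move=> ex.
have fg i v : f i v *m g i v = 0 by have [_ []] := ex i v.
have ci := loc_quasi_iso D (cone_to_quasi_iso fg ex).
have [c' [c'c cc']] := ci.
exists (loc D (cone_out f) \oc c'), X, Y, f, (idm D X), (idm D Y), (loc D (cone_to fg)).
do 2!(split; first exact: isiso_id).
split=> //; split; first by rewrite compm1 comp1m.
split.
  rewrite compm1 -locM; apply: loc_ext => i v /=.
  by rewrite mul_row_col mul0mx add0r mul1mx.
by rewrite -compA c'c compm1 fmor1 comp1m.
Qed.

(** A fraction X[1] <- Z -> Y[1] is the shift of a fraction X <- Z[-1] -> Y. *)
Lemma dshift_full X Y (g : D (shiftc X) (shiftc Y)) :
  exists f : D X Y, fmor (dshift D) f = g.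
Proof.
have [Z [s [f [qs E]]]] := loc_frac g.
have si := loc_quasi_iso D (quasi_iso_unshift qs); have [t [ts st]] := si.
have [c [cu uc]] : isiso (loc D (unshift_counit Z)).
  by apply: (loc_chain_iso (g := unshift_counitV Z)) => i v /=; rewrite rcastK.
have H Y' (h : chain Z (shiftc Y')) :
    fmor (dshift D) (loc D (unshift_chain h)) = loc D h \oc loc D (unshift_counit Z).
  rewrite dshift_loc -locM; apply: loc_ext => i v /=.
  rewrite -(rcast_nat (X := Z) (Y := Y') (p := fun j => j + 1) (cmap h) (addrK 1 i)).
  by congr (_ *m _).
exists (loc D (unshift_chain f) \oc t).
rewrite fmorM H -E -compA -compA [loc D s \oc _]compA -H -fmorM st fmor1 compm1.
by [].
Qed.

End DerivedCategory.

(** * Stalk complexes *)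

Section Stalks.
Variables (k : fieldType) (n : nat) (Q : quiver n).
Implicit Types (X Y Z : complex k Q) (V W U : rep k Q).

(** Selecting V by a Boolean makes a stalk complex whose differentials all vanish
definitionally, and whose degrees are compared by computation. *)
Definition rpick (b : bool) V : rep k Q := if b then V else rep0 k Q.

Definition rpick_mor b V W (f : rmor V W) : rmor (rpick b V) (rpick b W) :=
  match b return rmor (rpick b V) (rpick b W) with
  | true => f
  | false => rmor0 _ _
  end.

Definition stalkz (m : int) V : complex k Q.
Proof.
exists (fun i => rpick (i == m) V) (fun i => rmor0 _ _).
- by move=> i v /=; rewrite mulmx0.
- exists `|m|%N => i mi v /=; rewrite /rpick; case: eqP => // e; lia.
Defined.

Definition stz m V W (f : rmor V W) : chain (stalkz m V) (stalkz m W).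
Proof.
exists (fun i => rpick_mor (i == m) f) => i v /=.
by rewrite mulmx0 mul0mx.
Defined.

(** The morphism into the m-th term X m, transported to degree i when i = m. *)
Definition rin m V (X : int -> rep k Q) (f : rmor V (X m)) i : rmor (rpick (i == m) V) (X i) :=
  match @eqP _ i m in reflect _ b return rmor (rpick b V) (X i) with
  | ReflectT e => match esym e in _ = j return rmor V (X j) with erefl => f end
  | ReflectF _ => rmor0 _ _
  end.

Lemma rin_d m V Y (f : rmor V (Y m)) :
  (forall v, f v *m cdiff Y m v = 0) -> forall i v, rin f i v *m cdiff Y i v = 0.
Proof.
move=> fd i v; rewrite /rin; case: eqP => [e|_]; last by rewrite /= mul0mx.
by subst i; apply: fd.
Qed.

Definition stz_in m V Y (f : rmor V (Y m)) (fd : forall v, f v *m cdiff Y m v = 0) :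
  chain (stalkz m V) Y.
Proof.
exists (rin f) => i v /=.
by rewrite rin_d // mul0mx.
Defined.

Lemma rin_at m V (X : int -> rep k Q) (f : rmor V (X m)) v :
  const_mx 1 *m rin f m v = const_mx 1 *m f v :> 'rV[k]_(X m v).
Proof.
rewrite /rin; case: eqP => [e|//]; by rewrite (eq_axiomK e).
Qed.

(** The same in degrees shifted by one: the shape of a homotopy into X i. *)
Definition rin_h i V (X : int -> rep k Q) (f : rmor V (X i)) j :
    rmor (rpick (j + 1 == i + 1) V) (X j) :=
  match @eqP _ (j + 1) (i + 1) in reflect _ b return rmor (rpick b V) (X j) with
  | ReflectT e => match esym (addIr 1 e) in _ = l return rmor V (X l) with erefl => f end
  | ReflectF _ => rmor0 _ _
  end.

Lemma rin_h_at i V (X : int -> rep k Q) (f : rmor V (X i)) v :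
  const_mx 1 *m rin_h f i v = const_mx 1 *m f v :> 'rV[k]_(X i v).
Proof.
rewrite /rin_h; case: eqP => [e|//]; by rewrite (eq_axiomK (addIr 1 e)).
Qed.

Definition rexact V W U (f : rmor V W) (g : rmor W U) : Prop :=
  forall v,
    (forall x : 'rV_(V v), x *m f v = 0 -> x = 0) /\
    f v *m g v = 0 /\
    (forall y : 'rV_(W v), y *m g v = 0 -> exists x, y = x *m f v) /\
    (forall z : 'rV_(U v), exists y, z = y *m g v).

Lemma rexact_short m V W U (f : rmor V W) (g : rmor W U) :
  rexact f g -> short_exact (stz m f) (stz m g).
Proof.
move=> ex i v /=; case: (i == m) => /=; first exact: ex.
split; first by move=> x _; apply: mx_dim0r.
split; first by rewrite mulmx0.
split; first by move=> y _; exists 0; rewrite mul0mx; apply: mx_dim0r.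
by move=> z; exists 0; rewrite mul0mx; apply: mx_dim0r.
Qed.

Definition bcast b b' (e : b = b') V : rmor (rpick b V) (rpick b' V) :=
  match e with erefl => rid _ end.

Definition stalkz_shift m V : chain (shiftc (stalkz (m + 1) V)) (stalkz m V).
Proof.
exists (fun i => bcast (inj_eq (addIr 1) i m) V) => i v /=.
by rewrite oppr0 mul0mx mulmx0.
Defined.

Definition stalkz_shiftV m V : chain (stalkz m V) (shiftc (stalkz (m + 1) V)).
Proof.
exists (fun i => bcast (esym (inj_eq (addIr 1) i m)) V) => i v /=.
by rewrite oppr0 mul0mx mulmx0.
Defined.

Lemma bcastK b b' (e : b = b') (e' : b' = b) V v :
  bcast e V v *m bcast e' V v = 1%:M.
Proof. by subst b'; rewrite (eq_axiomK e') /= mul1mx. Qed.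

Definition stalk_z V : chain (stalk V) (stalkz 0 V).
Proof.
exists (fun i => match i return rmor (stalk V i) (stalkz 0 V i) with
                 | Posz 0 => rid V | _ => rmor0 _ _ end) => i v /=.
by rewrite mulmx0 mul0mx.
Defined.

Definition stalk_zV V : chain (stalkz 0 V) (stalk V).
Proof.
exists (fun i => match i return rmor (stalkz 0 V i) (stalk V i) with
                 | Posz 0 => rid V | _ => rmor0 _ _ end) => i v /=.
by rewrite mulmx0 mul0mx.
Defined.

Lemma stalkz_shift_iso (D : derived_category k Q) m V :
  iso_obj D (shiftc (stalkz (m + 1) V)) (stalkz m V).
Proof.
exists (loc D (stalkz_shift m V)); apply: (loc_chain_iso D (g := stalkz_shiftV m V));
  by move=> i v /=; rewrite bcastK.
Qed.

Lemma stalk_z_isiso (D : derived_category k Q) V : isiso (loc D (stalk_z V)).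
Proof.
apply: (loc_chain_iso D (g := stalk_zV V)).
  by case=> [[|i]|i] v /=; rewrite ?mul1mx //; apply/matrixP => -[].
by case=> [[|i]|i] v /=; rewrite ?mul1mx //; apply/matrixP => -[].
Qed.

Lemma stalk_z_iso (D : derived_category k Q) V : iso_obj D (stalk V) (stalkz 0 V).
Proof. by exists (loc D (stalk_z V)); apply: stalk_z_isiso. Qed.

End Stalks.

(** * Representations of the linear quiver *)

Section LinearRepresentations.
Variables (k : fieldType) (n : nat).
Local Notation A := (linA n).
Implicit Types (X Y Z : complex k A) (V W U : rep k A).

Lemma const_mxM m p q (c d : k) :
  (const_mx c : 'M_(m, p)) *m (const_mx d : 'M_(p, q)) = const_mx (c * d *+ p).
Proof.
apply/matrixP => i j; rewrite !mxE.
by under eq_bigr do rewrite !mxE; rewrite sumr_const card_ord.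
Qed.

Lemma const_mx_eq m q (c d : k) : ((0 < m)%N -> (0 < q)%N -> c = d) ->
  const_mx c = const_mx d :> 'M_(m, q).
Proof.
move=> cd; apply/matrixP => i j; rewrite !mxE cd //.
  exact: leq_ltn_trans (ltn_ord i).
exact: leq_ltn_trans (ltn_ord j).
Qed.

Definition rstep V (v w : 'I_n) : 'M[k]_(V v, V w) :=
  match @idP (val (v, w).1 == (val (v, w).2).+1) with
  | ReflectT e => ract V (Sub (v, w) e : arrow A)
  | ReflectF _ => 0
  end.

Lemma rstepE V (a : arrow A) : rstep V (src a) (tgt a) = ract V a.
Proof.
case: a => [[v w] e]; rewrite /rstep /=; case: {-}_ / idP => [e'|] //.
by rewrite (bool_irrelevance e e').
Qed.

Lemma rstep0 V (v w : 'I_n) : val v != w.+1 -> rstep V v w = 0.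
Proof. by move=> /negP e; rewrite /rstep; case: {-}_ / idP. Qed.

(** The image of x at the vertex w, d arrows below v; the sum over u has at most
one nonzero term, the vertex above w. *)
Fixpoint transport V (v : 'I_n) (x : 'rV[k]_(V v)) (d : nat) (w : 'I_n) : 'rV[k]_(V w) :=
  if d is d'.+1 then \sum_u transport x d' u *m rstep V u w
  else x *m \matrix_(i, j) ((v == w) && (val i == val j))%:R.

Lemma transport0 V v (x : 'rV[k]_(V v)) : transport x 0 v = x.
Proof.
rewrite /= -[RHS]mulmx1; congr (_ *m _); apply/matrixP => i j.
by rewrite !mxE eqxx.
Qed.

Lemma transportS V v (x : 'rV[k]_(V v)) d (a : arrow A) :
  transport x d.+1 (tgt a) = transport x d (src a) *m ract V a.
Proof.
rewrite /= (bigD1 (src a)) //= big1 ?addr0 ?rstepE // => u ua.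
rewrite rstep0 ?mulmx0 //; apply: contra ua => /eqP e; apply/eqP/val_inj => /=.
by rewrite e (eqP (valP a)).
Qed.

(** The paths from v to the vertices below it form a basis of P_v, so x in V_v
can be pushed along them.  The factor const_mx 1 only adapts the number of rows,
which is (w <= v) instead of 1. *)
Definition yoneda V v (x : 'rV[k]_(V v)) : rmor (projective k v) V.
Proof.
exists (fun w : 'I_n => const_mx 1 *m transport x (v - w)%N w) => a.
rewrite /= -mulmxA -transportS mulmxA const_mxM.
case: (leqP (src a) v) => h; last first.
  rewrite [const_mx 1]mx_dim0l ?[const_mx _]mx_dim0l ?mul0mx //=;
  by rewrite leqNgt h.
have e := eqP (valP a); rewrite /= in e h.
have pred_sub p q r : p = q.+1 -> (p <= r)%N ->
    (r - q = (r - p).+1)%N /\ (q <= r)%N by lia.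
have [-> ->] := pred_sub _ _ _ e h.
by rewrite mulr1.
Defined.

Lemma yonedaE V v (x : 'rV[k]_(V v)) : const_mx 1 *m yoneda x v = x.
Proof.
by rewrite /= mulmxA const_mxM leqnn mulr1 subnn transport0 [const_mx _]mx11_scalar mxE mul1mx.
Qed.

(** Every arrow between vertices below v acts invertibly on P_v, so the value at
v determines the morphism by descending induction. *)
Lemma proj_null V v (f : rmor (projective k v) V) :
  const_mx 1 *m f v = 0 :> 'rV_(V v) -> forall w, f w = 0.
Proof.
move=> f0.
suff H d (w : 'I_n) : (w + d = v)%N -> f w = 0.
  move=> w; case: (leqP w v) => h; first by apply: (H (v - w)%N); rewrite subnKC.
  by apply: mx_dim0l => /=; rewrite leqNgt h.
elim: d w => [|d IH] w wd.
  have e : w = v by apply: val_inj; rewrite /= -wd addn0.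
  subst w; move: f0; move: (f v) => /=; rewrite leqnn => B.
  by rewrite [const_mx _]mx11_scalar mxE mul1mx.
have vn : (w.+1 < n)%N by apply: leq_ltn_trans (ltn_ord v); rewrite -wd addnS ltnS leq_addr.
have va : val (Ordinal vn, w).1 == (val (Ordinal vn, w).2).+1 by [].
pose a : arrow A := Sub (Ordinal vn, w) va.
have := rmxP f a; rewrite (IH (src a)); last by rewrite /= -wd addSnnS.
rewrite mul0mx /=.
have -> : (w < v)%N by rewrite -wd addnS ltnS leq_addr.
move: (f w) => /=; have -> : (w <= v)%N by rewrite -wd leq_addr.
by move=> B; rewrite [const_mx _]mx11_scalar mxE mul1mx.
Qed.

Lemma proj_lin V v (c : k) (f g h : rmor (projective k v) V) :
  const_mx 1 *m h v = c *: (const_mx 1 *m f v) + const_mx 1 *m g v :> 'rV_(V v) ->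
  forall w, h w = c *: f w + g w.
Proof.
move=> E w.
have P a : ract (projective k v) a *m (h (tgt a) - (c *: f (tgt a) + g (tgt a))) =
    (h (src a) - (c *: f (src a) + g (src a))) *m ract V a.
  by rewrite mulmxBr mulmxBl mulmxDr mulmxDl -scalemxAr -scalemxAl !rmxP.
apply/eqP; rewrite -subr_eq0; apply/eqP.
apply: (proj_null (f := @RMor _ _ _ (projective k v) V
  (fun w => h w - (c *: f w + g w)) P)) => /=.
by rewrite mulmxBr mulmxDr -scalemxAr E subrr.
Qed.

Lemma proj_uniq V v (f g : rmor (projective k v) V) :
  const_mx 1 *m f v = const_mx 1 *m g v :> 'rV_(V v) -> forall w, f w = g w.
Proof.
move=> E w; have := @proj_lin V v 0 g f f; rewrite scale0r add0r => H.
have := @proj_lin V v 1 (rmor0 _ _) g f; rewrite /= mulmx0 scaler0 add0r => /(_ E w) ->.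
by rewrite scaler0 add0r.
Qed.

Definition interval (s t : nat) : rep k A :=
  @Rep k n A (fun v => nat_of_bool (s <= v < t)%N) (fun=> const_mx 1).

(** The identity wherever both modules are nonzero.  It is a morphism when
s <= s' and t <= t', and is replaced by 0 otherwise, which makes the family
total. *)
Definition interval_rmor (s t s' t' : nat) : rmor (interval s t) (interval s' t').
Proof.
exists (fun v => const_mx ((s <= s')%N && (t <= t')%N)%:R) => a /=.
have e := eqP (valP a); rewrite /= in e.
rewrite !const_mxM mul1r mulr1; apply: const_mx_eq; rewrite !lt0b => h h'.
case: andP => [[ss tt]|_]; last by rewrite !mul0rn.
by congr (_ *+ nat_of_bool _); apply/idP/idP => _; lia.
Defined.

End LinearRepresentations.

(** * Projective modules corepresent cohomology *)

Section Corepresentability.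
Variables (k : fieldType) (n : nat) (D : derived_category k (linA n)).
Local Notation A := (linA n).
Implicit Types (X Y Z : complex k A) (V W U : rep k A).

Definition proj_stalk (v : 'I_n) (i : int) : complex k A := stalkz (i + 1) (projective k v).

(** The value of f on the trivial path at v.  The generator is written const_mx 1
since the dimension of P_v at v is (v <= v), which is not convertible to 1. *)
Definition ev v i Y (f : chain (proj_stalk v i) Y) : 'rV[k]_(Y (i + 1) v) :=
  const_mx 1 *m f (i + 1) v.

Lemma mx_norows m p (M N : 'M[k]_(m, p)) : m = 0%N -> M = N.
Proof. by move=> m0; rewrite [M]mx_dim0l // [N]mx_dim0l. Qed.

Lemma rpick_lin b v V (c : k) (f g h : rmor (rpick b (projective k v)) V) :
  const_mx 1 *m h v = c *: (const_mx 1 *m f v) + const_mx 1 *m g v :> 'rV_(V v) ->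
  forall w, h w = c *: f w + g w.
Proof.
case: b f g h => f g h E w; first exact: proj_lin.
by apply/matrixP => -[].
Qed.

Lemma ev_lin v i Y (c : k) (f g h : chain (proj_stalk v i) Y) :
  ev h = c *: ev f + ev g -> forall j w, h j w = c *: f j w + g j w.
Proof.
move=> E j w; case: (eqVneq j (i + 1)) => [->|ne]; first exact: rpick_lin.
by apply: mx_norows; rewrite /= (negbTE ne).
Qed.

Lemma ev_comp v i Y Z (f : chain (proj_stalk v i) Y) (g : chain Y Z) :
  ev (chain_comp g f) = ev f *m g (i + 1) v.
Proof. by rewrite /ev /= mulmxA. Qed.

Lemma ev_cocycle v i Y (f : chain (proj_stalk v i) Y) : ev f *m cdiff Y (i + 1) v = 0.
Proof. by rewrite /ev -mulmxA cmapP /= mul0mx mulmx0. Qed.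

Lemma ev_exists v i Y (x : 'rV_(Y (i + 1) v)) : x *m cdiff Y (i + 1) v = 0 ->
  exists f : chain (proj_stalk v i) Y, ev f = x.
Proof.
move=> xd.
have fd w : yoneda x w *m cdiff Y (i + 1) w = 0.
  apply: (proj_null (f := rcomp (cdiff Y (i + 1)) (yoneda x))) => /=.
  have := yonedaE x; rewrite /= => E.
  by rewrite 2!mulmxA -[const_mx 1 *m _ *m _]mulmxA E xd.
by exists (stz_in fd); rewrite /ev /= rin_at yonedaE.
Qed.

(** A chain map whose value at the generator is a boundary is null-homotopic,
the homotopy being given by a preimage of this value. *)
Lemma ev_boundary v i Y (f : chain (proj_stalk v i) Y) (y : 'rV_(Y i v)) :
  ev f = y *m cdiff Y i v -> loc D f = 0.
Proof.
move=> E; apply/(loc_eq0 D); exists (proj_stalk v i), (chain_id _); split.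
  move=> j w; split=> [x _ [y' Ey]|x xd].
    by exists 0; rewrite mul0mx; move: Ey; rewrite /= mulmx1 mulmx0.
  by exists x, 0; rewrite /= mulmx1 mul0mx addr0 xd.
exists (rin_h (yoneda y)) => j w; rewrite /= !mul0mx add0r mul1mx.
case: (eqVneq j i) => [->|ne]; last first.
  by apply: mx_norows; rewrite /= (inj_eq (addIr 1)) (negbTE ne).
have := @rpick_lin _ v _ 0 (rmor0 _ _) (rcomp (cdiff Y i) (rin_h (yoneda y) i)) (f (i + 1)).
rewrite /= => -> //; first by rewrite scaler0 add0r.
rewrite mulmx0 scaler0 add0r mulmxA rin_h_at yonedaE -E.
by [].
Qed.

(** A quasi-isomorphism s onto the stalk of P_v hits the generator by a cocycle
z; a null-homotopy of f s evaluated at z exhibits f(1) as a boundary. *)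
Lemma ev_loc0 v i Y (f : chain (proj_stalk v i) Y) : loc D f = 0 ->
  exists y : 'rV_(Y i v), ev f = y *m cdiff Y i v.
Proof.
move/(loc_eq0 D) => [Z [s [qs [h fh]]]].
have [_ sur] := qs i v.
have [|z [y' [zd E]]] := sur (const_mx 1); first by rewrite /= mulmx0.
exists (z *m h i v); rewrite /ev E /= mulmx0 addr0.
have /= fhE := fh i v; rewrite -[LHS]mulmxA fhE.
by rewrite mulmxDr !mulmxA zd mul0mx add0r.
Qed.

Lemma loc_ev_lin v i Y (c : k) (f g h : chain (proj_stalk v i) Y) :
  ev h = c *: ev f + ev g -> loc D h = c *: loc D f + loc D g.
Proof. by move=> E; apply: loc_lin; apply: ev_lin. Qed.

Lemma loc_ev_eq v i Y (f g : chain (proj_stalk v i) Y) (y : 'rV_(Y i v)) :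
  ev f = ev g + y *m cdiff Y i v -> loc D f = loc D g.
Proof.
move=> E.
have [|h Eh] := @ev_exists v i Y (- ev g + ev f).
  by rewrite mulmxDl mulNmx !ev_cocycle oppr0 addr0.
have h0 : loc D h = 0 by apply: (@ev_boundary _ _ _ _ y); rewrite Eh E addKr.
have := @loc_ev_lin _ _ _ (-1) g f h; rewrite scaleN1r h0 => /(_ Eh) /esym/eqP.
by rewrite addrC scaleN1r subr_eq0 => /eqP.
Qed.

Lemma loc_ev_inj v i Y (f g : chain (proj_stalk v i) Y) :
  loc D f = loc D g -> exists y : 'rV_(Y i v), ev f = ev g + y *m cdiff Y i v.
Proof.
move=> E.
have [|h Eh] := @ev_exists v i Y (- ev g + ev f).
  by rewrite mulmxDl mulNmx !ev_cocycle oppr0 addr0.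
have := @loc_ev_lin _ _ _ (-1) g f h; rewrite scaleN1r => /(_ Eh).
rewrite E scaleN1r addNr => /ev_loc0 [y Ey]; exists y.
by rewrite -Ey Eh addNKr.
Qed.

(** P_v is projective: the roof Z that represents g has a cocycle over the
generator, which defines a section of Z -> P_v. *)
Lemma loc_surj v i Y (g : D (proj_stalk v i) Y) :
  exists f : chain (proj_stalk v i) Y, g = loc D f.
Proof.
have [Z [s [f [qs E]]]] := loc_frac g.
have [_ sur] := qs i v.
have [|z [y' [zd Ez]]] := sur (const_mx 1); first by rewrite /= mulmx0.
have [fz Efz] := ev_exists zd.
exists (chain_comp f fz); rewrite locM -E -compA -locM.
have -> : loc D (chain_comp s fz) = loc D (chain_id _).
  apply: (@loc_ev_eq _ _ _ _ _ 0); rewrite ev_comp Efz mul0mx addr0.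
  by rewrite /ev /= mulmx1 Ez /= mulmx0 addr0.
by rewrite loc1 compm1.
Qed.

(** The vanishing of H^{i+1}(Y), stated so that it is visibly invariant under
isomorphism in D. *)
Definition coh0 i Y : Prop := forall v, hom0 D (proj_stalk v i) Y.

Lemma coh0P i Y : (forall v, Y (i + 1) v = 0%N) -> coh0 i Y.
Proof.
move=> Y0 v g; have [f ->] := loc_surj g.
by apply: (@ev_boundary _ _ _ _ 0); rewrite mul0mx; apply: mx_dim0r.
Qed.

Lemma coh0_iso i Y Z : iso_obj D Y Z -> coh0 i Y -> coh0 i Z.
Proof. by move=> YZ h v; apply: hom0_iso YZ (h v); apply: iso_refl. Qed.

(** Replacing g by the numerator f of a fraction, the hypothesis on the test
objects is exactly that f is a quasi-isomorphism. *)
Lemma isiso_cohomology X Y (g : D X Y) :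
  (forall v i (x : D (proj_stalk v i) X), g \oc x = 0 -> x = 0) ->
  (forall v i (y : D (proj_stalk v i) Y), exists x, g \oc x = y) -> isiso g.
Proof.
move=> inj sur; have [Z [s [f [qs E]]]] := loc_frac g.
have [t [ts st]] := loc_quasi_iso D qs.
have -> : g = loc D f \oc t by rewrite -E -compA st compm1.
have ti : isiso t by exists (loc D s).
apply: isiso_comp => //; apply: loc_quasi_iso => i v; split.
  move=> x xd [y xy]; have [fx Ex] := ev_exists xd.
  have fx0 : loc D (chain_comp f fx) = 0.
    by apply: (@ev_boundary _ _ _ _ y); rewrite ev_comp Ex.
  have : loc D s \oc loc D fx = 0 by apply: inj; rewrite compA E -locM.
  move=> /(congr1 (fun u => t \oc u)); rewrite compA ts comp1m comp0r.
  by move=> /ev_loc0 [x' Ex']; exists x'; rewrite -Ex.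
move=> y yd; have [fy Ey] := ev_exists yd.
have [x0 Ex0] := sur _ _ (loc D fy).
have [fx Efx] := loc_surj (t \oc x0).
have : loc D (chain_comp f fx) = loc D fy.
  by rewrite locM -Efx -E -compA [loc D s \oc _]compA st comp1m.
move=> /esym /loc_ev_inj [y' E']; exists (ev fx), y'; split.
  exact: ev_cocycle.
by rewrite -Ey E' ev_comp.
Qed.

End Corepresentability.

(** * Interval modules in the derived category *)

Section Intervals.
Variables (k : fieldType) (n : nat) (D : derived_category k (linA n)).
Local Notation A := (linA n).
Implicit Types (X Y Z : complex k A) (V W U : rep k A).

(** The degree is i + 1 so that the stalk of P_v is proj_stalk v i; the module
itself corresponds to i = -1. *)
Definition interval_stalk (i : int) (s t : nat) : complex k A := stalkz (i + 1) (interval k n s t).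

Definition interval_dmor i s t s' t' : D (interval_stalk i s t) (interval_stalk i s' t') :=
  loc D (stz (i + 1) (interval_rmor k n s t s' t')).

Lemma stz_comp m V W U (f : rmor V W) (g : rmor W U) (h : rmor V U) :
  (forall v, f v *m g v = h v) -> loc D (stz m g) \oc loc D (stz m f) = loc D (stz m h).
Proof.
move=> fg; rewrite -locM; apply: loc_ext => i v /=.
by case: (i == m) => /=; rewrite ?fg ?mulmx0.
Qed.

Lemma stz_id m V (f : rmor V V) :
  (forall v, f v = 1%:M) -> loc D (stz m f) = idm D _.
Proof.
move=> f1; rewrite -loc1; apply: loc_ext => i v /=.
by case: (i == m) => /=; rewrite ?f1 //; apply/matrixP => -[].
Qed.

Lemma stz_zero m V W (f : rmor V W) :
  (forall v, f v = 0) -> loc D (stz m f) = 0.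
Proof.
move=> f1; apply: loc_zero => i v /=.
by case: (i == m) => /=; rewrite ?f1.
Qed.

Lemma interval_dmor_comp i s t s' t' s'' t'' :
  (s <= s' <= s'')%N -> (t <= t' <= t'')%N ->
  interval_dmor i s' t' s'' t'' \oc interval_dmor i s t s' t' = interval_dmor i s t s'' t''.
Proof.
move=> /andP[h1 h2] /andP[h3 h4]; apply: stz_comp => v /=.
rewrite h1 h2 h3 h4 (leq_trans h1 h2) (leq_trans h3 h4) const_mxM mulr1.
by apply: const_mx_eq; rewrite !lt0b => a b; rewrite (_ : (s' <= v < t')%N) //; lia.
Qed.

Lemma interval_dmor0 i s t s' t' : (t <= s')%N -> interval_dmor i s t s' t' = 0.
Proof.
move=> ts; apply: stz_zero => v /=; rewrite -[RHS]/(const_mx 0).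
by apply: const_mx_eq; rewrite !lt0b => h h'; lia.
Qed.

Lemma interval_stalk_zero i s t : (t <= s)%N -> zero_obj D (interval_stalk i s t).
Proof.
move=> ts; apply: zero_complex => j v /=; rewrite /rpick.
by case: ifP => // _ /=; case: andP => // -[h h']; lia.
Qed.

(** H^{i+1} of the stalk at v is the one-dimensional space of the interval at v,
or 0. *)
Lemma hom_proj_stalk v i s t (g : D (proj_stalk k v i) (interval_stalk i s t)) :
  exists2 c, g = c *: interval_dmor i 0 v.+1 s t & ~~ (s <= v < t)%N -> g = 0.
Proof.
have [f ->] := loc_surj g.
case: (boolP (s <= v < t)%N) => svt; last first.
  have f0 : loc D f = 0.
    apply: (@ev_boundary _ _ _ _ _ _ _ 0); rewrite mul0mx; apply: mx_dim0r.
    by rewrite /= eqxx /= (negbTE svt).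
  by exists 0 => //; rewrite scale0r.
have [x Ex] : exists x : 'rV[k]_(rpick (i + 1 == i + 1) (interval k n s t) v), ev f = x.
  by exists (ev f).
have [c Ec] : exists c, x = const_mx c.
  move: x {Ex}; rewrite eqxx /= svt => x; exists (x 0 0).
  by apply/matrixP => a b; rewrite !mxE !ord1.
exists c => //.
have [|z Ez] := @ev_exists k n v i (interval_stalk i s t) 0; first by rewrite mul0mx.
rewrite (@loc_ev_lin _ _ _ _ _ _ c
  (stz (i + 1) (interval_rmor k n 0 v.+1 s t) : chain (proj_stalk k v i) _) z f).
  by rewrite (@ev_boundary _ _ D _ _ _ z 0) ?addr0 // Ez mul0mx.
rewrite Ex Ec Ez addr0 /ev /=.
clear x Ex Ec z Ez f g; rewrite eqxx /=.
have /andP[_ vt] := svt; rewrite const_mxM leqnn vt mul1r mulr1n.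
by apply/matrixP => a b; rewrite !mxE mulr1.
Qed.

Lemma hom_proj_stalk_shift v i j s t : i != j -> hom0 D (proj_stalk k v i) (interval_stalk j s t).
Proof.
move=> ij; apply: coh0P => w /=.
by rewrite (inj_eq (addIr 1)) (negbTE ij).
Qed.

Lemma interval_dmor_neq0 i (v : 'I_n) s t : (s <= v < t)%N -> interval_dmor i 0 v.+1 s t <> 0.
Proof.
move=> svt /(@ev_loc0 _ _ D v) [y]; rewrite /= mulmx0 /ev /=.
have /andP[sv vt] := svt.
clear y; rewrite eqxx /= const_mxM leqnn vt mul1r mulr1n.
rewrite sv => /matrixP /(_ 0 0); rewrite !mxE.
by move=> /eqP; rewrite oner_eq0.
Qed.

Lemma hom_proj q i j s t (g : D (interval_stalk i 0 q) (interval_stalk j s t)) : (q <= n)%N ->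
  ~~ [&& i == j, s < q & q <= t]%N -> g = 0.
Proof.
case: q g => [|q] g qn h; first by rewrite ((zero_objP _ (interval_stalk_zero i (leqnn 0))).1 g).
case: (eqVneq i j) => [e|ne]; last exact: (@hom_proj_stalk_shift (Ordinal qn) i j s t ne g).
subst j; have [c _ ->] // := @hom_proj_stalk (Ordinal qn) i s t g.
by move: h; rewrite eqxx /= ltnS.
Qed.

Lemma hom_proj_rho q i s t (g : D (interval_stalk i 0 q) (interval_stalk i s t)) : (q <= n)%N ->
  exists c, g = c *: interval_dmor i 0 q s t.
Proof.
case: q g => [|q] g qn.
  by exists 0; rewrite scale0r ((zero_objP _ (interval_stalk_zero i (leqnn 0))).1 g).
by have [c ->] := @hom_proj_stalk (Ordinal qn) i s t g; exists c.
Qed.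

Lemma interval_dmor_proj_neq0 q i s t : (q <= n)%N -> (s < q <= t)%N -> interval_dmor i 0 q s t <> 0.
Proof.
by case: q => [|q] qn h; [rewrite ltn0 in h|apply: (@interval_dmor_neq0 i (Ordinal qn))].
Qed.

(** At each vertex at most one of the outer terms is nonzero, and the middle term
is equal to it. *)
Lemma interval_exact s t u : (s <= t <= u)%N ->
  rexact (interval_rmor k n s t s u) (interval_rmor k n s u t u).
Proof.
move=> /andP[st tu] v /=; rewrite !leqnn st tu /=.
have : [\/ [/\ (s <= v < t)%N = true, (s <= v < u)%N = true & (t <= v < u)%N = false],
  [/\ (s <= v < t)%N = false, (s <= v < u)%N = true & (t <= v < u)%N = true] |
  [/\ (s <= v < t)%N = false, (s <= v < u)%N = false & (t <= v < u)%N = false]].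
  by case: (ltnP v t) => h1; case: (ltnP v u) => h2; case: (leqP s v) => h3;
     try lia; rewrite ?andbT ?andbF; do ?[by constructor].
case=> -[-> -> ->].
- rewrite [const_mx 1 : 'M_(true, true)]mx11_scalar mxE mul1mx.
  split; first by move=> x; rewrite mulmx1.
  split; first exact: mx_dim0r.
  split; first by move=> y _; exists y; rewrite mulmx1.
  by move=> z; exists 0; rewrite mul0mx; apply: mx_dim0r.
- rewrite [const_mx 1 : 'M_(true, true)]mx11_scalar mxE mulmx1.
  split; first by move=> x _; apply: mx_dim0r.
  split; first exact: mx_dim0l.
  split; first by move=> y; rewrite mulmx1 => ->; exists 0; rewrite mul0mx.
  by move=> z; exists z; rewrite mulmx1.
- split; first by move=> x _; apply: mx_dim0r.
  split; first exact: mx_dim0l.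
  split; first by move=> y _; exists 0; rewrite mul0mx; apply: mx_dim0r.
  by move=> z; exists 0; rewrite mul0mx; apply: mx_dim0r.
Qed.

Lemma interval_dist i s t u : (s <= t <= u)%N ->
  exists w, derived_dist (interval_dmor i s t s u) (interval_dmor i s u t u) w.
Proof. by move=> h; apply/short_exact_dist/rexact_short/interval_exact. Qed.

Definition rpair V W U (f : rmor V W) (g : rmor V U) : rmor V (rsum W U).
Proof.
exists (fun v => row_mx (f v) (g v)) => a /=.
by rewrite mul_mx_row mul_row_block !mulmx0 addr0 add0r !rmxP.
Defined.

Definition rcopair V W U (f : rmor W V) (g : rmor U V) : rmor (rsum W U) V.
Proof.
exists (fun v => col_mx (f v) (g v)) => a /=.
by rewrite mul_block_col mul_col_mx !mul0mx addr0 add0r !rmxP.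
Defined.

(** The four possible positions of a vertex give the exact sequences k -> k^2 ->
k, k -> k -> 0, 0 -> k -> k and 0. *)
Lemma square_exact c a d b : (c <= a)%N -> (a <= d)%N -> (d <= b)%N ->
  rexact (rpair (interval_rmor k n c d c b) (interval_rmor k n c d a d))
         (rcopair (interval_rmor k n c b a b) (ropp (interval_rmor k n a d a b))).
Proof.
move=> ca ad db v /=; rewrite !leqnn ca db /=.
have : [\/ [/\ (c <= v < d)%N = true, (c <= v < b)%N = true,
      (a <= v < d)%N = true & (a <= v < b)%N = true],
  [/\ (c <= v < d)%N = true, (c <= v < b)%N = true,
      (a <= v < d)%N = false & (a <= v < b)%N = false],
  [/\ (c <= v < d)%N = false, (c <= v < b)%N = true,
      (a <= v < d)%N = false & (a <= v < b)%N = true] |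
  [/\ (c <= v < d)%N = false, (c <= v < b)%N = false,
      (a <= v < d)%N = false & (a <= v < b)%N = false]].
  by case: (ltnP v d) => h1; case: (ltnP v b) => h2; case: (leqP c v) => h3;
     case: (leqP a v) => h4; try lia; rewrite ?andbT ?andbF; do ?[by constructor].
have one : const_mx 1 = 1%:M :> 'M[k]_(true, true) by rewrite [LHS]mx11_scalar mxE.
case=> -[-> -> -> ->]; rewrite ?one.
- split; first by move=> x; rewrite mul_mx_row !mulmx1 => /(congr1 lsubmx); rewrite row_mxKl linear0.
  split; first by rewrite mul_row_col !mul1mx subrr.
  split; last first.
    by move=> z; exists (row_mx z 0); rewrite mul_row_col mulmx1 mul0mx addr0.
  move=> y; rewrite -[y]hsubmxK mul_row_col mulmxN !mulmx1 => /eqP.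
  by rewrite subr_eq0 => /eqP ->; exists (rsubmx y); rewrite mul_mx_row !mulmx1.
- split; first by move=> x; rewrite mul_mx_row !mulmx1 => /(congr1 lsubmx); rewrite row_mxKl linear0.
  split; first exact: mx_dim0r.
  split; last by move=> z; exists 0; rewrite mul0mx; apply: mx_dim0r.
  move=> y _; exists (lsubmx y); rewrite mul_mx_row !mulmx1 -{1}[y]hsubmxK.
  by congr row_mx; rewrite [LHS]mx_dim0r // [RHS]mx_dim0r.
- split; first by move=> x _; apply: mx_dim0r.
  split; first exact: mx_dim0l.
  split; last by move=> z; exists (row_mx z 0); rewrite mul_row_col mulmx1 mul0mx addr0.
  move=> y; rewrite -[y]hsubmxK mul_row_col mulmx1 [rsubmx y]mx_dim0r // mul0mx addr0.
  by move=> ->; exists 0; rewrite row_mx0 mul0mx.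
- split; first by move=> x _; apply: mx_dim0r.
  split; first exact: mx_dim0l.
  split; first by move=> y _; exists 0; rewrite mul0mx; apply: mx_dim0r.
  by move=> z; exists 0; rewrite mul0mx; apply: mx_dim0r.
Qed.

Lemma square_dist i c a d b : (c <= a)%N -> (a <= d)%N -> (d <= b)%N ->
  exists w, derived_dist
    (loc D (stz (i + 1) (rpair (interval_rmor k n c d c b) (interval_rmor k n c d a d))))
    (loc D (stz (i + 1) (rcopair (interval_rmor k n c b a b) (ropp (interval_rmor k n a d a b))))) w.
Proof. by move=> *; apply/short_exact_dist/rexact_short/square_exact. Qed.

Lemma stalkz_biproduct m V W : biproduct D (stalkz m (rsum V W)) (stalkz m V) (stalkz m W).
Proof.
exists (loc D (stz m (rpair (rid V) (rmor0 V W)))), (loc D (stz m (rpair (rmor0 W V) (rid W)))),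
  (loc D (stz m (rcopair (rid V) (rmor0 W V)))), (loc D (stz m (rcopair (rmor0 V W) (rid W)))).
split.
  rewrite (@stz_comp m _ _ _ _ _ (rid V)); first exact: stz_id.
  by move=> v /=; rewrite mul_row_col mulmx1 mulmx0 addr0.
split.
  rewrite (@stz_comp m _ _ _ _ _ (rid W)); first exact: stz_id.
  by move=> v /=; rewrite mul_row_col mulmx1 mulmx0 add0r.
rewrite -!locM -loc1 -[X in X + _]scale1r; symmetry; apply: loc_lin => i v /=.
rewrite scale1r; case: (i == m) => /=; last by apply/matrixP => -[].
rewrite !mul_col_mx !mul_mx_row !mulmx0 !mulmx1.
rewrite -/(block_mx 1%:M 0 0 0) -/(block_mx 0 0 0 1%:M) add_block_mx !addr0 !add0r.
exact: scalar_mx_block.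
Qed.

End Intervals.

(** * Orbit categories *)

Section OrbitCategory.
Variables (k : fieldType) (O : Type) (D : lincat k O) (fo : O -> O).
Variables (F : linfunctor D D fo) (G : quasi_inverse F) (E : orbit_category G).
Local Notation go := (qobj G).
Local Notation theta := (opow_mor (orb_th E) (orb_thV E)).
Local Notation Pr := (fmor (proj E)).
Implicit Types X Y Z W : O.

Lemma orb_thV_isiso X : isiso (orb_thV E X).
Proof.
have [t [t1 t2]] := orb_th_iso E (go X).
have -> : orb_thV E X = Pr (qcounit G X) \oc t.
  by rewrite -orb_thVE -compA t2 compm1.
apply: isiso_comp; first exact/fmor_isiso/qcounit_iso.
by exists (orb_th E (go X)).
Qed.

Lemma proj_faithful X Y (f : D X Y) : Pr f = 0 -> f = 0.
Proof.
move=> f0.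
pose h i : D X (opow fo go i Y) :=
    match i return D X (opow fo go i Y) with Posz 0 => f | _ => 0 end.
have := @orb_free _ _ _ _ _ _ E X Y [:: 0] h isT.
by rewrite big_seq1 /= f0 comp0r => /(_ erefl 0 (mem_head _ _)).
Qed.

(** Terms of equal index are added up, and those of index 0 are collected in f0,
since opow_mor is the identity there. *)
Lemma orb_decomp X Y (g : E X Y) :
  exists (s : seq int) (f : forall i, D X (opow fo go i Y)) (f0 : D X Y),
    [/\ uniq s, 0 \notin s & g = Pr f0 + \sum_(i <- s) theta i Y \oc Pr (f i)].
Proof.
have [s [f ->]] := orb_span g.
elim: s => [|j s [s' [f' [f0 [us s0 IH]]]]].
  by exists [::], f, 0; split=> //; rewrite !big_nil fmor0 addr0.
rewrite big_cons IH.
case: (eqVneq j 0) => [->|j0].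
  exists s', f', (f 0 + f0); split=> //.
  by rewrite fmorD -!addrA /= comp1m.
case: (boolP (j \in s')) => js.
  exists s', (fun i => f' i + (i == j)%:R *: f i), f0; split=> //.
  rewrite addrCA; congr (_ + _).
  rewrite [RHS](eq_bigr (fun i => theta i Y \oc Pr (f' i) +
    (i == j)%:R *: (theta i Y \oc Pr (f i)))); last first.
    by move=> i _; rewrite fmorD compDr fmorZ compZr.
  rewrite big_split addrC /=; congr (_ + _).
  by rewrite (bigD1_seq j) //= eqxx scale1r big1 ?addr0 // => i /negbTE ->; rewrite scale0r.
exists (j :: s'), (fun i => if i \in s' then f' i else f i), f0; split.
- by rewrite /= js.
- by rewrite inE negb_or eq_sym j0.
rewrite big_cons (negbTE js) addrCA; congr (_ + (_ + _)).
by rewrite big_seq [RHS]big_seq; apply: eq_bigr => i ->.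
Qed.

Lemma orb_component0 X Y s (f : forall i, D X (opow fo go i Y)) (f0 : D X Y) :
  uniq s -> 0 \notin s ->
  Pr f0 + \sum_(i <- s) theta i Y \oc Pr (f i) = 0 -> f0 = 0.
Proof.
move=> us s0 e.
(* The family f with its component of index 0 replaced by f0. *)
pose h i : D X (opow fo go i Y) :=
    (match i return D X (opow fo go i Y) -> D X (opow fo go i Y) with
     | Posz 0 => fun=> f0 | _ => id end) (f i).
apply: (@orb_free _ _ _ _ _ _ E X Y (0 :: s) h _ _ 0 (mem_head _ _)); first by rewrite /= s0.
rewrite big_cons -[RHS]e /= comp1m; congr (_ + _).
rewrite big_seq [RHS]big_seq; apply: eq_bigr => i si.
by case: i si => [[|i]|i] // si; rewrite si in s0.
Qed.

(** Only the component of index 0 of h contributes to the component of index 0 of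
h u, and g is concentrated in index 0. *)
Lemma proj_extend A B W (u : D A B) (h : E B W) (g : D A W) :
  h \oc Pr u = Pr g -> exists h0 : D B W, h0 \oc u = g.
Proof.
have [s [f [f0 [us s0 ->]]]] := orb_decomp h => e.
exists f0; apply/eqP; rewrite -subr_eq0; apply/eqP.
apply: (@orb_component0 _ _ s (fun i => f i \oc u)) => //.
rewrite fmorB -e compDl -fmorM comp_suml opprD addrA subrr add0r addrC.
by apply/eqP; rewrite subr_eq0; apply/eqP/eq_bigr => i _; rewrite fmorM compA.
Qed.

Lemma proj_full X Y : (forall i, i != 0 -> hom0 D X (opow fo go i Y)) ->
  forall g : E X Y, exists f : D X Y, g = Pr f.
Proof.
move=> h g; have [s [f [f0 [us s0 ->]]]] := orb_decomp g; exists f0.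
rewrite big_seq big1 ?addr0 // => i si.
by rewrite (h i _ (f i)) ?fmor0 ?comp0r //; apply: contraNneq s0 => <-.
Qed.

(** opow_mor at the index -1 is orb_thV. *)
Lemma proj_component_m1 X Y :
  (forall i, i != -1 -> hom0 D X (opow fo go i Y)) ->
  forall g : E X Y, exists f : D X (go Y), g = orb_thV E Y \oc Pr f.
Proof.
move=> h g; have [s [f ->]] := orb_span g.
elim: s => [|i s [f' IH]]; first by exists 0; rewrite big_nil fmor0 comp0r.
rewrite big_cons IH; case: (eqVneq i (-1)) => [->|ne].
  by exists (f (-1) + f'); rewrite fmorD compDr /= comp1m.
by exists f'; rewrite (h i ne (f i)) fmor0 comp0r add0r.
Qed.

End OrbitCategory.

(** * Morphisms between interval modules and their Auslander-Reiten translates *)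

Section ClusterLayer.
Variables (k : fieldType) (n : nat) (C : cluster_category k (linA n)).
Local Notation A := (linA n).
Local Notation D := (cl_D C).
Local Notation Pr := (fmor (proj (cl_orb C))).
Local Notation sD := (fmor (dshift D)).
Local Notation ist := (interval_stalk k n).
Local Notation rhoi := (interval_dmor D).
Implicit Types (X Y Z W : complex k A).

Lemma proj_iso X Y : iso_obj D X Y -> iso_obj C X Y.
Proof. exact: (fmor_iso (proj (cl_orb C))). Qed.

(** The shift of C is an equivalence that restricts to the shift of D, and D
embeds into C. *)
Lemma dshift_faithful X Y (f : D X Y) : sD f = 0 -> f = 0.
Proof.
move=> f0; apply: (proj_faithful (E := cl_orb C)).
apply: (qinv_faithful (tri_shift (cl_tri C))).
by rewrite cl_shiftE f0 !fmor0.
Qed.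

Lemma shift_hom0 X Y : hom0 D X Y <-> hom0 D (shiftc X) (shiftc Y).
Proof.
split=> h f; last by apply: dshift_faithful; apply: h.
by have [g <-] := dshift_full f; rewrite (h g) fmor0.
Qed.

Lemma shift_iso X Y : iso_obj D X Y -> iso_obj D (shiftc X) (shiftc Y).
Proof. exact: (fmor_iso (dshift D)). Qed.

Section Exactness.
Variables (X Y Z : complex k A) (u : D X Y) (v : D Y Z) (w : D Z (shiftc X)).
Hypothesis d : derived_dist u v w.

Lemma derived_comp0 : v \oc u = 0.
Proof.
by apply: (proj_faithful (E := cl_orb C)); rewrite fmorM (dist_comp0 (cl_dist d)).
Qed.

Lemma derived_comp0s : sD u \oc w = 0.
Proof.
apply: (proj_faithful (E := cl_orb C)); rewrite fmorM -cl_shiftE.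
have := dist_comp0' (dist_rot (cl_dist d)); rewrite compNl => /eqP.
by rewrite oppr_eq0 => /eqP.
Qed.

Lemma derived_ext2 W (f : D Z W) : f \oc v = 0 -> exists h : D (shiftc X) W, h \oc w = f.
Proof.
move=> fv; have [|h Eh] := dist_ext2 (f := Pr f) (cl_dist d).
  by rewrite -fmorM fv fmor0.
by apply: (proj_extend (E := cl_orb C) (h := h)).
Qed.

Lemma derived_ext3 W (f : D (shiftc X) W) :
  f \oc w = 0 -> exists h : D (shiftc Y) W, h \oc sD u = f.
Proof.
move=> fw; have [|h Eh] := dist_ext3 (f := Pr f : C (shiftc X) W) (cl_dist d).
  by rewrite -fmorM fw fmor0.
by apply: (proj_extend (E := cl_orb C) (h := h)); rewrite Eh cl_shiftE.
Qed.

End Exactness.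

Lemma interval_stalk_shift i s t : iso_obj D (shiftc (ist (i + 1) s t)) (ist i s t).
Proof. exact: stalkz_shift_iso. Qed.

Lemma interval_stalk_shift' i s t : iso_obj D (shiftc (ist i s t)) (ist (i - 1) s t).
Proof. by have := interval_stalk_shift (i - 1) s t; rewrite subrK. Qed.

Lemma coh0_hom i q Y : (q <= n)%N -> coh0 D i Y -> hom0 D (ist i 0 q) Y.
Proof.
case: q => [|q] qn h; first exact: (zero_objP _ (interval_stalk_zero D i (leqnn 0))).1.
exact: (h (Ordinal qn)).
Qed.

Lemma coh0_shift i Y : coh0 D i (shiftc Y) <-> coh0 D (i + 1) Y.
Proof.
split=> h v.
  apply: (shift_hom0 _ _).2; apply: hom0_iso (iso_refl _ _) (h v).
  exact/iso_sym/stalkz_shift_iso.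
apply: hom0_iso (iso_refl _ _) ((shift_hom0 _ _).1 (h v)).
exact: stalkz_shift_iso.
Qed.

(** The Hom sequence of [0, s) -> [0, t) -> [s, t) -> [0, s)[1]. *)
Lemma interval_hom0 i s t Y : (s <= t <= n)%N ->
  coh0 D i Y -> coh0 D (i - 1) Y -> hom0 D (ist i s t) Y.
Proof.
move=> /andP[st tn] h h' g.
have sn := leq_trans st tn.
have [|w d] := @interval_dist _ _ D i 0 s t; first by rewrite leq0n.
have [|y <-] := derived_ext2 (f := g) d; first exact: (coh0_hom tn h (_ \oc _)).
rewrite [y](_ : _ = 0) ?comp0l //.
apply: (hom0_iso _ (iso_refl _ _) (coh0_hom sn h')).
exact/iso_sym/interval_stalk_shift'.
Qed.

Lemma interval_stalk_coh0 i j s t : i != j -> coh0 D i (ist j s t).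
Proof. by move=> ij v; apply: hom_proj_stalk_shift. Qed.

Lemma interval_hom_epi i s t Y (g : D (ist i s t) Y) : (s <= t <= n)%N ->
  coh0 D (i - 1) Y -> g \oc rhoi i 0 t s t = 0 -> g = 0.
Proof.
move=> /andP[st tn] h' e; have sn := leq_trans st tn.
have [|w d] := @interval_dist _ _ D i 0 s t; first by rewrite leq0n.
have [y <-] := derived_ext2 (f := g) d e.
rewrite [y](_ : _ = 0) ?comp0l //.
apply: (hom0_iso _ (iso_refl _ _) (coh0_hom sn h')).
exact/iso_sym/interval_stalk_shift'.
Qed.

(** A morphism is determined by its restriction to [0, t), which is a scalar c.  As
this restriction vanishes on [0, s), the scalar is 0 unless s <= s'. *)
Lemma interval_hom i s t s' t' (g : D (ist i s t) (ist i s' t')) : (s <= t <= n)%N ->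
  exists2 c, g = c *: rhoi i s t s' t' & ~~ [&& s <= s', s' < t & t <= t']%N -> g = 0.
Proof.
move=> /andP[st tn]; have sn := leq_trans st tn.
have epi (h : D (ist i s t) (ist i s' t')) : h \oc rhoi i 0 t s t = 0 -> h = 0.
  apply: interval_hom_epi; rewrite ?st //.
  apply: interval_stalk_coh0; lia.
have [c Ec] := hom_proj_rho (g \oc rhoi i 0 t s t) tn.
case: (boolP (s' < t <= t')%N) => [/andP[s't tt']|ne]; last first.
  have g0 : g = 0.
    by apply: epi; apply: hom_proj => //; rewrite eqxx.
  by exists 0; rewrite ?scale0r.
case: (leqP s s') => ss'.
  exists c; last by [].
  apply/eqP; rewrite -subr_eq0; apply/eqP/epi.
  by rewrite compBl compZl interval_dmor_comp ?leq0n ?leqnn ?ss' ?tt' // Ec subrr.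
have g0 : g = 0.
  apply: epi; rewrite Ec.
  have [|w d] := @interval_dist _ _ D i 0 s t; first by rewrite leq0n.
  have : g \oc rhoi i 0 t s t \oc rhoi i 0 s 0 t = 0.
    by rewrite -compA (derived_comp0 d) comp0r.
  rewrite Ec compZl interval_dmor_comp ?leqnn ?st ?tt' // => /eqP.
  rewrite scaler_eq0 => /orP[/eqP ->|/eqP e]; first by rewrite scale0r.
  by case: (@interval_dmor_proj_neq0 _ _ D s i s' t' sn _ e); rewrite ss' (leq_trans st tt').
by exists 0; rewrite ?scale0r.
Qed.

Section Serre.
Local Notation tau := (tau (cl_tau C)).
Local Notation tr := (ar_trace (cl_tau C)).

(** Otherwise f and 0 represent the same functional. *)
Lemma trace_nondegenerate X Y (f : D X Y) : f <> 0 ->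
  exists g : D Y (shiftc (tau X)), tr X (g \oc f) <> 0.
Proof.
move=> f0; apply: NNPP => h; apply: f0.
have H (g : D Y (shiftc (tau X))) : tr X (g \oc f) = 0.
  by apply: NNPP => ne; apply: h; exists g.
pose phi : {scalar (D Y (shiftc (tau X)))} := \0.
have [f1 [_ uniq1]] := @ar_perfect _ _ _ _ (cl_tau C) X Y phi.
have e1 : f1 = f by apply: uniq1 => g; rewrite H.
have e2 : f1 = 0 by apply: uniq1 => g; rewrite comp0r linear0.
by rewrite -e1 e2.
Qed.

(** Serre duality is applied to Y and the Serre dual of X.  A morphism from the
Serre dual of X to that of Y comes from some h : X -> Y, and ar_nat moves h to
the other side of g. *)
Lemma trace_separates X Y (g : D Y (shiftc (tau X))) :
  (forall h : D X Y, tr X (g \oc h) = 0) -> g = 0.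
Proof.
move=> h; apply: NNPP => /trace_nondegenerate[l]; apply.
have [l1 <-] := dshift_full l.
have [l2 <-] := qinv_full (tauI (cl_tau C)) l1.
by rewrite -ar_nat h.
Qed.

(** Choose g : Z[1] -> (tau X)[1] pairing nontrivially with f.  Composition with g
is bijective on each test object T: the spaces D(T, Z) and
D(T, tau X) = D(X, T[1])^* are both zero or both spanned by one element, and in
the second case the two generators are paired to the trace of g f. *)
Lemma serre_recognition X Z (f : D X (shiftc Z)) : f <> 0 ->
  (forall v i,
    let T := proj_stalk k v i in
    (hom0 D X (shiftc T) /\ hom0 D T Z) \/
    (exists (e0 : D X (shiftc T)) (h0 : D T Z),
      [/\ forall e, exists c, e = c *: e0, forall h, exists c, h = c *: h0 &
          sD h0 \oc e0 = f])) ->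
  iso_obj D Z (tau X).
Proof.
move=> f0 H; have [g gf] := trace_nondegenerate f0.
have [g' Eg'] := dshift_full g; exists g'.
apply: isiso_cohomology => v i.
  move=> x gx; have [[_ hZ]|[e0 [h0 [He Hh Ef]]]] := H v i; first exact: hZ.
  have [c Ec] := Hh x; rewrite Ec.
  have : tr X (sD (g' \oc x) \oc e0) = 0 by rewrite gx fmor0 comp0l linear0.
  rewrite Ec fmorM fmorZ compZr compZl -compA Ef Eg' linearZ /=.
  by move/eqP; rewrite mulf_eq0 => /orP[/eqP ->|/eqP //]; rewrite scale0r.
move=> y; have [[hX _]|[e0 [h0 [He Hh Ef]]]] := H v i.
  exists 0; rewrite comp0r; symmetry; apply: dshift_faithful.
  by apply: trace_separates => h; have -> : h = 0 := hX h; rewrite comp0r linear0.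
pose a := tr X (sD y \oc e0); pose b := tr X (g \oc f).
exists ((a / b) *: h0); apply/eqP; rewrite -subr_eq0; apply/eqP.
apply: dshift_faithful; apply: trace_separates => h; have [c ->] := He h.
rewrite fmorB fmorM fmorZ Eg' compZr compBl compZr compZl -compA Ef.
rewrite linearZ /= linearB /= linearZ /= -/a -/b.
by rewrite divfK ?subrr ?mulr0 //; apply/eqP.
Qed.

(** The Hom sequence of [0, s) -> [0, t) -> [s, t) -> [0, s)[1], the first map
being injective on morphisms into P_v because s > 0. *)
Lemma interval_hom_proj_shift i s t v j w (x : D (ist i s t) (shiftc (proj_stalk k v j))) :
  (0 < s < t)%N -> (t <= n)%N -> derived_dist (rhoi i 0 s 0 t) (rhoi i 0 t s t) w ->
  exists2 x' : D (ist i 0 s) (proj_stalk k v j), x = sD x' \oc w &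
    ~~ ((i == j) && (s <= v.+1 < t)%N) -> x = 0.
Proof.
move=> /andP[s0 st] tn d; have sn : (s <= n)%N by lia.
have vn := ltn_ord v.
have x0 : x \oc rhoi i 0 t s t = 0.
  have [a [a' [a'a aa']]] := interval_stalk_shift' j 0 v.+1.
  have inj W (z : D W (shiftc (ist j 0 v.+1))) : a \oc z = 0 -> z = 0.
    by move=> az; rewrite -[z]comp1m -a'a -compA az comp0r.
  apply: inj; case: (boolP [&& i == (j - 1)%R, 0 < t & t <= v.+1]%N) => [/and3P[/eqP e _ tv]|ne].
    clear a' a'a aa'; move: a; rewrite -e => a.
    have [c Ec] := hom_proj_rho (a \oc (x \oc rhoi i 0 t s t)) tn.
    have : a \oc (x \oc rhoi i 0 t s t) \oc rhoi i 0 s 0 t = 0.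
      by rewrite -!compA (derived_comp0 d) !comp0r.
    rewrite Ec compZl interval_dmor_comp ?leqnn ?leq0n ?tv ?(ltnW st) // => /eqP.
    rewrite scaler_eq0 => /orP[/eqP ->|/eqP e0]; first by rewrite scale0r.
    case: (@interval_dmor_proj_neq0 _ _ D s i 0 v.+1 sn _ e0); lia.
  exact: (hom_proj _ tn ne).
have [y Ey] := derived_ext2 d x0; have [x' Ex'] := dshift_full y.
exists x'; first by rewrite Ex' Ey.
case: (eqVneq i j) => [e|ne _]; last first.
  by rewrite -Ey -Ex' (hom_proj (x' : D (ist i 0 s) (ist j 0 v.+1)) sn) ?fmor0 ?comp0l // (negbTE ne).
subst j; rewrite /= => ne; rewrite -Ey -Ex'.
have [c ->] := hom_proj_rho (x' : D (ist i 0 s) (ist i 0 v.+1)) sn.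
case: (leqP s v.+1) => sv; last first.
  have -> : rhoi i 0 s 0 v.+1 = 0.
    by apply: (hom_proj _ sn); rewrite eqxx s0 /= -ltnNge.
  by rewrite scaler0 fmor0 comp0l.
have tv : (t <= v.+1)%N by move: ne; rewrite sv /= -leqNgt.
rewrite -(@interval_dmor_comp _ _ D i 0 s 0 t 0 v.+1) ?leq0n ?tv ?(ltnW st) //.
by rewrite fmorZ fmorM compZl -compA (derived_comp0s d) comp0r scaler0.
Qed.

(** The morphism to recognize is [s + 1, t + 1) -> P_s[1] -> [s, t)[1]; it factors
through P_v[1] for every v in [s, t). *)
Lemma tau_interval i s t : (s < t)%N -> (t.+1 <= n)%N ->
  iso_obj D (ist i s t) (tau (ist i s.+1 t.+1)).
Proof.
move=> st tn; have sn : (s.+1 <= n)%N by lia.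
have [|w d] := @interval_dist _ _ D i 0 s.+1 t.+1; first by lia.
pose f := sD (rhoi i 0 s.+1 s t) \oc w.
have f0 : f <> 0.
  move=> /(derived_ext3 d) [h].
  have [h' <-] := dshift_full h; rewrite -fmorM => E.
  have : h' \oc rhoi i 0 s.+1 0 t.+1 - rhoi i 0 s.+1 s t = 0.
    by apply: dshift_faithful; rewrite fmorB E subrr.
  rewrite (hom_proj h' tn); last by rewrite ltnn !andbF.
  rewrite comp0l sub0r => /eqP; rewrite oppr_eq0 => /eqP.
  by apply: interval_dmor_proj_neq0 => //; rewrite ltnSn.
apply: (serre_recognition f0) => v j T; have vn := ltn_ord v.
have Hx (x : D (ist i s.+1 t.+1) (shiftc T)) := interval_hom_proj_shift x.
have sst : (0 < s.+1 < t.+1)%N by [].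
case: (boolP ((i == j) && (s.+1 <= v.+1 < t.+1)%N)) => [/andP[/eqP e svt]|ne]; last first.
  left; split=> x; first by have [x' _ ->] := Hx _ x sst tn d.
  by apply: (hom_proj (x : D (ist j 0 v.+1) _) vn); rewrite eq_sym -(ltnS v.+1).
right; subst j.
exists (sD (rhoi i 0 s.+1 0 v.+1) \oc w), (rhoi i 0 v.+1 s t); split.
- move=> x; have [x' -> _] := Hx _ x sst tn d.
  have [c ->] := hom_proj_rho (x' : D (ist i 0 s.+1) (ist i 0 v.+1)) sn.
  by exists c; rewrite fmorZ compZl.
- by move=> h; apply: (hom_proj_rho (h : D (ist i 0 v.+1) (ist i s t)) vn).
rewrite compA -fmorM; congr (sD _ \oc _).
by apply: (@interval_dmor_comp _ _ D i 0 s.+1 0 v.+1 s t); lia.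
Qed.

(** The morphism to recognize is the shift of P_s -> [s, n). *)
Lemma tau_proj i s : (s < n)%N -> iso_obj D (ist i s n) (tau (shiftc (ist i 0 s.+1))).
Proof.
move=> sn.
have f0 : sD (rhoi i 0 s.+1 s n) <> 0.
  by move/dshift_faithful; apply: interval_dmor_proj_neq0; rewrite // ltnSn.
apply: (serre_recognition f0) => v j T; have vn := ltn_ord v.
case: (boolP ((i == j) && (s.+1 <= v.+1)%N)) => [/andP[/eqP e sv]|ne]; last first.
  left; split.
    apply: (shift_hom0 _ _).1 => x; apply: (hom_proj (x : D (ist i 0 s.+1) (ist j 0 v.+1)) sn).
    by rewrite /=.
  by move=> x; apply: (hom_proj (x : D (ist j 0 v.+1) _) vn); rewrite eq_sym vn andbT.
right; subst j.
exists (sD (rhoi i 0 s.+1 0 v.+1)), (rhoi i 0 v.+1 s n); split.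
- move=> x; have [x' <-] := dshift_full x.
  have [c ->] := hom_proj_rho (x' : D (ist i 0 s.+1) (ist i 0 v.+1)) sn.
  by exists c; rewrite fmorZ.
- by move=> h; apply: (hom_proj_rho (h : D (ist i 0 v.+1) (ist i s n)) vn).
rewrite -fmorM; congr (sD _).
by apply: (@interval_dmor_comp _ _ D i 0 s.+1 0 v.+1 s n); lia.
Qed.

End Serre.
End ClusterLayer.

(** * The orbit functor and the exchange triangles *)

Section OrbitVanishing.
Variables (k : fieldType) (n : nat) (C : cluster_category k (linA n)).
Local Notation A := (linA n).
Local Notation D := (cl_D C).
Local Notation Pr := (fmor (proj (cl_orb C))).
Local Notation ist := (interval_stalk k n).
Local Notation rhoi := (interval_dmor D).
Local Notation tauo := (tau (cl_tau C)).
Local Notation tinv := (qobj (tauI (cl_tau C))).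
Local Notation Fo := (fun X => tinv (shiftc X)).
Local Notation Go := (qobj (cl_inv C)).
Implicit Types (X Y Z W : complex k A).

Lemma proj_biproduct B X Y : biproduct D B X Y -> biproduct C B X Y.
Proof.
have PM := fmorM (proj (cl_orb C)); have P1 := fmor1 (proj (cl_orb C)).
move=> [i1 [i2 [p1 [p2 [e1 [e2 e3]]]]]]; exists (Pr i1), (Pr i2), (Pr p1), (Pr p2).
split; first by rewrite -[LHS]PM e1 P1.
split; first by rewrite -[LHS]PM e2 P1.
by rewrite -P1 -e3 fmorD !PM.
Qed.

Lemma tau_iso X Y : iso_obj D X Y -> iso_obj D (tauo X) (tauo Y).
Proof. exact: (fmor_iso (tauF (cl_tau C))). Qed.

Lemma tinv_iso X Y : iso_obj D X Y -> iso_obj D (tinv X) (tinv Y).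
Proof. exact: (fmor_iso (qfun (tauI (cl_tau C)))). Qed.

Lemma Go_iso X Y : iso_obj D X Y -> iso_obj D (Go X) (Go Y).
Proof. exact: (fmor_iso (qfun (cl_inv C))). Qed.

Lemma tinv_eq X Y : iso_obj D X (tauo Y) -> iso_obj D (tinv X) Y.
Proof.
by move=> /tinv_iso h; apply: iso_trans h _; apply: (qunit_isoobj (tauI (cl_tau C))).
Qed.

Lemma Go_eq X Y : iso_obj D X (Fo Y) -> iso_obj D (Go X) Y.
Proof.
by move=> /Go_iso h; apply: iso_trans h _; apply: (qunit_isoobj (cl_inv C)).
Qed.

Lemma FoGo X : iso_obj D (Fo (Go X)) X.
Proof. exact: (qcounit_isoobj (cl_inv C)). Qed.

(** H^j(Y) = 0 for j > m; recall that coh0 i concerns H^{i+1}. *)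
Definition coh_le (m : int) Y : Prop := forall i, m <= i -> coh0 D i Y.
(** H^j(Y) = 0 for j <= m. *)
Definition coh_ge (m : int) Y : Prop := forall i, i < m -> coh0 D i Y.

Lemma coh_le_iso m X Y : iso_obj D X Y -> coh_le m X -> coh_le m Y.
Proof. by move=> XY h i mi; apply: coh0_iso XY (h i mi). Qed.

Lemma coh_ge_iso m X Y : iso_obj D X Y -> coh_ge m X -> coh_ge m Y.
Proof. by move=> XY h i mi; apply: coh0_iso XY (h i mi). Qed.

Lemma coh_le_shift m Y : coh_le m Y -> coh_le (m - 1) (shiftc Y).
Proof. by move=> h i mi; apply/coh0_shift/h; rewrite -lerBlDr. Qed.

(** By adjunction the cohomology of F Y at v is D(tau P_v, Y[1]) up to a shift, and
tau P_v is an interval module in degree 1, with projective dimension 1. *)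
Lemma Fo_coh_le m Y : coh_le m Y -> coh_le (m - 1) (Fo Y).
Proof.
move=> h i mi v; have vn := ltn_ord v; have Yh := coh_le_shift h.
apply: (qinv_hom0 (tauI (cl_tau C))).
apply: (hom0_iso (X := ist (i + 1) v n) (Y := shiftc Y)).
- apply: iso_trans (tau_proj C (i + 1) vn) _.
  exact/tau_iso/interval_stalk_shift.
- exact/iso_sym/(qcounit_isoobj (tauI (cl_tau C))).
by apply: interval_hom0; [rewrite (ltnW vn) leqnn|apply: Yh; lia..].
Qed.

(** By adjunction the cohomology of F^-1 Y at v is D(F P_v, Y), and F P_v is a
shifted interval module or projective, computed from tau. *)
Lemma Go_coh_ge m Y : coh_ge m Y -> coh_ge (m + 1) (Go Y).
Proof.
move=> h i mi v; have vn := ltn_ord v.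
apply: (qinv_hom0 (cl_inv C)).
have Ts : iso_obj D (shiftc (proj_stalk k v i)) (ist (i - 1) 0 v.+1).
  exact: (interval_stalk_shift' C i 0 v.+1).
case: (ltnP v.+1 n) => vn'.
  apply: (hom0_iso (X := ist (i - 1) 1 v.+2) (Y := Y)).
  - apply/iso_sym/tinv_eq/(iso_trans Ts).
    exact: tau_interval.
  - exact/iso_sym/FoGo.
  by apply: interval_hom0 => //; apply: h; lia.
have e : v.+1 = n by apply/eqP; rewrite eqn_leq vn vn'.
have n0 : (0 < n)%N by rewrite -e.
apply: (hom0_iso (X := ist (i - 1 - 1) 0 1) (Y := Y)).
- apply: iso_sym; apply: iso_trans (interval_stalk_shift' C (i - 1) 0 1).
  apply/tinv_eq/(iso_trans Ts); rewrite e.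
  exact: tau_proj.
- exact/iso_sym/FoGo.
by apply: coh0_hom => //; apply: h; lia.
Qed.

Lemma iter_Fo_coh_le r m Y : coh_le m Y -> coh_le (m - r%:Z) (iter r Fo Y).
Proof.
move=> h; elim: r => [|r IH]; first by rewrite subr0.
by have := Fo_coh_le IH; rewrite -addrA -opprD -PoszD addn1.
Qed.

Lemma iter_Go_coh_ge r m Y : coh_ge m Y -> coh_ge (m + r%:Z) (iter r Go Y).
Proof.
move=> h; elim: r => [|r IH]; first by rewrite addr0.
by have := Go_coh_ge IH; rewrite -addrA -PoszD addn1.
Qed.

Lemma iter_Go_iso r X Y : iso_obj D X Y -> iso_obj D (iter r Go X) (iter r Go Y).
Proof. by move=> h; elim: r => //= r; apply: Go_iso. Qed.

Lemma interval_stalk_coh_le i s t : coh_le (i + 1) (ist i s t).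
Proof. move=> j ij; apply: interval_stalk_coh0; lia. Qed.

Lemma interval_stalk_coh_ge i s t : coh_ge i (ist i s t).
Proof. move=> j ij; apply: interval_stalk_coh0; lia. Qed.

Lemma coh_le_le m m' Y : m <= m' -> coh_le m Y -> coh_le m' Y.
Proof. by move=> mm h i mi; apply: h; apply: le_trans mm mi. Qed.

Lemma interval_coh_le0 s t Y : (s <= t <= n)%N -> coh_le (- 2) Y -> hom0 D (ist (-1) s t) Y.
Proof. by move=> st h; apply: interval_hom0 => //; apply: h. Qed.

Lemma interval_coh_ge0 s t Y : (s <= t <= n)%N -> coh_ge 0 Y -> hom0 D (ist (-1) s t) Y.
Proof. by move=> st h; apply: interval_hom0 => //; apply: h. Qed.

(** The indecomposable [a, b) of the cluster category, where [a, n + 1) is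
P_{a-1}[1].  The value 0 at a = b = n + 1 makes cluster_obj a a zero for every a. *)
Definition cluster_obj (a b : nat) : complex k A :=
  if (b <= n)%N then ist (-1) a b
  else shiftc (ist (-1) 0 (if (a <= n)%N then a else 0%N)).

Lemma cluster_obj_coh_le a b : coh_le 0 (cluster_obj a b).
Proof.
rewrite /cluster_obj; case: ifP => _; first exact: (interval_stalk_coh_le (i := -1)).
by apply: coh_le_le (coh_le_shift (interval_stalk_coh_le (i := -1) (s := _) (t := _))).
Qed.

Lemma Fo_interval a b : (a < b)%N -> (b <= n)%N ->
  iso_obj D (Fo (ist (-1) a b)) (shiftc (cluster_obj a.+1 b.+1)).
Proof.
move=> ab bn; apply: tinv_eq.
apply: iso_trans (interval_stalk_shift' C (-1) a b) _.
rewrite /cluster_obj; case: ltnP => bn'.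
  apply: iso_trans (tau_interval C _ ab bn') _; apply: tau_iso.
  exact/iso_sym/interval_stalk_shift'.
have e : b = n by apply/eqP; rewrite eqn_leq bn bn'.
subst b; rewrite ab; apply: iso_trans (tau_proj C _ ab) _.
apply: tau_iso; apply: shift_iso.
exact/iso_sym/interval_stalk_shift'.
Qed.

Lemma Fo_injective b : (b < n)%N ->
  iso_obj D (Fo (ist 0 b n)) (shiftc (ist (-1) 0 b.+1)).
Proof.
move=> bn; apply: tinv_eq; apply: iso_trans (interval_stalk_shift' C 0 b n) _.
exact: (tau_proj C (-1)).
Qed.

(** F [a, b) = tau^-1 ([a, b)[1]) is the shift of [a + 1, b + 1), and every object
is isomorphic to its image under F in the orbit category. *)
Lemma cluster_obj_rotate a b : (a <= b <= n)%N ->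
  iso_obj C (ist (-1) a b) (shiftc (cluster_obj a.+1 b.+1)).
Proof.
move=> /andP[ab bn]; case: (ltnP a b) => h; last first.
  have e : a = b by apply/eqP; rewrite eqn_leq ab h.
  subst b; have z : zero_obj D (ist (-1) a a) by apply: interval_stalk_zero.
  have z' : zero_obj D (shiftc (cluster_obj a.+1 a.+1)).
    rewrite /zero_obj -(fmor1 (dshift D)) [idm D _](_ : _ = 0) ?fmor0 //.
    rewrite /cluster_obj; case: ltnP => an; first exact: interval_stalk_zero.
    rewrite -(fmor1 (dshift D)) [idm D _](_ : _ = 0) ?fmor0 //.
    exact: interval_stalk_zero.
  exact: (proj_iso (zero_iso z z')).
apply: iso_trans (proj_iso (Fo_interval h bn)).
have [t [t1 t2]] := orb_th_iso (cl_orb C) (ist (-1) a b).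
by exists t, (orb_th (cl_orb C) (ist (-1) a b)).
Qed.

Lemma hom_from_Go X Y Z : iso_obj D (Go Y) Z ->
  (forall i, i != -1 -> hom0 D X (opow Fo Go i Y)) ->
  forall g : C X Y, exists2 z : C Z Y, isiso z & exists f : D X Z, g = z \oc Pr f.
Proof.
move=> [a [a' [a'a aa']]] h g.
have [f ->] := proj_component_m1 h g.
exists (orb_thV (cl_orb C) Y \oc Pr a').
  apply: isiso_comp; first exact: orb_thV_isiso.
  by apply: (fmor_isiso (proj (cl_orb C))); exists a.
by exists (a \oc f); rewrite -compA -fmorM compA a'a comp1m.
Qed.

(** Of the components D([c, d), F^i M[1]) those with i > 0 and those with i < -1
vanish for degree reasons, and the one with i = 0 by hypothesis.  The remaining
one is D([c, d), [a - 1, b - 1)); if a = 0 then F^-1 M[1] = tau M lives in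
cohomological degree 1 and there is no morphism at all. *)
Lemma hom_interval_shift_cluster_obj c d a b (g : C (ist (-1) c d) (shiftc (cluster_obj a b))) :
  (c < d)%N -> (d <= n)%N -> (a < b)%N -> (b <= n.+1)%N -> (b = n.+1 -> 0 < a)%N ->
  hom0 D (ist (-1) c d) (shiftc (cluster_obj a b)) -> g <> 0 ->
  [/\ (0 < a)%N, (c < a <= d)%N, (d < b)%N &
    exists2 z : C (ist (-1) a.-1 b.-1) (shiftc (cluster_obj a b)), isiso z &
      g = z \oc Pr (rhoi (-1) c d a.-1 b.-1)].
Proof.
move=> cd dn ab bn an h0 g0.
(* All components but the one of index -1 vanish as soon as F^-1 M[1] is
   concentrated in nonnegative degrees. *)
have van Z : iso_obj D (Go (shiftc (cluster_obj a b))) Z -> coh_ge (-1) Z ->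
    forall i, i != -1 -> hom0 D (ist (-1) c d) (opow Fo Go i (shiftc (cluster_obj a b))).
  move=> GZ Zh [[|r]|[|r]] // _.
  - apply: interval_coh_le0; first by rewrite ltnW.
    have := @iter_Fo_coh_le r.+1 _ _ (coh_le_shift (cluster_obj_coh_le (a := a) (b := b))).
    apply: coh_le_le; lia.
  have := @iter_Go_coh_ge r.+1 _ _ Zh; rewrite addrC.
  move=> hZ; apply: interval_coh_ge0; first by rewrite ltnW.
  rewrite /= -iterS iterSr.
  apply: (coh_ge_iso (iso_sym (iter_Go_iso r.+1 GZ))).
  by move=> i ir; apply: hZ; lia.
case: a ab an h0 g g0 van => [|a] ab an h0 g g0 van.
  have bn' : (b <= n)%N by move: bn; rewrite leq_eqVlt => /orP[/eqP /an|].
  case: b => [//|b] in ab bn an h0 g g0 van bn' *.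
  have GZ : iso_obj D (Go (shiftc (cluster_obj 0 b.+1))) (ist 0 b n).
    apply/Go_eq/iso_sym; rewrite /cluster_obj bn'.
    exact: Fo_injective.
  have [|z zi [f Ef]] := hom_from_Go GZ (van _ GZ _) g.
    by move=> i i0; apply: interval_stalk_coh_ge; lia.
  have f0 : f = 0.
    have hg : coh_ge 0 (ist 0 b n) by apply: interval_stalk_coh_ge.
    by apply: interval_coh_ge0 hg _; rewrite ltnW.
  by case: g0; rewrite Ef f0 fmor0 comp0r.
case: b => [//|b] in ab bn an h0 g g0 van *.
have GZ : iso_obj D (Go (shiftc (cluster_obj a.+1 b.+1))) (ist (-1) a b).
  by apply/Go_eq/iso_sym/Fo_interval.
have [|z zi [f Ef]] := hom_from_Go GZ (van _ GZ _) g; first exact: interval_stalk_coh_ge.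
have [|x Ex ne] := interval_hom f; first by rewrite ltnW.
have x0 : x != 0.
  by apply: contra_notN g0 => /eqP x0; rewrite Ef Ex x0 scale0r fmor0 comp0r.
case: (boolP [&& c <= a, a < d & d <= b]%N) => [/and3P[ca ad db]|/ne f0]; last first.
  by case: g0; rewrite Ef f0 fmor0 comp0r.
split; rewrite /= ?ltnS ?ca ?ad //.
exists (x *: z); last by rewrite Ef Ex fmorZ compZl compZr.
have [z' [z'z zz']] := zi; exists (x^-1 *: z').
by rewrite !compZl !compZr !scalerA mulVf // mulfV // !scale1r.
Qed.

(** The octahedral axiom for [c, d) -> [c, b) -> [a, b), whose factors have the
cones [d, b) and [c, a)[1].  The connecting morphism between these is the shift of
[c, a) -> [d, b), which is 0 as a <= d. *)
Lemma interval_cone c a d b : (c <= a)%N -> (a <= d)%N -> (d <= b)%N ->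
  exists Z (v : C (ist (-1) a b) Z) (w : C Z (shiftc (ist (-1) c d))),
    dist (cl_tri C) (Pr (rhoi (-1) c d a b)) v w /\
    biproduct C Z (ist (-1) d b) (shiftc (ist (-1) c a)).
Proof.
move=> ca ad db.
have [|w1 d1] := @interval_dist _ _ D (-1) c d b; first by lia.
have [|w2 d2] := @interval_dist _ _ D (-1) c a b; first by lia.
have e1 := cl_dist d1; have e2 := dist_rot (cl_dist d2).
have E : Pr (rhoi (-1) c b a b) \oc Pr (rhoi (-1) c d c b) = Pr (rhoi (-1) c d a b).
  by rewrite -(fmorM (proj (cl_orb C))) interval_dmor_comp //; lia.
have [Z [v [w e3]]] := tri_cone (cl_tri C) (Pr (rhoi (-1) c d a b)).
exists Z, v, w; split=> //.
rewrite -E in e3.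
have [f [g [d4 _]]] := tri_oct e1 e2 e3.
have z : fmor (cl_shift C) (Pr (rhoi (-1) c b d b)) \oc
    (- fmor (cl_shift C) (Pr (rhoi (-1) c a c b))) = 0.
  rewrite compNr -fmorM -(fmorM (proj (cl_orb C))).
  by rewrite interval_dmor_comp ?interval_dmor0 ?fmor0 ?oppr0 //; lia.
rewrite z in d4; exact: (dist0_biproduct d4).
Qed.

Lemma shift_reflect_biproduct A' X Y :
  biproduct C (shiftc A') (shiftc X) (shiftc Y) -> biproduct C A' X Y.
Proof.
have S := tri_shift (cl_tri C).
move=> [i1 [i2 [p1 [p2 [a [b c]]]]]].
have [j1 E1] := qinv_full S i1; have [j2 E2] := qinv_full S i2.
have [q1 F1] := qinv_full S p1; have [q2 F2] := qinv_full S p2.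
exists j1, j2, q1, q2; split; last split; apply: (qinv_faithful S).
- by rewrite fmorM fmor1 E1 F1.
- by rewrite fmorM fmor1 E2 F2.
by rewrite fmorD !fmorM fmor1 E1 E2 F1 F2.
Qed.

Lemma one_dim_scale (V : lmodType k) (x y : V) : one_dim V -> x <> 0 -> y <> 0 ->
  exists2 c, c != 0 & x = c *: y.
Proof.
move=> [e e0 h] x0 y0; have [c Ec] := h x; have [l El] := h y.
have c0 : c != 0 by apply: contra_notN x0 => /eqP c0; rewrite Ec c0 scale0r.
have l0 : l != 0 by apply: contra_notN y0 => /eqP l0; rewrite El l0 scale0r.
exists (c / l); first by rewrite mulf_neq0 ?invr_neq0.
by rewrite Ec El scalerA divfK.
Qed.

Lemma scale_isiso X c : c != 0 -> isiso (c *: idm C X).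
Proof.
move=> c0; exists (c^-1 *: idm C X).
by rewrite !compZl !compZr !compm1 !scalerA mulVf // mulfV // !scale1r.
Qed.

(** For b <= n this is the triangle of a short exact sequence, which does not split
because there are no nonzero morphisms [c, b) -> [c, d) and [a, d) -> [c, d).  For
b = n + 1 it is a rotation of the triangle of interval_cone on [0, a) -> [c, d). *)
Lemma interval_extension c d a b : (c < a <= d)%N -> (d < b)%N -> (b <= n.+1)%N ->
  exists U0 (u : C (ist (-1) c d) U0) (v : C U0 (cluster_obj a b))
    (w : C (cluster_obj a b) (shiftc (ist (-1) c d))), dist (cl_tri C) u v w /\
    w <> 0 /\ biproduct C U0 (cluster_obj c b) (ist (-1) a d).
Proof.
move=> /andP[ca ad] db bn; have dn : (d <= n)%N by rewrite -ltnS (leq_trans db).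
have an := leq_trans ad dn; have cn := leq_trans (ltnW ca) an.
rewrite /cluster_obj; case: (leqP b n) => bn'; last first.
  have [Z [v [w [dd bi]]]] := interval_cone (leq0n c) (ltnW ca) ad.
  rewrite an cn; exists Z, v, w, (- fmor (cl_shift C) (Pr (rhoi (-1) 0 a c d))).
  split; first exact: dist_rot.
  split; last exact: biproduct_swap.
  move=> /eqP; rewrite oppr_eq0 => /eqP E.
  have E0 : Pr (rhoi (-1) 0 a c d) = 0.
    by apply: (qinv_faithful (tri_shift (cl_tri C))); rewrite fmor0.
  by have := proj_faithful E0; apply: interval_dmor_proj_neq0; rewrite ?ca.
have [w dw] := @square_dist _ _ D (-1) c a d b (ltnW ca) ad (ltnW db).
have dC := cl_dist dw.
eexists; do 2!eexists; exists (Pr w); split; first exact: dC.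
split; last first.
  exact/proj_biproduct/stalkz_biproduct.
(* A splitting would factor the identity of [c, d) through [c, b) + [a, d). *)
move=> w0; rewrite w0 in dC.
have [r [_ [r1 _ _]]] := dist0_split dC.
rewrite -(fmor1 (proj (cl_orb C)) (ist (-1) c d)) in r1.
have [r' Er'] := proj_extend (E := cl_orb C) r1.
have [i1 [i2 [p1 [p2 [e1 [e2 e3]]]]]] :=
  stalkz_biproduct D 0 (interval k n c b) (interval k n a d).
have z1 : (r' \oc i1 : D (ist (-1) c b) (ist (-1) c d)) = 0.
  have [|c1 _ ->] // := @interval_hom _ _ C (-1) c b c d (r' \oc i1); lia.
have z2 : (r' \oc i2 : D (ist (-1) a d) (ist (-1) c d)) = 0.
  have [|c1 _ ->] // := @interval_hom _ _ C (-1) a d c d (r' \oc i2); lia.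
have r0 : r' = 0.
  by rewrite -[r']compm1 -e3 compDr !compA z1 z2 !comp0l addr0.
move: Er'; rewrite r0 comp0l => id0.
have : rhoi (-1) 0 d c d = 0 by rewrite -[LHS]comp1m -id0 comp0l.
by apply: interval_dmor_proj_neq0; lia.
Qed.

Lemma isiso_scale X Y c (f : C X Y) : c != 0 -> isiso f -> isiso (c *: f).
Proof.
by move=> c0 fi; rewrite -[f]compm1 -compZr; apply: isiso_comp => //; apply: scale_isiso.
Qed.

(** U is compared with interval_extension by the uniqueness of the nonzero class
in Ext^1(M, N), and U'[1] with the cone of [c, d) -> [a - 1, b - 1). *)
Lemma exchange_triangles c d a b M N U U' :
  iso_obj C M (cluster_obj a b) -> iso_obj C N (ist (-1) c d) ->
  (c < d)%N -> (d <= n)%N -> (a < b)%N -> (b <= n.+1)%N -> (b = n.+1 -> 0 < a)%N ->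
  hom0 D (ist (-1) c d) (shiftc (cluster_obj a b)) ->
  one_dim (C M (shiftc N)) ->
  nonsplit_triangle (cl_tri C) N U M -> nonsplit_triangle (cl_tri C) M U' N ->
  [/\ (c < a <= d)%N, (d < b)%N, biproduct C U (cluster_obj c b) (ist (-1) a d) &
    biproduct C U' (cluster_obj d.+1 b) (ist (-1) c a.-1)].
Proof.
move=> [be bei] [al ali] cd dn ab bn an h0 one [u [v [w [dU w0]]]] [u' [v' [w' [dU' w'0]]]].
have [al' [al'al alal']] := ali; have [be' [be'be bebe']] := bei.
pose g := fmor (cl_shift C) be \oc w' \oc al'.
have g0 : g <> 0.
  move=> g0; apply: w'0; rewrite -[w']compm1 -al'al -[w']comp1m -(fmor1 (cl_shift C)).
  rewrite -be'be fmorM.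
  have -> : fmor (cl_shift C) be' \oc fmor (cl_shift C) be \oc w' \oc (al' \oc al) =
    fmor (cl_shift C) be' \oc g \oc al by rewrite /g !compA.
  by rewrite g0 comp0r comp0l.
have [a0 /andP[ca ad] db [z zi Eg]] := hom_interval_shift_cluster_obj cd dn ab bn an h0 g0.
have cad : (c < a <= d)%N by rewrite ca ad.
split=> //.
- have [U0 [u0 [v0 [w1 [d0 [w10 bi]]]]]] := interval_extension cad db bn.
  apply: biproduct_iso (iso_refl _ _) (iso_refl _ _) bi; apply: iso_sym.
  pose w2 : C M (shiftc N) := fmor (cl_shift C) al' \oc w1 \oc be.
  have w20 : w2 <> 0.
    move=> w20; apply: w10; rewrite -[w1]compm1 -bebe' -[w1]comp1m -(fmor1 (cl_shift C)).
    rewrite -alal' fmorM.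
    have -> : fmor (cl_shift C) al \oc fmor (cl_shift C) al' \oc w1 \oc (be \oc be') =
      fmor (cl_shift C) al \oc w2 \oc be' by rewrite /w2 !compA.
    by rewrite w20 comp0r comp0l.
  have [l l0 El] := one_dim_scale one w0 w20.
  apply: (dist_middle_iso dU d0 ali (isiso_scale l0 bei)).
  rewrite El !compZr /w2 !compA -fmorM alal' fmor1 comp1m.
  by [].
have [||| Z [v1 [w1 [d1 bi]]]] := @interval_cone c a.-1 d b.-1; try lia.
have [z' [z'z zz']] := zi.
have e : Pr (rhoi (-1) c d a.-1 b.-1) \oc al = z' \oc fmor (cl_shift C) be \oc w'.
  rewrite -[LHS]comp1m -z'z -[z' \oc z \oc _]compA [z \oc (_ \oc _)]compA -Eg /g.
  by rewrite -!compA al'al compm1.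
have bi' : isiso (z' \oc fmor (cl_shift C) be).
  by apply: isiso_comp; [exists z|apply: fmor_isiso].
have UZ := dist_third_iso (dist_rot (dist_rot dU')) d1 ali bi' e.
apply: shift_reflect_biproduct.
apply: biproduct_iso (iso_sym UZ) _ (iso_refl _ _) bi.
have b0 : (0 < b)%N by lia.
by have := @cluster_obj_rotate d b.-1; rewrite (prednK b0); apply; lia.
Qed.

End OrbitVanishing.

(** * Indecomposable representations of the linear quiver *)

Section RepresentationTheory.
Variables (k : fieldType) (n : nat).
Local Notation A := (linA n).
Implicit Types (V W U : rep k A).

Lemma mulmx_rV_inj m p (M N : 'M[k]_(m, p)) : (forall x : 'rV_m, x *m M = x *m N) -> M = N.
Proof. by move=> h; apply/row_matrixP => i; rewrite !rowE h. Qed.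

Lemma mx_nocols m p (M N : 'M[k]_(m, p)) : p = 0%N -> M = N.
Proof. by move=> m0; rewrite [M]mx_dim0r // [N]mx_dim0r. Qed.

Lemma scalar1_dim0 m : 1%:M = 0 :> 'M[k]_m -> m = 0%N.
Proof.
case: m => // m /matrixP /(_ 0 0); rewrite !mxE eqxx => /eqP.
by rewrite oner_eq0.
Qed.

(** The pullback of the functional x at s to the vertex w, d arrows above s. *)
Fixpoint cotransport V (s : 'I_n) (x : 'cV[k]_(V s)) (d : nat) (w : 'I_n) : 'cV[k]_(V w) :=
  if d is d'.+1 then \sum_u rstep V w u *m cotransport x d' u
  else (\matrix_(i, j) ((w == s) && (val i == val j))%:R) *m x.

Lemma cotransport0 V s (x : 'cV[k]_(V s)) : cotransport x 0 s = x.
Proof.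
rewrite /= -[RHS]mul1mx; congr (_ *m _); apply/matrixP => i j.
by rewrite !mxE eqxx.
Qed.

Lemma cotransportS V s (x : 'cV[k]_(V s)) d (a : arrow A) :
  cotransport x d.+1 (src a) = ract V a *m cotransport x d (tgt a).
Proof.
rewrite /= (bigD1 (tgt a)) //= big1 ?addr0 ?rstepE // => u ua.
rewrite rstep0 ?mul0mx //; apply: contra ua => /eqP e; apply/eqP/val_inj => /=.
by apply/eq_add_S; rewrite -e (eqP (valP a)).
Qed.

Lemma arrow_pred (w : 'I_n) : (0 < w)%N -> exists2 a : arrow A, src a = w & tgt a = w.-1 :> nat.
Proof.
move=> w0; have wn : (w.-1 < n)%N by apply: leq_ltn_trans (leq_pred _) (ltn_ord w).
have va : val (w, Ordinal wn).1 == (val (w, Ordinal wn).2).+1 by rewrite /= prednK.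
by exists (Sub (w, Ordinal wn) va).
Qed.

(** Take x at the topmost vertex b of the support and the last vertex s at which its
image y is nonzero.  The images of x span a copy of [s, b + 1).  A functional on
V_s with value 1 on y, pulled back to the vertices above, is a retraction onto it:
the compatibility at the top holds because V vanishes above b. *)
Lemma interval_summand V : ~ rzero V -> exists s t (i : rmor (interval k n s t) V)
  (p : rmor V (interval k n s t)), (s < t <= n)%N /\ forall v, i v *m p v = 1%:M.
Proof.
move=> V0.
have [v0 Vv0] : exists v, V v != 0%N.
  by apply: NNPP => h; apply: V0 => v; apply/eqP; apply: contra_notT h => ne; exists v.
case: (@arg_maxnP _ v0 (fun v => V v != 0%N) (fun v : 'I_n => val v) Vv0) => b Vb bmax.
have Vgt (w : 'I_n) : (b < w)%N -> V w = 0%N.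
  move=> bw; apply/eqP; apply: contraTT bw => Vw; rewrite -leqNgt; exact: bmax.
have [x x0] : exists x : 'rV[k]_(V b), x != 0.
  exists (const_mx 1); apply/eqP => /matrixP e.
  have lt0 : (0 < V b)%N by rewrite lt0n.
  by have := e 0 (Ordinal lt0); rewrite !mxE => /eqP; rewrite oner_eq0.
pose y (w : 'I_n) : 'rV[k]_(V w) := transport x (b - w) w.
have yb : y b != 0 by rewrite /y subnn transport0.
have Pb : (b <= b)%N && (y b != 0) by rewrite leqnn.
case: (@arg_minnP _ b (fun w : 'I_n => (w <= b)%N && (y w != 0)) (fun w : 'I_n => val w) Pb)
  => s /andP[sb ys] smin.
have ystep (a : arrow A) : (src a <= b)%N -> y (src a) *m ract V a = y (tgt a).
  move=> ab; rewrite /y -transportS; have e : src a = (tgt a).+1 :> nat := eqP (valP a).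
  by have -> : (b - src a).+1 = (b - tgt a)%N by lia.
have ylow (w : 'I_n) : (w < s)%N -> y w = 0.
  move=> ws; apply/eqP; apply: contraTT ws => yw; rewrite -leqNgt; case: (leqP w b) => wb.
    by apply: smin; rewrite wb.
  exact: leq_trans sb (ltnW wb).
(* A functional with value 1 on the last nonzero image of x. *)
have [phi yphi] : exists phi : 'cV[k]_(V s), y s *m phi = 1%:M.
  have /rV0Pn[j yj] := ys; exists ((y s 0 j)^-1 *: delta_mx j 0).
  rewrite -scalemxAr -colE [LHS]mx11_scalar !mxE mulVf //.
pose f (w : 'I_n) : 'cV[k]_(V w) := cotransport phi (w - s) w.
have fstep (a : arrow A) : (s <= tgt a)%N -> ract V a *m f (tgt a) = f (src a).
  move=> ab; rewrite /f -cotransportS; have e : src a = (tgt a).+1 :> nat := eqP (valP a).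
  by have -> : (tgt a - s).+1 = (src a - s)%N by lia.
have yf (w : 'I_n) : (s <= w <= b)%N -> y w *m f w = 1%:M.
  move: {-2}(w - s)%N (erefl (w - s)%N) => d.
  elim: d w => [|d IH] w dw /andP[sw wb].
    have e : w = s by apply: val_inj; apply/eqP; rewrite eqn_leq sw andbT -subn_eq0 dw.
    by subst w; rewrite /f subnn cotransport0.
  have w0 : (0 < w)%N by lia.
  have [a ea ta] := arrow_pred w0; subst w.
  have st : (s <= tgt a)%N by lia.
  rewrite -(fstep a st) mulmxA (ystep a wb); apply: IH; lia.
have iP (a : arrow A) : const_mx 1 *m (const_mx 1 *m y (tgt a) : 'M_((s <= tgt a < b.+1)%N, _)) =
    (const_mx 1 *m y (src a) : 'M_((s <= src a < b.+1)%N, _)) *m ract V a.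
  have e : src a = (tgt a).+1 :> nat := eqP (valP a).
  rewrite mulmxA const_mxM -mulmxA mul1r.
  case: (boolP (s <= src a < b.+1)%N) => [/andP[h1 h2]|h]; last first.
    exact: mx_norows.
  rewrite ystep //.
  case: (leqP s (tgt a)) => h3.
    by rewrite (leq_ltn_trans _ h2) //= e.
  by rewrite ylow // !mulmx0.
have pP (a : arrow A) : ract V a *m (f (tgt a) *m const_mx 1 : 'M_(_, (s <= tgt a < b.+1)%N)) =
    (f (src a) *m const_mx 1 : 'M_(_, (s <= src a < b.+1)%N)) *m const_mx 1.
  have e : src a = (tgt a).+1 :> nat := eqP (valP a).
  case: (leqP s (tgt a)) => h1; last exact: mx_nocols.
  case: (leqP (src a) b) => h2; last by apply: mx_norows; apply: Vgt.
  rewrite mulmxA fstep // -[RHS]mulmxA const_mxM.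
  have -> : (s <= src a < b.+1)%N by rewrite ltnS h2 andbT /= e (leq_trans h1).
  by rewrite mulr1.
exists s, b.+1, (@RMor k n A (interval k n s b.+1) V (fun w => const_mx 1 *m y w) iP),
  (@RMor k n A V (interval k n s b.+1) (fun w => f w *m const_mx 1) pP).
split; first by rewrite ltnS sb ltn_ord.
move=> w /=; case: (boolP (s <= w < b.+1)%N) => h; last by apply/matrixP => -[].
rewrite -mulmxA [y w *m _]mulmxA yf // mul1mx const_mxM.
by rewrite mulr1 [LHS]mx11_scalar mxE.
Qed.

Lemma const_mx1b (b : bool) : const_mx 1 = 1%:M :> 'M[k]_b.
Proof. by case: b; [rewrite [LHS]mx11_scalar mxE|apply: mx_norows]. Qed.

(** [s, t) is a quotient of P_{t-1}, and a morphism out of P_{t-1} is determined by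
its value at t - 1, where [s, t) is one-dimensional. *)
Lemma interval_endo s t (q : rmor (interval k n s t) (interval k n s t)) :
  (s < t <= n)%N -> exists c, forall v, q v = c *: 1%:M.
Proof.
move=> /andP[st tn]; have tn' : (t.-1 < n)%N by lia.
pose v0 := Ordinal tn'.
have P0 : (s <= v0 < t)%N by rewrite /=; lia.
have [c Ec] : exists c, q v0 = const_mx c.
  move: (q v0) => /=; rewrite P0 => B; exists (B 0 0).
  by apply/matrixP => i j; rewrite !mxE !ord1.
exists c => w.
have t0 : (0 < t)%N by lia.
have H : forall w : 'I_n, const_mx 1 *m q w = c *: const_mx 1 :> 'M_((w <= t.-1)%N, _).
  move=> u; have tt : (t.-1 < t)%:R = 1 :> k by rewrite prednK ?leqnn.
  have := @proj_lin k n (interval k n s t) v0 c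
    (interval_rmor k n 0 v0.+1 s t) (rmor0 _ _) (rcomp q (interval_rmor k n 0 v0.+1 s t)).
  rewrite /= Ec tt mulmx0 addr0 !const_mxM leqnn scalemx_const.
  move=> /(_ _ u); rewrite addr0; apply.
  by rewrite P0 !mulr1n !mulr1 !mul1r.
have := H w; move: (q w) => /=.
case: (boolP (s <= w < t)%N) => [/andP[sw wt]|_] B; last by move=> _; apply: mx_norows.
have -> : (w <= t.-1)%N by lia.
by rewrite !const_mx1b mul1mx.
Qed.

(** The idempotent of a decomposition is a scalar c.  If c = 0 the first summand
vanishes, otherwise the second one does. *)
Lemma interval_indecomposable s t : (s < t <= n)%N -> rindecomposable (interval k n s t).
Proof.
move=> st; have /andP[st' tn] := st; split.
  have sn : (s < n)%N by lia.
  by move=> /(_ (Ordinal sn)) /=; rewrite leqnn st'.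
move=> W W' [f [g fg]].
pose inl : rmor W (rsum W W') := rpair (rid W) (rmor0 W W').
pose inr : rmor W' (rsum W W') := rpair (rmor0 W' W) (rid W').
pose prl : rmor (rsum W W') W := rcopair (rid W) (rmor0 W' W).
pose prr : rmor (rsum W W') W' := rcopair (rmor0 W W') (rid W').
have ll v : inl v *m prl v = 1%:M by rewrite /= mul_row_col mulmx1 mul0mx addr0.
have rr v : inr v *m prr v = 1%:M by rewrite /= mul_row_col mulmx1 mul0mx add0r.
have rl v : inr v *m prl v = 0 by rewrite /= mul_row_col mul0mx mulmx0 addr0.
have [c Ec] := interval_endo (rcomp (rcomp g inl) (rcomp prl f)) st.
have E v : f v *m prl v *m (inl v *m g v) = c *: 1%:M := Ec v.
have K v : prl v *m inl v = c *: 1%:M.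
  have := congr1 (fun B => g v *m B *m f v) (E v).
  rewrite -!mulmxA (fg v).2 mulmx1 [g v *m _]mulmxA (fg v).2 mul1mx => ->.
  by rewrite -scalemxAl -scalemxAr mul1mx (fg v).2.
case: (eqVneq c 0) => [c0|c0].
  left=> v; apply: scalar1_dim0; rewrite -[LHS]mulmx1 -{1}(ll v) -(ll v).
  by rewrite -mulmxA [prl v *m _]mulmxA K c0 scale0r mul0mx mulmx0.
right=> v; apply: scalar1_dim0; rewrite -(rr v).
have : inr v *m (prl v *m inl v) *m prr v = 0 by rewrite mulmxA rl !mul0mx.
rewrite K -scalemxAr mulmx1 -scalemxAl => /eqP.
by rewrite scaler_eq0 (negbTE c0) /= => /eqP.
Qed.

End RepresentationTheory.

(** * The functor H^0 *)

Section CohomologyFunctor.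
Variables (k : fieldType) (n : nat) (C : cluster_category k (linA n)).
Local Notation A := (linA n).
Local Notation D := (cl_D C).
Local Notation Pr := (fmor (proj (cl_orb C))).
Local Notation ist := (interval_stalk k n).
Local Notation rhoi := (interval_dmor D).
Local Notation tinv := (qobj (tauI (cl_tau C))).
Local Notation Fo := (fun X => tinv (shiftc X)).
Local Notation Go := (qobj (cl_inv C)).
Local Notation Ps v := (stalk (projective k v)).
Implicit Types (V W U : rep k A).

Definition H0_maps X (V : rep k A) (phi : forall v, {linear 'rV[k]_(V v) -> C (Ps v) X}) :=
  (forall v, bijective (phi v)) /\
  forall (a : arrow A) (x : 'rV[k]_(V (src a))),
    phi (tgt a) (x *m ract V a) =
    phi (src a) x \oc Pr (loc D (stalk_chain (proj_arrow k a))).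

(** The matrix of F at v consists of the preimages of the composites of f with the
images of the basis vectors. *)
Lemma H0_transfer X Y V W (phi : forall v, {linear 'rV[k]_(V v) -> C (Ps v) X})
    (psi : forall v, {linear 'rV[k]_(W v) -> C (Ps v) Y}) (f : C X Y) :
  H0_maps phi -> H0_maps psi -> exists F : rmor V W,
    forall v x, psi v (x *m F v) = f \oc phi v x.
Proof.
move=> [bphi nphi] [bpsi npsi].
have ex v : exists M : 'M[k]_(V v, W v), forall x, psi v (x *m M) = f \oc phi v x.
  have [g _ gK] := bpsi v.
  exists (\matrix_i g (f \oc phi v (delta_mx 0 i))) => x.
  rewrite {1}[x]row_sum_delta mulmx_suml linear_sum {2}[x]row_sum_delta linear_sum comp_sumr.
  apply: eq_bigr => i _.
  by rewrite -scalemxAl -rowE rowK linearZ /= gK linearZ /= compZr.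
pose F v := projT1 (constructive_indefinite_description _ (ex v)).
have FE v x : psi v (x *m F v) = f \oc phi v x.
  by rewrite /F; case: constructive_indefinite_description.
have FP a : ract V a *m F (tgt a) = F (src a) *m ract W a.
  apply: mulmx_rV_inj => x; apply: (bij_inj (bpsi (tgt a))).
  by rewrite !mulmxA FE npsi FE nphi compA.
by exists (RMor FP).
Qed.

Lemma is_H0_uniq X Y V W : is_H0 C X V -> is_H0 C Y W -> iso_obj C X Y -> riso V W.
Proof.
move=> [phi hphi] [psi hpsi] [a [b [ba ab]]].
have [F FE] := H0_transfer a hphi hpsi; have [G GE] := H0_transfer b hpsi hphi.
exists F, G => v; split; apply: mulmx_rV_inj => x; rewrite mulmxA mulmx1.
  by apply: (bij_inj (hphi.1 v)); rewrite GE FE compA ba comp1m.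
by apply: (bij_inj (hpsi.1 v)); rewrite FE GE compA ab comp1m.
Qed.

Lemma riso_dim V W : riso V W -> forall v, V v = W v.
Proof.
move=> [f [g h]] v; have [fg gf] := h v; apply/eqP; rewrite eqn_leq.
rewrite -{1}(mxrank1 k (V v)) -{2}(mxrank1 k (W v)) -fg -gf.
by rewrite (leq_trans (mxrankM_maxr _ _)) ?rank_leq_row //
  (leq_trans (mxrankM_maxr _ _)) ?rank_leq_row.
Qed.

Lemma stalk_iso V W : riso V W -> iso_obj D (stalk V) (stalk W).
Proof.
move=> [f [g h]]; exists (loc D (stalk_chain f)).
apply: (loc_chain_iso D (g := stalk_chain g)).
  by case=> [[|i]|i] v /=; rewrite ?(h v).1 //; apply/matrixP => -[].
by case=> [[|i]|i] v /=; rewrite ?(h v).2 //; apply/matrixP => -[].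
Qed.

Lemma stalk_interval_stalk s t : iso_obj D (stalk (interval k n s t)) (ist (-1) s t).
Proof. exact: stalk_z_iso. Qed.

Lemma stalkz_coh0 i m V : i + 1 != m -> coh0 D i (stalkz m V).
Proof. by move=> im; apply: coh0P => v /=; rewrite (negbTE im). Qed.

(** A positive power of F moves X to negative cohomological degrees and a negative
power to positive ones, where P_v has no morphisms. *)
Lemma hom_component0 v X : coh_le C 0 X -> coh_ge C (-1) X ->
  forall i, i != 0 -> hom0 D (Ps v) (opow Fo Go i X).
Proof.
move=> hl hg i i0.
suff h : coh0 D (-1) (opow Fo Go i X).
  by apply: hom0_iso (iso_sym (stalk_z_iso D _)) (iso_refl _ _) (h v).
case: i i0 => [[|r]|r] // _.
  by have := @iter_Fo_coh_le _ _ C r.+1 _ _ hl; apply; lia.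
by have := @iter_Go_coh_ge _ _ C r.+1 _ _ hg; apply; lia.
Qed.

Lemma hom_proj_stalk_full v V (g : C (Ps v) (stalk V)) : exists f, g = Pr f.
Proof.
apply: (proj_full (E := cl_orb C)) => i i0; apply: hom_component0 i0.
  apply: coh_le_iso (iso_sym (stalk_z_iso D V)) _ => j j0; apply: stalkz_coh0; lia.
apply: coh_ge_iso (iso_sym (stalk_z_iso D V)) _ => j j0; apply: stalkz_coh0; lia.
Qed.

Lemma stalk_z_nat V W (f : rmor V W) :
  loc D (stz 0 f) \oc loc D (stalk_z V) = loc D (stalk_z W) \oc loc D (stalk_chain f).
Proof.
rewrite -!locM; apply: loc_ext => -[[|i]|i] v /=; rewrite ?mul0mx ?mulmx0 //.
by rewrite mul1mx mulmx1.
Qed.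

Definition H0_stalk_fun V v (x : 'rV[k]_(V v)) : C (Ps v) (stalk V) :=
  Pr (loc D (stalk_chain (yoneda x))).

Lemma H0_stalk_linear V v : linear (@H0_stalk_fun V v).
Proof.
move=> c x y; apply: etrans (fmor_lin (proj (cl_orb C)) _ _ _); congr (Pr _).
apply: loc_lin => -[[|i]|i] w /=; last 2 first.
- exact: mx_norows.
- exact: mx_norows.
by apply: (@proj_lin k n V v c (yoneda x) (yoneda y) (yoneda _)); rewrite !yonedaE.
Qed.

HB.instance Definition _ V v := GRing.isLinear.Build k 'rV[k]_(V v) (C (Ps v) (stalk V)) *:%R
  (@H0_stalk_fun V v) (@H0_stalk_linear V v).

Lemma H0_stalk_inj V v : injective (@H0_stalk_fun V v).
Proof.
move=> x y E; apply/eqP; rewrite -subr_eq0; apply/eqP.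
have := proj_faithful (E := cl_orb C) (f := loc D (stalk_chain (yoneda (x - y)))).
rewrite -/(H0_stalk_fun (x - y)) linearB /= E subrr => /(_ erefl) f0.
have z0 : loc D (stz 0 (yoneda (x - y))) = 0.
  have [z [_ zz]] := stalk_z_isiso D (projective k v).
  by rewrite -[LHS]compm1 -zz compA stalk_z_nat f0 comp0r comp0l.
have [u] := @ev_loc0 k n D v (-1) _ (stz 0 (yoneda (x - y))) z0.
by rewrite /= mulmx0 /ev /= yonedaE.
Qed.

Lemma H0_stalk_surj V v (g : C (Ps v) (stalk V)) : exists x, g = H0_stalk_fun x.
Proof.
have [f ->] := hom_proj_stalk_full g.
have [p [pz zp]] := stalk_z_isiso D (projective k v).
have [q [qz zq]] := stalk_z_isiso D V.
have [h Eh] := @loc_surj k n D v (-1) _ (loc D (stalk_z V) \oc f \oc p).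
exists (ev h : 'rV_(V v)); rewrite /H0_stalk_fun; congr (Pr _).
have E : loc D h = loc D (stz 0 (yoneda (ev h : 'rV_(V v)))).
  apply: (@loc_ev_eq k n D v (-1) _ h _ 0); rewrite mul0mx addr0.
  by rewrite [RHS]/ev /= yonedaE.
rewrite -[f]compm1 -pz -[f]comp1m -qz.
have -> : q \oc loc D (stalk_z V) \oc f \oc (p \oc loc D (stalk_z (projective k v))) =
   q \oc (loc D (stalk_z V) \oc f \oc p) \oc loc D (stalk_z (projective k v)).
  by rewrite !compA.
by rewrite Eh E -compA stalk_z_nat compA qz comp1m.
Qed.

(** C(P_v, V) = D(P_v, V) = V_v, by degree reasons and by the Yoneda lemma. *)
Lemma is_H0_stalk V : is_H0 C (stalk V) V.
Proof.
exists (fun v => @H0_stalk_fun V v : {linear _ -> _}); split.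
  move=> v.
  pose g (y : C (Ps v) (stalk V)) :=
    projT1 (constructive_indefinite_description _ (H0_stalk_surj y)).
  have gK : cancel g (@H0_stalk_fun V v).
    by move=> y; rewrite /g; case: constructive_indefinite_description.
  by exists g => // x; apply: (@H0_stalk_inj V v); rewrite gK.
move=> a x; apply: etrans (fmorM (proj (cl_orb C)) _ _); rewrite -locM; congr (Pr _).
apply: loc_ext => -[[|i]|i] w /=; try exact: mx_norows.
apply: (@proj_uniq k n V (tgt a) (yoneda _) (rcomp (yoneda x) (proj_arrow k a))).
rewrite yonedaE.
transitivity ((const_mx 1 *m yoneda x (src a) : 'rV_(V (src a))) *m ract V a).
  by rewrite yonedaE.
rewrite -mulmxA -rmxP [RHS]mulmxA mulmxA; congr (_ *m _).
rewrite /= !const_mxM; apply: const_mx_eq => _ _.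
by rewrite !leqnn.
Qed.

Lemma is_H0_biproduct B X Y V : biproduct C B X Y -> is_H0 C X V ->
  (forall v, hom0 C (Ps v) Y) -> is_H0 C B V.
Proof.
move=> [i1 [i2 [p1 [p2 [e1 [e2 e3]]]]]] [phi [bphi nphi]] Y0.
have lin v : linear (fun x => i1 \oc phi v x).
  by move=> c x y; rewrite linearP comp_linr.
pose psi v : {linear 'rV[k]_(V v) -> C (Ps v) B} :=
  HB.pack (fun x => i1 \oc phi v x) (GRing.isLinear.Build _ _ _ _ _ (lin v)).
exists psi; split=> [v|a x]; last by rewrite /= nphi compA.
have [g gK Kg] := bphi v; exists (fun y => g (p1 \oc y)) => [x|y] /=.
  by rewrite compA e1 comp1m gK.
have y2 : p2 \oc y = 0 := Y0 v (p2 \oc y).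
by rewrite Kg -[RHS]comp1m -e3 compDl -[i2 \oc p2 \oc y]compA y2 comp0r addr0 compA.
Qed.

Lemma hom0_orbit X Y : (forall i, hom0 D X (opow Fo Go i Y)) -> hom0 C X Y.
Proof.
move=> h g; have [f ->] := proj_full (E := cl_orb C) (fun i _ => h i) g.
have -> : f = 0 := h 0 f.
exact: fmor0.
Qed.

(** Nonnegative powers of F keep P_c[1] in negative degrees; and F^-1 (P_c[1]) is
the injective module [c, n) in cohomological degree 1, which further negative
powers move up. *)
Lemma hom0_proj_cluster_obj v c : (c <= n.+1)%N -> hom0 C (Ps v) (cluster_obj k n c n.+1).
Proof.
have z : zero_obj C (shiftc (ist (-1) 0 0)).
  apply: (fmor_zero (cl_shift C)); apply: (fmor_zero (proj (cl_orb C))).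
  exact: interval_stalk_zero.
move=> cn; rewrite /cluster_obj ltnn; case: (leqP c n) => cn'; last exact: (zero_objP _ z).2.
case: c cn cn' => [|c] _ cn; first exact: (zero_objP _ z).2.
apply: hom0_orbit => i.
suff h : coh0 D (-1) (opow Fo Go i (shiftc (ist (-1) 0 c.+1))).
  by apply: hom0_iso (iso_sym (stalk_z_iso D _)) (iso_refl _ _) (h v).
case: i => r.
  have := @iter_Fo_coh_le _ _ C r _ _ (coh_le_shift (@interval_stalk_coh_le k n C (-1) 0 c.+1)).
  by apply; lia.
have GZ : iso_obj D (Go (shiftc (ist (-1) 0 c.+1))) (ist 0 c n).
  by apply/Go_eq/iso_sym/Fo_injective.
rewrite /opow iterSr.
apply: (coh0_iso (iso_sym (iter_Go_iso r GZ))).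
by have := @iter_Go_coh_ge _ _ C r _ _ (@interval_stalk_coh_ge k n C 0 c n); apply; lia.
Qed.

Lemma interval_stalk_nonzero s t : (s < t <= n)%N -> ~ zero_obj C (ist (-1) s t).
Proof.
move=> /andP[st tn] z.
have z' : rhoi (-1) 0 t s t = 0.
  apply: (proj_faithful (E := cl_orb C)); exact: (zero_objP _ z).2.
by apply: interval_dmor_proj_neq0 z'; rewrite ?st /=.
Qed.

Lemma stz_stalk_comp V W U (f : rmor V W) (g : rmor W U) (h : rmor V U) :
  (forall v, f v *m g v = h v) ->
  loc D (stalk_chain g) \oc loc D (stalk_chain f) = loc D (stalk_chain h).
Proof.
move=> fg; rewrite -locM; apply: loc_ext => -[[|i]|i] v /=; try exact: mx_norows.
exact: fg.
Qed.

(** An interval summand of V is a nonzero retract of M; H^0 turns the resulting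
isomorphism into one of representations. *)
Lemma indecomposable_stalk M V : indecomposable C M -> iso_obj C M (stalk V) ->
  exists s t, [/\ (s < t <= n)%N, iso_obj C M (ist (-1) s t) & riso V (interval k n s t)].
Proof.
move=> Mi MV.
have V0 : ~ rzero V.
  move=> V0; apply: Mi.1; apply: zero_obj_iso (iso_sym MV) _.
  rewrite /zero_obj -(fmor1 (proj (cl_orb C))) -loc1 loc_zero ?fmor0 //.
  by move=> [[|i]|i] v; apply: mx_norows => //=; apply: V0.
have [s [t [i [p [st ip]]]]] := interval_summand V0.
have [a [b [ba ab]]] := MV.
have e : Pr (loc D (stalk_chain p)) \oc Pr (loc D (stalk_chain i)) = idm C (stalk (interval k n s t)).
  rewrite -[LHS](fmorM (proj (cl_orb C))) (stz_stalk_comp (h := rid _)) //.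
  rewrite -[RHS](fmor1 (proj (cl_orb C))) -loc1; congr (Pr _).
  by apply: loc_ext => -[[|j]|j] v /=; try exact: mx_norows.
have I0 : ~ zero_obj C (stalk (interval k n s t)).
  move=> z; apply: (interval_stalk_nonzero st); apply: zero_obj_iso z.
  exact/proj_iso/stalk_interval_stalk.
have iso : isiso (b \oc Pr (loc D (stalk_chain i))).
  apply: (retract_indecomposable (cl_tri C) (p := Pr (loc D (stalk_chain p)) \oc a)) => //.
  by rewrite -compA [a \oc _]compA ab comp1m e.
have MI : iso_obj C M (stalk (interval k n s t)) by apply: iso_sym; eexists; exact: iso.
exists s, t; split=> //.
  apply: iso_trans MI _; exact/proj_iso/stalk_interval_stalk.
apply: (is_H0_uniq (is_H0_stalk V) (is_H0_stalk _)).
exact: iso_trans (iso_sym MV) MI.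
Qed.

Lemma shifted_proj_cluster_obj (i : 'I_n) :
  iso_obj C (shiftc (stalk (projective k i))) (cluster_obj k n i.+1 n.+1).
Proof.
rewrite /cluster_obj ltnn ltn_ord; apply/proj_iso/shift_iso.
exact: (stalk_interval_stalk 0 i.+1).
Qed.

Lemma biproduct_stalk B s t s' t' : biproduct C B (ist (-1) s t) (ist (-1) s' t') ->
  iso_obj C B (stalk (rsum (interval k n s t) (interval k n s' t'))).
Proof.
move=> b; apply: (biproduct_uniq b); apply: proj_biproduct.
apply: biproduct_iso (iso_sym (stalk_z_iso D _)) (iso_refl _ _) (iso_refl _ _) _.
exact: (stalkz_biproduct D 0).
Qed.

End CohomologyFunctor.

(** * Quiver Grassmannians of interval modules *)

Section GrassmannianOfInterval.
Variables (k : fieldType) (n : nat).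
Variables (chi : forall N, kset k N -> int) (chiP : euler_characteristic chi).
Local Notation A := (linA n).

(** Additivity for the disjoint union of two empty sets. *)
Lemma chi_empty N : chi (fun _ : 'rV[k]_N => False) = 0.
Proof.
have c : constructible (fun _ : 'rV[k]_N => False) by exists (GRing.Bool false).
have := chi_union chiP c c (fun _ f _ => f).
have -> : (fun x : 'rV[k]_N => False \/ False) = (fun=> False).
  by apply: functional_extensionality => x; apply: propositional_extensionality; tauto.
by move/(congr1 (fun z => z - chi (fun _ : 'rV[k]_N => False))); rewrite addrK subrr.
Qed.

Lemma kset_ext N (X Y : kset k N) : (forall x, X x <-> Y x) -> X = Y.
Proof.
by move=> XY; apply: functional_extensionality => x; apply: propositional_extensionality.
Qed.

(** Subspaces of spaces of dimension at most 1 have only one echelon basis. *)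
Lemma reduced_echelon_small m d (B : 'M[k]_(m, d)) : (m <= d <= 1)%N ->
  reduced_echelon B <-> B = const_mx 1.
Proof.
move=> /andP[md d1]; have m1 := leq_trans md d1.
have small q (i j : 'I_q) : (q <= 1)%N -> i = j.
  by move=> q1; apply: val_inj; have := ltn_ord i; have := ltn_ord j; rewrite /=; lia.
split=> [[p [_ h]]|->].
  apply/matrixP => i j; rewrite mxE (small _ j (p i) d1).
  by have [_ ->] := h i; rewrite eqxx.
exists (widen_ord md); split=> [i j|i].
  by rewrite (small _ i j m1) ltnn.
split=> [j|i']; first by rewrite /= => ji; have := ltn_ord i; have := ltn_ord j; lia.
by rewrite mxE (small _ i' i m1) eqxx.
Qed.

(** The dimension vectors of the submodules of [s, t). *)
Definition sub_closed (s t : nat) (e : 'I_n -> nat) : Prop :=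
  forall a : arrow A, (0 < e (src a))%N -> (s <= tgt a < t)%N -> (0 < e (tgt a))%N.

Lemma const_mx_submx m m' d p (le1 : (m' <= d)%N) (d1 : (d <= 1)%N) (p1 : (m <= p <= 1)%N) :
  ((const_mx 1 : 'M[k]_(m, p)) *m (const_mx 1 : 'M_(p, d)) <= (const_mx 1 : 'M_(m', d)))%MS <->
  ((0 < m)%N -> (0 < d)%N -> (0 < m')%N).
Proof.
rewrite const_mxM mul1r.
case: m p1 => [|[|m]] p1; last by lia.
  by split=> // _; rewrite [const_mx _]mx_dim0l // sub0mx.
have -> : p = 1%N by lia.
case: d le1 d1 => [|[|d]] le1 d1; last by lia.
  by split=> // _; rewrite [const_mx _]mx_dim0r // sub0mx.
case: m' le1 => [|[|m']] le1; last by lia.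
  split=> [|h]; last by have := h isT isT.
  have -> : const_mx 1 = 0 :> 'M[k]_(0, 1) by apply: mx_dim0l.
  move=> /submx0null/matrixP /(_ 0 0).
  by rewrite !mxE mulr1n => /eqP; rewrite oner_eq0.
by rewrite mulr1n; split=> // _; apply: submx_refl.
Qed.

(** All the spaces have dimension at most 1, so the only candidate has all its
coordinates equal to 1; it is stable under the arrows exactly when e is
sub_closed. *)
Lemma quiver_grass_interval s t (e : 'I_n -> nat)
    (x : 'rV[k]_(\sum_v (e v * interval k n s t v)%N)) :
  (forall v, e v <= interval k n s t v)%N ->
  quiver_grass (interval k n s t) e x <-> x = const_mx 1 /\ sub_closed s t e.
Proof.
move=> eV.
have V1 v : (interval k n s t v <= 1)%N by rewrite /=; case: (_ && _).
have U1 v : vec_mx (@submxrow k n (fun v => (e v * interval k n s t v)%N) 1 (const_mx 1) v)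
    = const_mx 1 :> 'M_(e v, interval k n s t v).
  by apply/matrixP => i j; rewrite !mxE.
have cond a : ((const_mx 1 : 'M_(e (src a), interval k n s t (src a))) *m ract (interval k n s t) a
      <= (const_mx 1 : 'M_(e (tgt a), interval k n s t (tgt a))))%MS <->
    ((0 < e (src a))%N -> (s <= tgt a < t)%N -> (0 < e (tgt a))%N).
  rewrite const_mx_submx ?eV ?V1 //.
  by rewrite /= lt0b.
split.
  move=> [re sub].
  have xE : x = const_mx 1.
    rewrite -[x](@submxrowK k n (fun v => (e v * interval k n s t v)%N)).
    rewrite -[RHS](@submxrowK k n (fun v => (e v * interval k n s t v)%N)).
    apply: eq_mxrow => v; apply: (can_inj (@vec_mxK _ _ _)).
    rewrite U1; apply/reduced_echelon_small; last exact: re.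
    by rewrite eV V1.
  split=> // a; apply/cond; have := sub a; rewrite xE !U1; exact.
move=> [-> cl]; split.
  by move=> v; rewrite U1; apply/reduced_echelon_small; rewrite ?eV ?V1.
by move=> a; rewrite !U1; apply/cond/cl.
Qed.

Lemma chi_grass_point s t (e : 'I_n -> nat) : (forall v, e v <= interval k n s t v)%N ->
  sub_closed s t e -> chi (quiver_grass (interval k n s t) e) = 1.
Proof.
move=> eV cl.
have -> : quiver_grass (interval k n s t) e = (fun y => y = const_mx 1).
  by apply: kset_ext => x; rewrite quiver_grass_interval //; tauto.
exact: chi_point.
Qed.

Lemma chi_grass_empty s t (e : 'I_n -> nat) : (forall v, e v <= interval k n s t v)%N ->
  ~ sub_closed s t e -> chi (quiver_grass (interval k n s t) e) = 0.
Proof.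
move=> eV cl.
have -> : quiver_grass (interval k n s t) e = (fun _ => False).
  by apply: kset_ext => x; rewrite quiver_grass_interval //; tauto.
exact: chi_empty.
Qed.

End GrassmannianOfInterval.

(** * The characters of interval modules *)

Section FieldIdentities.
Variable F : fieldType.

Lemma field_cancel4 (a b c d : F) : a != 0 -> b != 0 -> c != 0 -> d != 0 ->
  a * b * d / c * (c / (d * a * b)) = 1.
Proof. by move=> a0 b0 c0 d0; field; rewrite a0 b0 c0 d0. Qed.

Lemma field_reorder (a b c d e f g h : F) : c != 0 -> d != 0 -> e != 0 -> g != 0 ->
  a * b / (c * d) * (f / e) * (h / g) = a * b * h / e * (f / (g * c * d)).
Proof. by move=> c0 d0 e0 g0; field; rewrite c0 d0 e0 g0. Qed.

Lemma ptolemy_identity (x1 x2 x3 x4 z1 z2 z3 y1 y2 y3 s1 s2 s3 s4 : F) :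
  z1 != 0 -> y1 != 0 -> y2 != 0 -> y3 != 0 ->
  x1 * x2 * z3 / y1 * (s1 - s2) * (x3 * x4 * z2 / y2 * (s3 - s4)) =
  x1 * x4 * z2 / y1 * (s3 - s2) * (x3 * x2 * z3 / y2 * (s1 - s4)) +
  x2 * x4 * z2 / y3 * (s3 - s1) * (x1 * x3 * z1 / y1 * (s4 - s2)) * (y3 / y2) * (z3 / z1).
Proof. by move=> z10 y10 y20 y30; field; rewrite z10 y10 y20 y30. Qed.

Lemma split_identity (x1 x2 x3 z1 z3 y1 y2 s1 s2 s4 : F) :
  z1 != 0 -> y1 != 0 -> y2 != 0 ->
  x1 * x2 * z3 / y1 * (s1 - s2) * x3 =
  x1 * (x3 * x2 * z3 / y2 * (s1 - s4)) * (y2 / y1) +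
  x2 * (x1 * x3 * z1 / y1 * (s4 - s2)) * (z3 / z1).
Proof. by move=> z10 y10 y20; field; rewrite z10 y10 y20. Qed.

End FieldIdentities.

Section CharacterOfInterval.
Variables (k : fieldType) (n : nat).
Variables (chi : forall N, kset k N -> int) (chiP : euler_characteristic chi).
Local Notation A := (linA n).
Local Notation K := (cfield n).

(** u is the lowest vertex of [s, t) where e vanishes; closure under arrows
propagates this upwards. *)
Lemma sub_closed_interval s t (e : 'I_n -> nat) : (s <= t <= n)%N ->
  (forall v, e v <= interval k n s t v)%N -> sub_closed s t e ->
  exists2 u, (s <= u <= t)%N & forall v, e v = (s <= v < u)%N.
Proof.
move=> /andP[st tn] eV cl.
pose P u := (s <= u)%N && ((u == t) || [exists v : 'I_n, (val v == u) && (e v == 0%N)]).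
have exP : exists u, P u by exists t; rewrite /P st eqxx.
case: (ex_minnP exP) => u /andP[su Pu] umin.
have ut : (u <= t)%N by apply: umin; rewrite /P st eqxx.
exists u; first by rewrite su.
have eout (v : 'I_n) : ~~ (s <= v < t)%N -> e v = 0%N.
  by move=> h; have := eV v; rewrite /= (negbTE h) leqn0 => /eqP.
have e1 (v : 'I_n) : (e v <= 1)%N by apply: leq_trans (eV v) _; rewrite /=; case: (_ && _).
have ehigh d (v : 'I_n) : val v = (u + d)%N -> e v = 0%N.
  elim: d v => [|d IH] v vd.
    move: Pu => /orP[/eqP e0|/existsP[w /andP[/eqP wu /eqP ew]]].
      by apply: eout; rewrite vd addn0 e0 ltnn andbF.
    by have -> : v = w by apply: val_inj; rewrite vd wu addn0.
  have vd' : v = (u + d.+1)%N :> nat := vd.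
  have v0 : (0 < v)%N by rewrite vd' addnS.
  case: (boolP (s <= v < t)%N) => [/andP[sv vt]|]; last exact: eout.
  have [a ea ta] := @arrow_pred n v v0.
  have := cl a; rewrite ea ta => h.
  have et : e (tgt a) = 0%N by apply: IH; rewrite [val _]ta vd addnS.
  apply/eqP; rewrite -leqn0 leqNgt; apply/negP => ev.
  by have h0 := h ev; rewrite et ltnn in h0; suff: false by []; apply: h0; lia.
move=> v; case: (ltnP v u) => vu.
  case: (leqP s v) => sv; last by rewrite eout //= leqNgt sv.
  apply/eqP; rewrite eqn_leq e1 lt0n; apply/negP => ev.
  suff : (u <= v)%N by rewrite leqNgt vu.
  apply: umin; rewrite /P sv; apply/orP; right.
  by apply/existsP; exists v; rewrite eqxx.
by rewrite andbF; apply: (ehigh (v - u)%N); rewrite subnKC.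
Qed.

Lemma arrow_eq (a b : arrow A) : tgt a = tgt b :> nat -> a = b.
Proof.
case: a b => [[p q] h] [[p' q'] h'] /= e; apply: val_inj => /=.
move: (eqP h) (eqP h'); rewrite /= e => h1 h2; congr pair; apply: val_inj => //=.
by rewrite h1 h2.
Qed.

Lemma sum_arrows_tgt (G : 'I_n -> int) (r : 'I_n) (g : nat -> int) :
  (forall v : 'I_n, G v = g v) -> (forall m, (n <= m)%N -> g m = 0) ->
  \sum_(a : arrow A) G (src a) * (r == tgt a)%:R = g r.+1.
Proof.
move=> Gg g0; case: (ltnP r.+1 n) => rn; last first.
  rewrite g0 // big1 // => a _; case: eqP => [e|]; last by rewrite mulr0.
  have ha : src a = (tgt a).+1 :> nat := eqP (valP a).
  have e' : r = tgt a :> nat by rewrite e.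
  by have := ltn_ord (src a); rewrite ha -e' ltnNge rn.
have va : val (Ordinal rn, r).1 == (val (Ordinal rn, r).2).+1 by [].
pose b : arrow A := Sub (Ordinal rn, r) va.
rewrite (bigD1 b) //= eqxx mulr1 big1 ?addr0; first by rewrite Gg.
move=> a ab; case: eqP => [e|]; last by rewrite mulr0.
by case/eqP: ab; apply: arrow_eq; exact: (congr1 val (esym e)).
Qed.

Lemma sum_arrows_src (G : 'I_n -> int) (r : 'I_n) (g : nat -> int) :
  (forall v : 'I_n, G v = g v) ->
  \sum_(a : arrow A) (r == src a)%:R * G (tgt a) = if (0 < r)%N then g r.-1 else 0.
Proof.
move=> Gg; case: ltnP => r0; last first.
  rewrite big1 // => a _; case: eqP => [e|]; last by rewrite mul0r.
  have ha : src a = (tgt a).+1 :> nat := eqP (valP a).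
  have e' : r = src a :> nat by rewrite e.
  by move: r0; rewrite e' ha.
have [b eb tb] := arrow_pred r0.
rewrite (bigD1 b) //= -[(sval b).1]/(src b) eb eqxx mul1r big1 ?addr0.
  by rewrite Gg -[(sval b).2]/(tgt b) tb.
move=> a ab; case: eqP => [e|]; last by rewrite mul0r.
case/eqP: ab; apply: arrow_eq; apply: eq_add_S.
have ha : @src n A a = (@tgt n A a).+1 :> nat := eqP (valP a).
have hb : src b = (tgt b).+1 :> nat := eqP (valP b).
have e' : @src n A a = r :> nat by rewrite /= -e.
by rewrite -ha -hb eb e'.
Qed.

Lemma euler_form_simple_r (d : 'rV[int]_n) (r : 'I_n) (g : nat -> int) :
  (forall v : 'I_n, d 0 v = g v) -> (forall m, (n <= m)%N -> g m = 0) ->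
  euler_form A d (delta_mx 0 r) = g r - g r.+1.
Proof.
move=> dg g0; rewrite /euler_form; congr (_ - _).
  rewrite (bigD1 r) //= mxE !eqxx mulr1 big1 ?addr0 // => v vr.
  by rewrite mxE (negbTE vr) andbF mulr0.
rewrite -(sum_arrows_tgt r dg g0); apply: eq_bigr => a _.
by rewrite mxE eqxx /= eq_sym.
Qed.

Lemma euler_form_simple_l (d : 'rV[int]_n) (r : 'I_n) (g : nat -> int) :
  (forall v : 'I_n, d 0 v = g v) ->
  euler_form A (delta_mx 0 r) d = g r - (if (0 < r)%N then g r.-1 else 0).
Proof.
move=> dg; rewrite /euler_form; congr (_ - _).
  rewrite (bigD1 r) //= mxE !eqxx mul1r big1 ?addr0 // => v vr.
  by rewrite mxE (negbTE vr) andbF mul0r.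
rewrite -(sum_arrows_src r dg); apply: eq_bigr => a _.
by rewrite mxE eqxx /= eq_sym.
Qed.

(** x_{u-1} for 0 < u <= n, and 1 for u = 0 and u = n + 1. *)
Definition xpad (u : nat) : K := \prod_(r < n | r.+1 == u) xvar r.
Definition ypart (u : nat) : K := \prod_(r < n | (r < u)%N) yvar r.
Definition zpart (u : nat) : K := \prod_(r < n | (r < u)%N) zvar r.
(** The partial sums through which all the characters are expressed. *)
Definition ssum (m : nat) : K :=
  \sum_(0 <= u < m) ypart u / (zpart u * xpad u * xpad u.+1).
(** The character of [s, t).  It is 1 for s = t, in accordance with the zero
module. *)
Definition interval_value (s t : nat) : K :=
  xpad s * xpad t.+1 * zpart t / ypart s * (ssum t.+1 - ssum s).

Lemma mpolyX_neq0 p (m : multinom p) : mpolyX rat m != 0.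
Proof. 
apply/eqP => /(congr1 (fun q => mcoeff m q)).
by rewrite mcoeffX mcoeff0 eqxx => /eqP; rewrite oner_eq0.
Qed.

Lemma xvar_neq0 (r : 'I_n) : xvar r != 0.
Proof. by rewrite /xvar tofrac_eq0 mpolyX_neq0. Qed.
Lemma yvar_neq0 (r : 'I_n) : yvar r != 0.
Proof. by rewrite /yvar tofrac_eq0 mpolyX_neq0. Qed.
Lemma zvar_neq0 (r : 'I_n) : zvar r != 0.
Proof. by rewrite /zvar tofrac_eq0 mpolyX_neq0. Qed.

Lemma xpad_neq0 u : xpad u != 0.
Proof. by rewrite prodf_seq_neq0; apply/allP => r _; rewrite xvar_neq0 implybT. Qed.
Lemma ypart_neq0 u : ypart u != 0.
Proof. by rewrite prodf_seq_neq0; apply/allP => r _; rewrite yvar_neq0 implybT. Qed.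
Lemma zpart_neq0 u : zpart u != 0.
Proof. by rewrite prodf_seq_neq0; apply/allP => r _; rewrite zvar_neq0 implybT. Qed.

Lemma xpad0 : xpad 0 = 1.
Proof. by rewrite /xpad big1. Qed.
Lemma xpadn1 : xpad n.+1 = 1.
Proof. by rewrite /xpad big1 // => r /eqP[e]; have := ltn_ord r; rewrite e ltnn. Qed.
Lemma xpadS (r : 'I_n) : xpad r.+1 = xvar r.
Proof. by rewrite /xpad (big_pred1 r) // => i /=; rewrite eqSS. Qed.

Lemma prod_interval (f : 'I_n -> K) s u : (forall r, f r != 0) -> (s <= u)%N ->
  \prod_r f r ^+ (s <= r < u)%N =
  (\prod_(r < n | (r < u)%N) f r) / \prod_(r < n | (r < s)%N) f r.
Proof.
move=> f0 su.
apply: (canRL (mulfK _)).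
  by rewrite prodf_seq_neq0; apply/allP => r _; rewrite f0 implybT.
rewrite (big_mkcond (fun r : 'I_n => (r < s)%N)) [RHS]big_mkcond -big_split /=.
apply: eq_bigr => r _; case: (ltnP r s) => rs.
  by rewrite (leq_trans rs su) expr0 mul1r.
by rewrite mulr1; case: ltnP.
Qed.

Lemma interval_value_empty s : interval_value s s = 1.
Proof.
rewrite /interval_value /ssum big_nat_recr //= addrAC subrr add0r.
by apply: field_cancel4; rewrite ?xpad_neq0 ?ypart_neq0 ?zpart_neq0.
Qed.

Lemma xpadE u : xpad u = \prod_r xvar r ^ ((nat_of_ord r).+1 == u)%:Z.
Proof.
rewrite /xpad big_mkcond; apply: eq_bigr => r _.
by case: eqP; rewrite ?expr1z ?expr0z.
Qed.

(** The exponents telescope: [s, u) contributes x_{s-1} / x_{u-1} and [u, t)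
contributes x_t / x_u. *)
Lemma prod_xvar_exponents s u t : (s <= u <= t)%N ->
  \prod_(r < n) xvar r ^ (- ((s <= r < u)%N%:Z - (s <= r.+1 < u)%N%:Z)
     - ((u <= r < t)%N%:Z - (if (0 < r)%N then (u <= r.-1 < t)%N%:Z else 0))) =
  xpad s * xpad t.+1 / (xpad u * xpad u.+1).
Proof.
move=> /andP[su ut]; apply: (canRL (mulfK _)); first by rewrite mulf_neq0 ?xpad_neq0.
rewrite !xpadE -!big_split /=; apply: eq_bigr => r _.
rewrite -!expfzDr ?xvar_neq0 //; congr (_ ^ _).
case: (val r) => [|m] /=; lia.
Qed.

Definition interval_dim (s t u : nat) : {dffun forall v : 'I_n, 'I_(interval k n s t v).+1} :=
  [ffun v : 'I_n => (inord (s <= v < u)%N : 'I_(interval k n s t v).+1)].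

Lemma interval_dimE s t u v : (u <= t)%N -> interval_dim s t u v = (s <= v < u)%N :> nat.
Proof.
move=> ut; rewrite ffunE inordK // ltnS /=.
case: (s <= v)%N => //=; case: (ltnP v u) => // vu.
by rewrite (leq_trans vu ut).
Qed.

Lemma interval_dim_inj s t u u' : (s <= u <= t)%N -> (s <= u' <= t)%N -> (t <= n)%N ->
  interval_dim s t u = interval_dim s t u' -> u = u'.
Proof.
move=> /andP[su ut] /andP[su' ut'] tn E.
have H (v : 'I_n) : (s <= v < u)%N = (s <= v < u')%N :> nat.
  by rewrite -!(interval_dimE s v ut) // -(interval_dimE s v ut') E.
have no w w' : (s <= w)%N -> (w < w')%N -> (w' <= t)%N ->
    ~ (forall v : 'I_n, (s <= v < w)%N = (s <= v < w')%N :> nat).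
  move=> sw ww' w't /(_ (Ordinal (leq_trans (leq_trans ww' w't) tn))) /=.
  by rewrite sw ww' ltnn.
case: (ltngtP u u') => // h.
  by case: (no _ _ su h ut').
by case: (no _ _ su' h ut) => v; rewrite H.
Qed.

(** Only the dimension vectors of the submodules [s, u) contribute, each with Euler
characteristic 1. *)
Lemma module_character_interval s t : (s <= t <= n)%N ->
  module_character chi (interval k n s t) = interval_value s t.
Proof.
move=> st; have /andP[st' tn] := st; rewrite /module_character.
set F := (X in \sum_e X e).
have bound (e : {dffun forall v : 'I_n, 'I_(interval k n s t v).+1}) v :
    (e v <= interval k n s t v)%N by rewrite -ltnS ltn_ord.
have F0 (e : {dffun forall v : 'I_n, 'I_(interval k n s t v).+1}) :
    ~ sub_closed s t (fun v => e v) -> F e = 0.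
  move=> h; by rewrite /F (chi_grass_empty chiP (bound _) h) mulr0z mul0r.
have F1 u : (s <= u <= t)%N -> F (interval_dim s t u) =
    xpad s * xpad t.+1 / (xpad u * xpad u.+1) * (ypart u / ypart s) * (zpart t / zpart u).
  move=> /andP[su ut].
  have cl : sub_closed s t (fun v => interval_dim s t u v).
    move=> a; rewrite !interval_dimE // !lt0b => /andP[h1 h2] /andP[h3 h4].
    have ha : src a = (tgt a).+1 :> nat := eqP (valP a).
    by rewrite h3 /=; rewrite ha in h2; exact: ltnW.
  rewrite /F (chi_grass_point chiP (bound _) cl).
  rewrite mul1r !big_split /=; congr (_ * _ * _).
  - rewrite -prod_xvar_exponents ?su ?ut //; apply: eq_bigr => r _; congr (_ ^ _).
    rewrite (euler_form_simple_r r (g := fun m => (s <= m < u)%N%:Z)).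
    + rewrite (euler_form_simple_l r (g := fun m => (u <= m < t)%N%:Z)) //.
      move=> v; rewrite !mxE interval_dimE //=; lia.
    + by move=> v; rewrite !mxE interval_dimE.
    by move=> m nm /=; lia.
  - rewrite -(prod_interval yvar_neq0 su); apply: eq_bigr => r _.
    by rewrite interval_dimE.
  rewrite -(prod_interval zvar_neq0 ut); apply: eq_bigr => r _.
  by rewrite interval_dimE //=; congr (_ ^+ _); lia.
(* Exactly one u occurs for the dimension vector e of a submodule; otherwise
   F e = 0. *)
have Fsum (e : {dffun forall v : 'I_n, 'I_(interval k n s t v).+1}) :
    F e = \sum_(s <= u < t.+1) (e == interval_dim s t u)%:R * F e.
  case: (classic (sub_closed s t (fun v => e v))) => cl; last first.
    by rewrite F0 // big1 // => u _; rewrite mulr0.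
  have [u0 su0 Eu0] := sub_closed_interval st (bound e) cl.
  have e0 : e = interval_dim s t u0.
    apply/ffunP => v; apply: val_inj; rewrite /= Eu0.
    by case/andP: su0 => _ h; rewrite interval_dimE.
  rewrite (bigD1_seq u0) ?mem_index_iota ?iota_uniq //=.
  rewrite e0 eqxx mul1r big_seq_cond big1 ?addr0 // => u.
  rewrite mem_index_iota ltnS => /andP[su uu].
  case: eqP => [E|]; last by rewrite mul0r.
  by case/eqP: uu; apply: (interval_dim_inj su su0 tn); rewrite E.
rewrite (eq_bigr _ (fun e _ => Fsum e)) exchange_big /=.
rewrite /interval_value /ssum (big_cat_nat (leq0n s) (leqW st')) /= addrAC subrr add0r mulr_sumr.
rewrite big_nat [RHS]big_nat; apply: eq_bigr => u su.
rewrite (bigD1 (interval_dim s t u)) //= eqxx mul1r big1 ?addr0; last first.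
  by move=> e /negbTE ->; rewrite mul0r.
rewrite F1 //.
by apply: field_reorder; rewrite ?xpad_neq0 ?ypart_neq0 ?zpart_neq0.
Qed.

End CharacterOfInterval.

(** * The multiplication formulas *)

Section CharacterAlgebra.
Variable n : nat.
Local Notation interval_value := (@interval_value n).
Local Notation xpad := (@xpad n).
Local Notation ypart := (@ypart n).
Local Notation zpart := (@zpart n).

Lemma interval_value_ptolemy c a d b :
  interval_value c d * interval_value a.+1 b = interval_value c b * interval_value a.+1 d +
    interval_value d.+1 b * interval_value c a * (ypart d.+1 / ypart a.+1) * (zpart d / zpart a).
Proof.
rewrite /interval_value.
by apply: ptolemy_identity; rewrite ?ypart_neq0 ?zpart_neq0.
Qed.

Lemma interval_value_split c a d :
  interval_value c d * xpad a.+1 = xpad c * interval_value a.+1 d * (ypart a.+1 / ypart c) +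
    xpad d.+1 * interval_value c a * (zpart d / zpart a).
Proof.
rewrite /interval_value.
by apply: split_identity; rewrite ?ypart_neq0 ?zpart_neq0.
Qed.

Lemma ymon_interval (w : 'rV[int]_n) s u : (s <= u)%N ->
  (forall r : 'I_n, w 0 r = (s <= r < u)%N) -> ymon w = ypart u / ypart s.
Proof.
move=> su h; rewrite -(prod_interval (@yvar_neq0 n) su); apply: eq_bigr => r _.
by rewrite h.
Qed.

Lemma zmon_interval (w : 'rV[int]_n) s u : (s <= u)%N ->
  (forall r : 'I_n, w 0 r = (s <= r < u)%N) -> zmon w = zpart u / zpart s.
Proof.
move=> su h; rewrite -(prod_interval (@zvar_neq0 n) su); apply: eq_bigr => r _.
by rewrite h.
Qed.

End CharacterAlgebra.

Section ClusterCharacterValues.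
Variables (k : closedFieldType) (n : nat) (chi : forall N, kset k N -> int).
Hypothesis chiP : euler_characteristic chi.
Variables (C : cluster_category k (linA n)) (X : complex k (linA n) -> cfield n).
Hypothesis XP : cluster_character chi C X.
Variable i0 : 'I_n.

(** A zero object is a direct summand of P_i[1], whose character x_i is invertible. *)
Lemma X_zero Z : zero_obj C Z -> X Z = 1.
Proof.
move=> Z0; have := cc_sum XP (biproduct_zero (shiftc (stalk (projective k i0))) Z0).
rewrite (cc_proj XP) -[LHS]mulr1 => /(mulfI (xvar_neq0 i0)).
by [].
Qed.

Lemma X_iso B B' : iso_obj C B B' -> X B = X B'.
Proof.
move=> BB; have [Z Z0] := tri_zero (cl_tri C).
have b := biproduct_iso (iso_sym BB) (iso_refl C B') (iso_refl C Z) (biproduct_zero B' Z0).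
by rewrite (cc_sum XP b) (X_zero Z0) mulr1.
Qed.

Lemma X_interval_stalk s t : (s <= t <= n)%N ->
  X (interval_stalk k n (-1) s t) = interval_value n s t.
Proof.
move=> /andP[st tn]; move: st; rewrite leq_eqVlt => /orP[/eqP <-|st].
  by rewrite interval_value_empty X_zero //; apply: (fmor_zero (proj (cl_orb C)));
    apply: interval_stalk_zero.
rewrite -(X_iso (proj_iso (stalk_interval_stalk C s t))) (cc_mod XP).
  by rewrite (module_character_interval chiP) // (ltnW st).
by apply: interval_indecomposable; rewrite st.
Qed.

Lemma X_cluster_obj a : (a <= n.+1)%N -> X (cluster_obj k n a n.+1) = xpad n a.
Proof.
have z : zero_obj C (shiftc (interval_stalk k n (-1) 0 0)).
  apply: (fmor_zero (cl_shift C)); apply: (fmor_zero (proj (cl_orb C))).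
  exact: interval_stalk_zero.
rewrite /cluster_obj ltnn => an; case: (leqP a n) => h; last first.
  have -> : a = n.+1 by apply/eqP; rewrite eqn_leq an h.
  by rewrite xpadn1 X_zero.
case: a an h => [|a] _ h; first by rewrite xpad0 X_zero.
rewrite (xpadS (Ordinal h)) -(cc_proj XP); apply: X_iso; apply: iso_sym.
have := shifted_proj_cluster_obj C (Ordinal h).
by rewrite /cluster_obj ltnn /= h.
Qed.

End ClusterCharacterValues.

Theorem theorem3p1 (k : closedFieldType) (n : nat)
    (chi : forall N, kset k N -> int) (chiP : euler_characteristic chi)
    (C : cluster_category k (linA n))
    (X : complex k (linA n) -> cfield n) (XP : cluster_character chi C X)
    (H0 : complex k (linA n) -> rep k (linA n))
    (H0P : forall A, is_H0 C A (H0 A))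
    (M N : complex k (linA n))
    (Mindec : indecomposable C M) (Nindec : indecomposable C N)
    (Ext1 : one_dim (cl_Ext1 C M N))
    (U U' : complex k (linA n))
    (triU : nonsplit_triangle (cl_tri C) N U M)
    (triU' : nonsplit_triangle (cl_tri C) M U' N) :
  (forall VM VN : rep k (linA n),
     iso_obj C M (stalk VM) -> iso_obj C N (stalk VN) ->
     (forall (f : rmor VM VN) v, f v = 0) ->
     (* without this M and N may be interchanged, and the formula fails, e.g. for
        n = 2, M the simple module at 1 and N the simple module at 2 *)
     (forall e : mod_Ext1 C VN VM, e = 0) ->
     exists U3 U4 : rep k (linA n),
       riso (H0 U') (rsum U3 U4) /\
       X N * X M =
         X U + X U' * ymon (dimvec VM - dimvec U3) * zmon (dimvec VN - dimvec U4)) /\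
  (forall (i : 'I_n) (VN : rep k (linA n)),
     iso_obj C M (shiftc (stalk (projective k i))) -> iso_obj C N (stalk VN) ->
     X N * X M =
       X U * ymon (dimvec VN - dimvec (H0 U)) + X U' * zmon (dimvec VN - dimvec (H0 U'))).
Proof.
split.
  move=> VM VN MV NV _ ext0.
  have [a [b [/andP[ab bn] Mi Vi]]] := indecomposable_stalk Mindec MV.
  have [c [d [/andP[cd dn] Ni Wi]]] := indecomposable_stalk Nindec NV.
  have i0 : 'I_n by exact: (Ordinal (leq_trans ab bn)).
  have Mk : iso_obj C M (cluster_obj k n a b) by rewrite /cluster_obj bn.
  have h0 : hom0 (cl_D C) (interval_stalk k n (-1) c d) (shiftc (cluster_obj k n a b)).
    rewrite /cluster_obj bn; apply: hom0_iso ext0.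
      exact: iso_trans (stalk_iso C Wi) (stalk_interval_stalk C c d).
    by apply: shift_iso; apply: iso_trans (stalk_iso C Vi) (stalk_interval_stalk C a b).
  have bnS : b = n.+1 -> (0 < a)%N by move=> e; rewrite e ltnn in bn.
  have [/andP[ca ad] db bU bU'] :=
    exchange_triangles Mk Ni cd dn ab (leqW bn) bnS h0 Ext1 triU triU'.
  case: a ca => // a ca in ab Mi Vi Mk h0 bnS ad bU bU' *.
  rewrite /cluster_obj bn in bU bU'.
  exists (interval k n d.+1 b), (interval k n c a); split.
    apply: (is_H0_uniq (H0P U') (is_H0_stalk C _)).
    exact: biproduct_stalk bU'.
  rewrite (X_iso XP i0 Mi) (X_iso XP i0 Ni) (cc_sum XP bU) (cc_sum XP bU').
  have VMd := riso_dim Vi; have VNd := riso_dim Wi.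
  rewrite (@ymon_interval n _ a.+1 d.+1) ?(leqW ad) //; last first.
    by move=> r; rewrite !mxE VMd /=; lia.
  rewrite (@zmon_interval n _ a d) ?(ltnW ad) //; last first.
    by move=> r; rewrite !mxE VNd /=; lia.
  rewrite !(X_interval_stalk chiP XP i0); try lia.
  exact: interval_value_ptolemy.
move=> i VN Mi NV.
have [c [d [/andP[cd dn] Ni Wi]]] := indecomposable_stalk Nindec NV.
have Mk := iso_trans Mi (shifted_proj_cluster_obj C i).
have h0 : hom0 (cl_D C) (interval_stalk k n (-1) c d) (shiftc (cluster_obj k n i.+1 n.+1)).
  apply: interval_coh_le0; first by rewrite (ltnW cd).
  rewrite /cluster_obj ltnn ltn_ord.
  exact: (coh_le_shift (coh_le_shift (@interval_stalk_coh_le k n C (-1) 0 i.+1))).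
have [/andP[ca ad] db bU bU'] :=
  exchange_triangles Mk Ni cd dn (ltn_ord i : (i.+1 < n.+1)%N) (leqnn _) (fun=> isT) h0 Ext1 triU triU'.
have VNd := riso_dim Wi.
have dimH0 B s t e : biproduct C B (cluster_obj k n e n.+1) (interval_stalk k n (-1) s t) ->
    (e <= n.+1)%N -> forall v, H0 B v = interval k n s t v.
  move=> bB en; apply: riso_dim; apply: (is_H0_uniq (H0P B) _ (iso_refl C B)).
  apply: (is_H0_biproduct (X := stalk (interval k n s t)) _ (is_H0_stalk C _)); last first.
    by move=> v; apply: hom0_proj_cluster_obj en.
  apply: biproduct_iso (iso_refl _ _) _ (iso_refl _ _) (biproduct_swap bB).
  exact/iso_sym/proj_iso/stalk_interval_stalk.
rewrite (X_iso XP i Mk) (X_iso XP i Ni) (cc_sum XP bU) (cc_sum XP bU').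
rewrite (@ymon_interval n _ c i.+1) ?(ltnW ca) //; last first.
  by move=> r; rewrite !mxE VNd (dimH0 _ _ _ _ bU) /=; lia.
rewrite (@zmon_interval n _ i d) ?(ltnW ad) //; last first.
  by move=> r; rewrite !mxE VNd (dimH0 _ _ _ _ bU') /=; lia.
have cn : (c <= n.+1)%N by lia.
have iN : (i.+1 <= n.+1)%N by rewrite ltnS ltnW.
rewrite !(X_cluster_obj XP i) // !(X_interval_stalk chiP XP i); try lia.
exact: interval_value_split.
Qed.
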